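(* Let $f\colon\mathbb R\to\mathbb R$ satisfy conditions (i) and (ii) of the context with some $\varepsilon_\infty>0$, and let $0<\varepsilon<\varepsilon_\infty$. Then for all $x\in\Omega_\varepsilon$ $$\boldsymbol B_\varepsilon(x;f)=\mathfrak B_{\varepsilon,f}(x).$$
   Context: Conditions on $f$: (i) $f\in C^2(\mathbb R)$, and $f''$ is piecewise monotone with only finitely many monotonicity intervals; (ii) the integral $\int_{\mathbb R}e^{-|t|/\varepsilon_\infty}\,df''(t)$ is absolutely convergent. For an interval $J$, $\langle\varphi\rangle_J=\frac1{|J|}\int_J\varphi$. For an interval $I$, $\mathrm{BMO}_\varepsilon(I)$ is the set of $\varphi$ on $I$ with $\sup_{J\subset I}\langle|\varphi-\langle\varphi\rangle_J|^2\rangle_J\le\varepsilon^2$ (supremum over all subintervals $J$ of $I$). $\Omega_\varepsilon=\{x\in\mathbb R^2: x_1^2\le x_2\le x_1^2+\varepsilon^2\}$. The Bellman function on $\Omega_\varepsilon$ (it does not depend on the interval $I$) is $$\boldsymbol B_\varepsilon(x_1,x_2;f)=\sup\{\langle f(\varphi)\rangle_I:\ \langle\varphi\rangle_I=x_1,\ \langle\varphi^2\rangle_I=x_2,\ \varphi\in\mathrm{BMO}_\varepsilon(I)\}.$$ A function on a set $\Omega$ is locally concave if it is concave on every convex subdomain of $\Omega$ (equivalently, on every segment contained in $\Omega$). Let $\Lambda_{\varepsilon,f}$ be the set of continuous locally concave functions $G$ on $\Omega_\varepsilon$ with $G(u,u^2)=f(u)$ for all $u\in\mathbb R$. $\mathfrak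 B_{\varepsilon,f}$ denotes the pointwise minimal function of this class: $\mathfrak B_{\varepsilon,f}(x)=\inf\{G(x):G\in\Lambda_{\varepsilon,f}\}$. *)

(* Defs.v *)
From HB Require Import structures.
From mathcomp Require Import all_boot all_order all_algebra.
From mathcomp Require Import all_classical all_reals all_analysis.

Set Implicit Arguments.
Unset Strict Implicit.
Unset Printing Implicit Defensive.

Import Order.TTheory GRing.Theory Num.Theory.
Import numFieldNormedType.Exports.

Local Open Scope classical_set_scope.
Local Open Scope ring_scope.

Section conditions_on_f.
Context {R : realType}.
Implicit Types f h : R -> R.

Definition C2 f : Prop :=
  [/\ forall x, derivable f x 1, forall x, derivable (derive1 f) x 1
    & continuous (derive1n 2 f)].

Definition piecewise_monotone h : Prop :=
  exists s : seq (interval R),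
    (forall x, exists2 i, i \in s & x \in i) /\
    (forall i, i \in s -> {in i &, {homo h : x y / x <= y}} \/
                          {in i &, {homo h : x y /~ x <= y}}).

(* The first conjunct characterizes V, up to an additive constant, as the
   variation function of h, so that the Lebesgue-Stieltjes measure of V is the
   total variation measure |dh|; dh itself may be an infinite signed measure
   (of locally finite variation), hence not a charge of the library. *)
Definition stieltjes_abs_convergent (w h : R -> R) : Prop :=
  exists V : cumulative R R,
    (forall a b, a <= b -> total_variation a b h = (V b - V a)%:E) /\
    (lebesgue_stieltjes_measure V).-integrable setT (EFin \o w).

Definition condition_i f : Prop := C2 f /\ piecewise_monotone (derive1n 2 f).

Definition condition_ii (eps_inf : R) f : Prop :=
  stieltjes_abs_convergent (fun t => expR (- (`|t| / eps_inf))) (derive1n 2 f).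

End conditions_on_f.

Section bellman.
Context {R : realType}.
Notation mu := (@lebesgue_measure R).
Implicit Types (I J : interval R) (phi f : R -> R) (eps : R).

Definition bounded_nondegenerate I : Prop := (0 < mu [set` I] < +oo)%E.

Definition mean I (phi : R -> R) : \bar R :=
  ((mu [set` I])^-1 * \int[mu]_(t in [set` I]) (phi t)%:E)%E.

(* The averages of phi are finite (phi is integrable on I), so fine loses no
   information; the mean square oscillation is +oo when phi ^+ 2 is not
   integrable on J. Values of phi outside I are irrelevant. *)
Definition BMO eps I : set (R -> R) := [set phi : R -> R |
  mu.-integrable [set` I] (EFin \o phi) /\
  (ereal_sup [set mean J (fun t => `|phi t - fine (mean J phi)| ^+ 2)%R |
      J in [set J | bounded_nondegenerate J /\ [set` J] `<=` [set` I]]]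
    <= (eps ^+ 2)%:E)%E].

Definition Omega eps : set (R * R) :=
  [set x | x.1 ^+ 2 <= x.2 <= x.1 ^+ 2 + eps ^+ 2].

Definition Bellman eps f I (x : R * R) : \bar R :=
  ereal_sup [set mean I (f \o phi) | phi in [set phi |
    [/\ mean I phi = x.1%:E, mean I (fun t => phi t ^+ 2) = x.2%:E
      & BMO eps I phi]]].

End bellman.

Section minimal_locally_concave.
Context {R : realType}.
Implicit Types (f : R -> R) (eps : R) (G : R * R -> R).

Definition concave_on (C : set (R * R)) G : Prop :=
  @convex_function R (R^o * R^o)%type C (fun x => - G x).

Definition locally_concave (D : set (R * R)) G : Prop :=
  forall C : set (R * R), C `<=` D -> @convex_set R (R^o * R^o)%type C ->
    concave_on C G.

Definition Lambda eps f : set (R * R -> R) := [set G |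
  [/\ {within Omega eps, continuous G}, locally_concave (Omega eps) G
    & forall u, G (u, u ^+ 2) = f u]].

Definition min_locally_concave eps f (x : R * R) : \bar R :=
  ereal_inf [set (G x)%:E | G in Lambda eps f].

End minimal_locally_concave.

(* Main.v *)
(* Let Omega be the parabolic strip, G a function of the class Lambda and phi a
   function of BMO.

   Bellman <= G.  When e < d, every interval splits, in a proportion bounded away
   from 0 and 1, so that the segment joining the two mean points of a function
   of BMO_e lies in Omega_d.  For phi bounded of norm < eps, if the mean of f(phi)
   exceeded G at the mean point, so it would, by local concavity, on nested
   intervals shrinking to a point; an open set of small measure covering the
   exceptional null set keeps that point inside the set where Lebesgue's
   differentiation theorem applies, a contradiction.  The case of general phi
   follows by truncating and by multiplying by r < 1, letting r tend to 1;
   integrability of exp(|phi| / eps_inf) comes from the same argument applied to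
   an explicit locally concave function with boundary values exp(u / eps_inf).

   min <= Bellman.  Consider finitely supported distributions all of whose
   quantile windows have variance at most eps^2, that is, the distributions of
   monotone step functions in BMO_eps.  This class is stable under mixing two
   distributions whose mean points are joined by a segment inside Omega.  Hence
   the supremum of the mean of f over the class is locally concave.  It is
   continuous up to the lower boundary, because f - (its tangent) is bounded by
   a hyperbolic cosine, and elsewhere because a bounded locally concave function
   is Lipschitz along the tangents to the upper parabola.  So it belongs to
   Lambda, and it is at most the Bellman function. *)
Require Import Defs.
From mathcomp Require Import all_boot all_order all_algebra.
From mathcomp Require Import all_classical all_reals all_analysis.
From mathcomp Require Import measurable_realfun ring lra.
Import Order.TTheory GRing.Theory Num.Theory.
Import numFieldNormedType.Exports.
Local Open Scope classical_set_scope.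
Local Open Scope ring_scope.

Set Implicit Arguments.
Unset Strict Implicit.
Unset Printing Implicit Defensive.

(** * Discrete distributions *)

(** The obstacle on the lower side is that two functions of BMO_eps on adjacent intervals need not
    glue to a function of BMO_eps, even if the segment between their mean points stays in Omega.
    Superposing the distributions and rearranging monotonically repairs this: a subinterval then
    sees a window of values, so the claim concerns cutting a finite measure from above and from
    below. Cut at level t and look at Y = t - X, of mass p and moments q, r. An atom at t changes p
    only. If r <= 2 e q the variance bound is automatic; if r > 2 e q and e p <= q, lowering p can
    only help. The remaining case, r > 2 e q with e p > q, is excluded by moving t upwards through
    the atoms. On the upper side, splitting needs e < d strictly, whereas G lives on Omega_eps only;
    the factor r < 1 provides the room. For the exponential, the explicit function is taken from a
    still wider strip, so that the square root in it stays positive. *)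

Section discrete_windows.
Context {R : realType}.
Implicit Types (s : seq (R * R)) (lam g h : R -> R) (e t u : R).

Definition disc e (p q r : R) : R := e ^+ 2 * p ^+ 2 - p * r + q ^+ 2.

(** The arguments on the left are the moments of t - X, which has the variance of X. *)
Lemma disc_shift e t p q r :
  disc e p (t * p - q) (t ^+ 2 * p - 2 * t * q + r) = disc e p q r.
Proof. by rewrite /disc; ring. Qed.

Lemma discZ e a p q r : disc e (a * p) (a * q) (a * r) = a ^+ 2 * disc e p q r.
Proof. by rewrite /disc; ring. Qed.

(** [disc e p q r] equals [(e * p - q) ^+ 2 + p * (2 * e * q - r)]. *)
Lemma disc_ge0_small e p q r : 0 <= p -> r <= 2 * e * q -> 0 <= disc e p q r.
Proof.
move=> p0 rq; have := sqr_ge0 (e * p - q).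
have : p * r <= p * (2 * e * q) by exact: ler_wpM2l.
by rewrite /disc; nra.
Qed.

Definition wsum g s : R := \sum_(p <- s) p.2 * g p.1.

Lemma wsum_cat g s1 s2 : wsum g (s1 ++ s2) = wsum g s1 + wsum g s2.
Proof. exact: big_cat. Qed.

Lemma eq_wsum g h s : (forall p, p \in s -> g p.1 = h p.1) -> wsum g s = wsum h s.
Proof. by move=> gh; apply: eq_big_seq => p /gh ->. Qed.

Lemma wsumD g h s : wsum (fun x => g x + h x) s = wsum g s + wsum h s.
Proof. by rewrite -big_split; apply: eq_bigr => p _; rewrite mulrDr. Qed.

Lemma wsumZ c g s : wsum (fun x => c * g x) s = c * wsum g s.
Proof. by rewrite big_distrr; apply: eq_bigr => p _; rewrite mulrCA. Qed.

Definition nonneg s := forall p, p \in s -> 0 <= p.2.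

Lemma wsum_ge0 g s : nonneg s -> (forall p, p \in s -> 0 <= g p.1) ->
  0 <= wsum g s.
Proof.
move=> s0 g0; rewrite /wsum big_seq sumr_ge0// => p ps.
by rewrite mulr_ge0 ?s0 ?g0.
Qed.

Definition scale lam s := [seq (p.1, lam p.1 * p.2) | p <- s].

Lemma wsum_scale g lam s : wsum g (scale lam s) = wsum (fun x => lam x * g x) s.
Proof. by rewrite /wsum big_map; apply: eq_bigr => p _ /=; ring. Qed.

Definition reflect_values s := [seq (- p.1, p.2) | p <- s].

Lemma wsum_reflect g s : wsum g (reflect_values s) = wsum (fun x => g (- x)) s.
Proof. by rewrite /wsum big_map. Qed.

(* The profile of the restriction of a monotone function to a subinterval: only
   the two extreme values may lose a part of their mass. *)
Definition window lam := (forall x, 0 <= lam x <= 1) /\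
  (forall x y z, x < y < z -> 0 < lam x -> 0 < lam z -> lam y = 1).

Definition disc_sum e lam s := disc e (wsum lam s) (wsum (fun x => lam x * x) s)
  (wsum (fun x => lam x * x ^+ 2) s).

Definition monotone_bmo e s :=
  nonneg s /\ forall lam, window lam -> 0 <= disc_sum e lam s.

(** For unit masses this says that the segment joining the two mean points stays below the upper
    parabola. *)
Definition pair_ok e s1 s2 := forall a b, 0 <= a -> 0 <= b ->
  0 <= disc e (a * wsum (cst 1) s1 + b * wsum (cst 1) s2)
              (a * wsum id s1 + b * wsum id s2)
              (a * wsum (fun x => x ^+ 2) s1 + b * wsum (fun x => x ^+ 2) s2).

End discrete_windows.

(** * Cutoffs and the tangent estimates that control them *)

Section mixtures.
Context {R : realType}.
Implicit Types (s : seq (R * R)) (lam g h : R -> R) (e t u : R).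

(** On a finite support every window is a cutoff from above times a cutoff from below; [theta]
    accounts for an end of the subinterval falling inside the cell of the value [t]. *)
Definition cutoff t (theta : R) x : R :=
  if x < t then 1 else if x == t then theta else 0.

Lemma window_cutoff t theta : 0 <= theta <= 1 -> window (cutoff t theta).
Proof.
move=> th; split=> [x|x y z /andP[xy yz] _]; rewrite /cutoff.
  by case: ifP => _; [rewrite ler01 lexx|case: ifP; rewrite ?lexx ?ler01].
case: (ltgtP z t) => [zt _|zt|zt _]; last by rewrite -zt yz.
  by rewrite (lt_trans yz zt).
by rewrite ltxx.
Qed.

Lemma windowM lam1 lam2 : window lam1 -> window lam2 ->
  window (fun x => lam1 x * lam2 x).
Proof.
move=> [b1 w1] [b2 w2]; split=> [x|x y z xyz].
  have := b1 x; have := b2 x; nra.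
have pos a : 0 < lam1 a * lam2 a -> 0 < lam1 a /\ 0 < lam2 a.
  move: (b1 a) (b2 a) => /andP[la _] /andP[lb _].
  rewrite !lt0r la lb !andbT mulf_eq0 negb_or.
  by move=> /andP[/andP[-> ->]].
by move=> /pos[x1 x2] /pos[z1 z2]; rewrite (w1 x y z) ?(w2 x y z) ?mulr1.
Qed.

Lemma window_opp lam : window lam -> window (fun x => lam (- x)).
Proof.
move=> [b w]; split=> [x|x y z /andP[xy yz] lx lz]; first exact: b.
by apply: (w (- z) (- y) (- x)); rewrite ?ltrN2 ?xy ?yz.
Qed.

Lemma nonneg_scale lam s : (forall x, 0 <= lam x) -> nonneg s ->
  nonneg (scale lam s).
Proof. by move=> l0 s0 _ /mapP[p ps ->]/=; rewrite mulr_ge0 ?s0. Qed.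

Lemma nonneg_reflect s : nonneg s -> nonneg (reflect_values s).
Proof. by move=> s0 _ /mapP[p ps ->]/=; rewrite s0. Qed.

Lemma nonneg_cat s1 s2 : nonneg s1 -> nonneg s2 -> nonneg (s1 ++ s2).
Proof. by move=> h1 h2 p; rewrite mem_cat => /orP[/h1|/h2]. Qed.

Lemma monotone_bmo_scale e lam s : window lam -> monotone_bmo e s ->
  monotone_bmo e (scale lam s).
Proof.
move=> wl [s0 sP]; split.
  by apply: nonneg_scale => // x; case: wl => /(_ x)/andP[].
move=> mu wmu; rewrite [disc_sum _ _ _](_ : _ =
  disc_sum e (fun x => lam x * mu x) s); first exact/sP/windowM.
rewrite /disc_sum !wsum_scale.
by congr (disc _ _ _ _); apply: eq_wsum => p _; rewrite ?mulrA.
Qed.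

Lemma monotone_bmo_scale_cst e c s : 0 <= c -> monotone_bmo e s ->
  monotone_bmo e (scale (cst c) s).
Proof.
move=> c0 [s0 sP]; split; first exact: nonneg_scale.
move=> mu /sP; rewrite /disc_sum !wsum_scale /= !wsumZ discZ => h.
by rewrite mulr_ge0 ?sqr_ge0.
Qed.

Lemma monotone_bmo_reflect e s : monotone_bmo e s ->
  monotone_bmo e (reflect_values s).
Proof.
move=> [s0 sP]; split; first exact: nonneg_reflect.
move=> mu /window_opp/sP; rewrite /disc_sum !wsum_reflect /disc.
have -> : wsum (fun x => mu (- x) * (- x) ^+ 2) s =
    wsum (fun x => mu (- x) * x ^+ 2) s.
  by apply: eq_wsum => p _; rewrite sqrrN.
have -> : wsum (fun x => mu (- x) * x) s = - wsum (fun x => mu (- x) * - x) s.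
  by rewrite -mulN1r -wsumZ; apply: eq_wsum => p _; ring.
by rewrite sqrrN.
Qed.

Lemma pair_ok_reflect e s1 s2 : pair_ok e s1 s2 ->
  pair_ok e (reflect_values s1) (reflect_values s2).
Proof.
move=> ok a b a0 b0; have := ok _ _ a0 b0.
rewrite !wsum_reflect /=.
have wN s : wsum (fun x : R => - x) s = - wsum id s.
  by rewrite -mulN1r -wsumZ; apply: eq_wsum => p _; rewrite mulN1r.
have w2 s : wsum (fun x : R => (- x) ^+ 2) s = wsum (fun x => x ^+ 2) s.
  by apply: eq_wsum => p _; rewrite sqrrN.
rewrite !wN !w2 (_ : wsum (fun x => cst 1 (- x)) s1 = wsum (cst 1) s1)//.
rewrite (_ : wsum (fun x => cst 1 (- x)) s2 = wsum (cst 1) s2)//.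
by rewrite /disc !mulrN -opprD sqrrN.
Qed.

Lemma seq_min_exists (l : seq R) : l != [::] ->
  exists2 x, x \in l & forall y, y \in l -> x <= y.
Proof.
elim: l => // a [_ _|b l /(_ isT)[x xl xm] _].
  by exists a; rewrite ?mem_head// => y; rewrite inE => /eqP ->.
have [ax|xa] := leP a x.
  exists a; rewrite ?mem_head// => y; rewrite inE => /predU1P[->//|/xm].
  exact: le_trans.
exists x; first by rewrite inE xl orbT.
by move=> y; rewrite inE => /predU1P[->|/xm//]; exact: ltW.
Qed.

Lemma seq_max_exists (l : seq R) : l != [::] ->
  exists2 x, x \in l & forall y, y \in l -> y <= x.
Proof.
case: l => // a l _.
have [|x] := @seq_min_exists (map -%R (a :: l)); first by [].
move=> /mapP[y yl ->] ym; exists y => // z zl.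
by rewrite -lerN2 ym ?map_f.
Qed.

(* For a random variable X in the class with X <= t, Y = t - X, either
   E Y >= e or E Y^2 <= 2 e E Y: the mean point of X is not above the left
   tangent to the upper parabola through (t, t^2). *)
Definition below_tangent e p q r := r <= 2 * e * q \/ e * p <= q.

(** Raising the cutting level by [d] replaces Y by d + Y. *)
Lemma below_tangent_shift e p q r d : 0 < e -> 0 <= d -> 0 <= p ->
  below_tangent e p q r ->
  below_tangent e p (d * p + q) (d ^+ 2 * p + 2 * d * q + r).
Proof.
move=> e0 d0 p0 [rq|pq].
  have [|lt] := leP (e * p) (d * p + q); first by right.
  by left; have := mulr_ge0 d0 p0; nra.
by right; have := mulr_ge0 d0 p0; lra.
Qed.

(** The new mass sits at Y = 0, hence changes [p] only. If the line q = e p were crossed while r > 2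
    e q, then at the crossing mass P > 0 the value of [disc] would be P (2 e q - r) < 0. *)
Lemma below_tangent_addmass e p q r m : 0 < e -> 0 <= p -> 0 <= q -> 0 <= m ->
  (p = 0 -> r <= 0) ->
  (forall th, 0 <= th <= 1 -> 0 <= disc e (p + th * m) q r) ->
  below_tangent e p q r -> below_tangent e (p + m) q r.
Proof.
move=> e0 p0 q0 m0 pr H [rq|pq]; first by left.
have [|rq] := leP r (2 * e * q); first by left.
right; rewrite leNgt; apply/negP => lt.
have m_gt0 : 0 < m.
  rewrite lt0r m0 andbT; apply/negP => /eqP m1; move: lt.
  by rewrite m1 addr0 ltNge pq.
have [mu mu01 qmu] : exists2 th, 0 <= th <= 1 & q = e * (p + th * m).
  exists ((q - e * p) / (e * m)).
    apply/andP; split; first by rewrite divr_ge0 ?subr_ge0// mulr_ge0 ?ltW.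
    by rewrite ler_pdivrMr ?mulr_gt0// mul1r lerBlDl -mulrDr ltW.
  by field; rewrite !gt_eqF.
have := H _ mu01; rewrite /disc; set P := p + mu * m.
have P0 : 0 <= P by move: mu01 => /andP[? ?]; rewrite addr_ge0 ?mulr_ge0.
have [PE|Pn] := eqVneq P 0.
  have q00 : q = 0 by rewrite qmu -/P PE mulr0.
  have p00 : p = 0.
    move: PE mu01; rewrite /P => PE /andP[mu0 _].
    by have := mulr_ge0 mu0 m0; lra.
  by have := pr p00; move: rq; rewrite q00 mulr0; lra.
have Pgt : 0 < P by rewrite lt0r Pn.
have : P * (2 * e * q) < P * r by rewrite ltr_pM2l.
by rewrite qmu -/P; nra.
Qed.

(* Raising the weight of the second summand from 0 to b, the combination would
   have to meet the line q = e * p while r > 2 * e * q. *)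
Lemma combo_above_line e a b p1 q1 r1 p2 q2 r2 : 0 < e ->
  0 < a -> 0 <= b -> 0 <= p1 -> 0 <= p2 ->
  (p1 = 0 -> r1 <= 2 * e * q1) ->
  (forall b', 0 <= b' -> 0 <= disc e (a * p1 + b' * p2) (a * q1 + b' * q2)
     (a * r1 + b' * r2)) ->
  2 * e * q1 < r1 -> e * p1 <= q1 ->
  2 * e * (a * q1 + b * q2) < a * r1 + b * r2 ->
  e * (a * p1 + b * p2) <= a * q1 + b * q2.
Proof.
move=> e0 a0 b0 p10 p20 pr H rq1 pq1 rq; rewrite leNgt; apply/negP => lt.
set d1 := q1 - e * p1; set d2 := q2 - e * p2.
have d10 : 0 <= d1 by rewrite /d1; lra.
have ad10 : 0 <= a * d1 by rewrite mulr_ge0// ltW.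
have Dlt : a * d1 + b * d2 < 0 by rewrite /d1 /d2; lra.
have d20 : d2 < 0.
  rewrite ltNge; apply/negP => d20; have := mulr_ge0 b0 d20; lra.
pose b' := a * d1 / - d2.
have b'0 : 0 <= b' by rewrite divr_ge0// oppr_ge0 ltW.
have b'b : b' < b by rewrite ltr_pdivrMr ?oppr_gt0//; lra.
have b'E : a * d1 + b' * d2 = 0 by rewrite /b'; field; lra.
have := H _ b'0; rewrite /disc.
set P := a * p1 + b' * p2; set Q := a * q1 + b' * q2; set S := a * r1 + b' * r2.
have QE : Q = e * P by move: b'E; rewrite /Q /P /d1 /d2; lra.
have SQ : 2 * e * Q < S.
  rewrite -subr_gt0 /S /Q; set e1 := r1 - 2 * e * q1; set e2 := r2 - 2 * e * q2.
  have e10 : 0 < a * e1 by rewrite mulr_gt0// /e1; lra.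
  have e12 : 0 < a * e1 + b * e2 by rewrite /e1 /e2; lra.
  suff : 0 < a * e1 + b' * e2 by rewrite /e1 /e2; lra.
  have [e20|e20] := leP 0 e2; first by rewrite ltr_wpDr// mulr_ge0.
  have : b * e2 < b' * e2 by rewrite ltr_nM2r.
  by lra.
have P0 : 0 < P.
  have p1_gt0 : 0 < p1.
    by rewrite lt0r p10 andbT; apply/eqP => /pr; rewrite leNgt rq1.
  by rewrite /P ltr_wpDr ?mulr_gt0// mulr_ge0.
have : P * (2 * e * Q) < P * S by rewrite ltr_pM2l.
by rewrite QE; nra.
Qed.

(** As a function of the mass, [disc] is a parabola with vertex at [r / (2 * e ^+ 2)]. The
    hypotheses put [p] to the left of the vertex, where the parabola decreases. *)
Lemma disc_le_mass e p p' q r : 0 < e -> 0 <= p' <= p -> e * p <= q ->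
  2 * e * q < r -> 0 <= disc e p q r -> 0 <= disc e p' q r.
Proof.
move=> e0 /andP[p'0 p'p] pq rq /le_trans; apply; rewrite -subr_ge0 /disc.
suff : 0 <= (p - p') * (r - e ^+ 2 * (p + p')) by lra.
rewrite mulr_ge0 ?subr_ge0//.
have : e * (e * p) <= e * q by rewrite ler_pM2l.
have : e * (e * p') <= e * (e * p) by rewrite !ler_pM2l.
by lra.
Qed.

(** The atoms [m1], [m2] sit at Y = 0. Unless the combination satisfies r <= 2 e q, one of the
    summands with nonzero weight has r > 2 e q, hence e p <= q; it takes the leading role in
    [combo_above_line], and the whole combination is then in the range of [disc_le_mass]. *)
Lemma disc_shrink_top_atom e a b p1 q1 r1 m1 p2 q2 r2 m2 th : 0 < e ->
  0 <= p1 -> 0 <= p2 -> 0 <= m1 -> 0 <= m2 -> 0 <= q1 -> 0 <= q2 ->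
  (p1 = 0 -> r1 <= 0) -> (p2 = 0 -> r2 <= 0) ->
  below_tangent e (p1 + m1) q1 r1 -> below_tangent e (p2 + m2) q2 r2 ->
  (forall a b, 0 <= a -> 0 <= b -> 0 <= disc e
     (a * (p1 + m1) + b * (p2 + m2)) (a * q1 + b * q2) (a * r1 + b * r2)) ->
  0 <= a -> 0 <= b -> 0 <= th <= 1 ->
  0 <= disc e (a * (p1 + th * m1) + b * (p2 + th * m2))
     (a * q1 + b * q2) (a * r1 + b * r2).
Proof.
move=> e0 p10 p20 m10 m20 q10 q20 pr1 pr2 H1 H2 H a0 b0 /andP[th0 th1].
have le_mass p m : 0 <= p -> 0 <= m -> 0 <= p + th * m <= p + m.
  move=> ? ?; rewrite addr_ge0 ?mulr_ge0//= lerD2l.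
  by rewrite -[leRHS]mul1r ler_wpM2r.
have /andP[P10 P11] := le_mass _ _ p10 m10.
have /andP[P20 P21] := le_mass _ _ p20 m20.
have [rq|rq] := leP (a * r1 + b * r2) (2 * e * (a * q1 + b * q2)).
  by apply: disc_ge0_small => //; rewrite addr_ge0// mulr_ge0.
apply: (@disc_le_mass _ (a * (p1 + m1) + b * (p2 + m2))) => //; last exact: H.
  by rewrite addr_ge0 ?mulr_ge0//= lerD ?ler_wpM2l.
have pz (p m q r : R) : 0 <= p -> 0 <= m -> 0 <= q -> (p = 0 -> r <= 0) ->
    p + m = 0 -> r <= 2 * e * q.
  move=> p0 m0 q0 pr pm; have /pr : p = 0 by lra.
  by move=> /le_trans; apply; rewrite !mulr_ge0// ltW.
have [r1q|r1q] := leP r1 (2 * e * q1); last first.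
  case: H1 => [|pq1]; first by rewrite leNgt r1q.
  have [az|an] := eqVneq a 0.
    move: rq; rewrite az !mul0r !add0r => rq.
    have [bz|bn] := eqVneq b 0; first by move: rq; rewrite bz !mul0r mulr0 ltxx.
    have b_gt0 : 0 < b by rewrite lt0r bn.
    case: H2 => [r2le|pq2]; last by rewrite mulrCA ler_wpM2l.
    by move: rq; rewrite mulrCA ltr_pM2l// ltNge r2le.
  apply: (@combo_above_line _ _ _ _ _ r1 _ _ r2) => //; rewrite ?addr_ge0//.
  - by rewrite lt0r an.
  - exact: pz.
  - by move=> b' b'0; exact: H.
have [r2q|r2q] := leP r2 (2 * e * q2).
  have : a * r1 <= a * (2 * e * q1) by rewrite ler_wpM2l.
  have : b * r2 <= b * (2 * e * q2) by rewrite ler_wpM2l.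
  by lra.
case: H2 => [|pq2]; first by rewrite leNgt r2q.
have [bz|bn] := eqVneq b 0.
  have : a * r1 <= a * (2 * e * q1) by rewrite ler_wpM2l.
  by move: rq; rewrite bz; lra.
rewrite addrC [leRHS]addrC.
apply: (@combo_above_line _ _ _ _ _ r2 _ _ r1) => //; rewrite ?addr_ge0//.
- by rewrite lt0r bn.
- exact: pz.
- move=> b' b'0; rewrite addrC [_ + b' * q1]addrC [_ + b' * r1]addrC; exact: H.
- by rewrite [_ + a * q1]addrC [_ + a * r1]addrC.
Qed.

End mixtures.

(** * Stability of the monotone class under mixing *)

Section mixture_theorem.
Context {R : realType}.
Implicit Types (s : seq (R * R)) (lam g h : R -> R) (e t u : R).

(** The k-th moment of t - X over X < t. Measuring from t makes the atom at t contribute to the mass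
    alone. *)
Definition cutm k t s := wsum (fun x => cutoff t 0 x * (t - x) ^+ k) s.
Definition atom t s := wsum (fun x => (x == t)%:R) s.

Lemma cutoffE t th x : cutoff t th x = cutoff t 0 x + th * (x == t)%:R.
Proof. by rewrite /cutoff; case: (ltgtP x t) => _ /=; ring. Qed.

Lemma wsum_cutoff t th s :
  wsum (cutoff t th) s = cutm 0 t s + th * atom t s.
Proof.
rewrite /cutm /atom -wsumZ -wsumD; apply: eq_wsum => p _.
by rewrite cutoffE expr0 mulr1.
Qed.

Lemma wsum_cutoff1 t th s : wsum (fun x => cutoff t th x * x) s =
  t * (cutm 0 t s + th * atom t s) - cutm 1 t s.
Proof.
rewrite -wsum_cutoff -mulN1r /cutm -!wsumZ -wsumD; apply: eq_wsum => p _.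
by rewrite /cutoff; case: (ltgtP p.1 t) => [_|_|->] /=; ring.
Qed.

Lemma wsum_cutoff2 t th s : wsum (fun x => cutoff t th x * x ^+ 2) s =
  t ^+ 2 * (cutm 0 t s + th * atom t s) - 2 * t * cutm 1 t s + cutm 2 t s.
Proof.
rewrite -wsum_cutoff -mulNr /cutm -!wsumZ -!wsumD; apply: eq_wsum => p _.
by rewrite /cutoff; case: (ltgtP p.1 t) => [_|_|->] /=; ring.
Qed.

Lemma disc_sum_cutoff e t th s : disc_sum e (cutoff t th) s =
  disc e (cutm 0 t s + th * atom t s) (cutm 1 t s) (cutm 2 t s).
Proof. by rewrite /disc_sum wsum_cutoff wsum_cutoff1 wsum_cutoff2 disc_shift. Qed.

Lemma cutm_ge0 k t s : nonneg s -> 0 <= cutm k t s.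
Proof.
move=> s0; apply: wsum_ge0 => // p _; rewrite /cutoff.
case: (ltP p.1 t) => [pt|_]; first by rewrite mul1r exprn_ge0// subr_ge0 ltW.
by case: ifP; rewrite mul0r.
Qed.

Lemma atom_ge0 t s : nonneg s -> 0 <= atom t s.
Proof. by move=> s0; apply: wsum_ge0 => // p _; rewrite ler0n. Qed.

Lemma cutm0_eq0 t s : nonneg s -> cutm 0 t s = 0 -> cutm 2 t s <= 0.
Proof.
move=> s0 /eqP; rewrite /cutm /wsum big_seq psumr_eq0 => [/allP z|p ps].
  rewrite big_seq big1// => p ps; have := z p ps.
  by rewrite ps expr0 mulr1 mulf_eq0 => /orP[/eqP->|/eqP->];
    rewrite ?(mul0r, mulr0).
rewrite mulr_ge0 ?s0// expr0 mulr1 /cutoff.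
by case: ifP => // _; case: ifP.
Qed.

(** Decrease of the induction measure when the cutting level moves down to an atom. *)
Lemma count_lt_trans s t t' : t' \in [seq p.1 | p <- s] -> t' < t ->
  (count (fun p => (p.1 < t')%R) s < count (fun p => (p.1 < t)%R) s)%N.
Proof.
elim: s => //= p s IH; rewrite inE => /predU1P[->|/IH{}IH] t't.
  rewrite t't ltxx add0n add1n ltnS; apply: sub_count => q /= /lt_trans; exact.
rewrite -addnS leq_add ?IH//; case: (ltP p.1 t') => // pt'.
by rewrite (lt_trans pt' t't).
Qed.

Lemma count_gt_trans s t t' : t' \in [seq p.1 | p <- s] -> t < t' ->
  (count (fun p => (t' < p.1)%R) s < count (fun p => (t < p.1)%R) s)%N.
Proof.
elim: s => //= p s IH; rewrite inE => /predU1P[->|/IH{}IH] t't.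
  rewrite t't ltxx add0n add1n ltnS; apply: sub_count => q /=; exact: lt_trans.
rewrite -addnS leq_add ?IH//; case: (ltP t' p.1) => // pt'.
by rewrite (lt_trans t't pt').
Qed.

(** No value lies strictly between [t'] and [t], so cutting below [t] amounts to cutting at [t']
    with its whole atom kept. *)
Lemma cutm_step k t t' s : t' < t ->
  (forall p, p \in s -> p.1 < t -> p.1 <= t') ->
  cutm k t s = wsum (fun x => cutoff t' 1 x * ((t - t') + (t' - x)) ^+ k) s.
Proof.
move=> t't maxt'; apply: eq_wsum => p ps; rewrite subrKA; congr (_ * _).
rewrite /cutoff; have := maxt' p ps.
case: (ltP p.1 t) => [pt /(_ isT)|tp _]; first by case: ltgtP.
by rewrite [p.1 < t']ltNge [p.1 == t']gt_eqF ?(lt_le_trans t't)// ltW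
  ?(lt_le_trans t't)//; case: ifP.
Qed.

Lemma below_tangent_atom e t s : 0 < e -> monotone_bmo e s ->
  below_tangent e (cutm 0 t s) (cutm 1 t s) (cutm 2 t s) ->
  below_tangent e (cutm 0 t s + atom t s) (cutm 1 t s) (cutm 2 t s).
Proof.
move=> e0 [s0 sP] H; apply: below_tangent_addmass => //.
- exact: cutm_ge0.
- exact: cutm_ge0.
- exact: atom_ge0.
- exact: cutm0_eq0.
- by move=> th /window_cutoff w; rewrite -disc_sum_cutoff; exact: sP.
Qed.

(** Induction on the number of atoms below [t]: from the next lower value [t'], first absorb its
    atom at level [t'], then raise the level to [t]. Below the support all moments vanish. *)
Lemma below_tangentP e s t : 0 < e -> monotone_bmo e s ->
  below_tangent e (cutm 0 t s) (cutm 1 t s) (cutm 2 t s).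
Proof.
move=> e0 sM; have [n] := ubnP (count (fun p => p.1 < t) s).
elim: n t => // n IH t; rewrite ltnS => cn.
have [/hasP[p0 p0s p0t]|/hasPn ts] := boolP (has (fun p => p.1 < t) s); last first.
  left; suff z k : cutm k t s = 0 by rewrite !z mulr0.
  rewrite /cutm /wsum big_seq big1// => p /ts; rewrite /cutoff => /negbTE ->.
  by case: ifP; rewrite mul0r mulr0.
have [|t' t'l t'max] := @seq_max_exists R [seq p.1 | p <- s & p.1 < t].
  rewrite -size_eq0 size_map size_filter -lt0n -has_count.
  by apply/hasP; exists p0.
have /mapP[p] := t'l; rewrite mem_filter => /andP[pt ps] t'p.
have t't : t' < t by rewrite t'p.
have t's : t' \in [seq p.1 | p <- s] by rewrite t'p map_f.
have {}t'max q : q \in s -> q.1 < t -> q.1 <= t'.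
  by move=> qs qt; apply: t'max; apply: map_f; rewrite mem_filter qt.
have := below_tangent_atom e0 sM (IH t' (leq_trans (count_lt_trans t's t't) cn)).
have /(below_tangent_shift e0) : 0 <= t - t' by rewrite subr_ge0 ltW.
have [s0 _] := sM.
move=> /[apply] /(_ (addr_ge0 (cutm_ge0 0 t' s0) (atom_ge0 t' s0))).
rewrite !(cutm_step _ t't)//.
have E0 : wsum (fun x => cutoff t' 1 x * (t - t' + (t' - x)) ^+ 0) s =
    cutm 0 t' s + atom t' s.
  by rewrite -[atom _ _]mul1r -wsum_cutoff; apply: eq_wsum => q _; rewrite mulr1.
have [E1 E2] : wsum (fun x => cutoff t' 1 x * (t - t' + (t' - x)) ^+ 1) s =
    (t - t') * (cutm 0 t' s + atom t' s) + cutm 1 t' s /\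
  wsum (fun x => cutoff t' 1 x * (t - t' + (t' - x)) ^+ 2) s =
    (t - t') ^+ 2 * (cutm 0 t' s + atom t' s) +
    2 * (t - t') * cutm 1 t' s + cutm 2 t' s.
  rewrite -E0 /cutm -!wsumZ -!wsumD; split; apply: eq_wsum => q _;
    rewrite /cutoff; by case: (ltgtP q.1 t') => [_|_|->] /=; ring.
by rewrite E0 E1 E2.
Qed.

Lemma pair_ok_eq_wsum e s1 s2 lam1 lam2 :
  (forall p, p \in s1 ++ s2 -> lam1 p.1 = lam2 p.1) ->
  pair_ok e (scale lam1 s1) (scale lam1 s2) ->
  pair_ok e (scale lam2 s1) (scale lam2 s2).
Proof.
move=> E.
have E1 : scale lam1 s1 = scale lam2 s1.
  by apply/eq_in_map => p ps; rewrite E ?mem_cat ?ps.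
have E2 : scale lam1 s2 = scale lam2 s2.
  by apply/eq_in_map => p ps; rewrite E ?mem_cat ?ps ?orbT.
by rewrite E1 E2.
Qed.

Lemma pair_ok_cutoffE e t th s1 s2 :
  pair_ok e (scale (cutoff t th) s1) (scale (cutoff t th) s2) <->
  (forall a b, 0 <= a -> 0 <= b -> 0 <= disc e
     (a * (cutm 0 t s1 + th * atom t s1) + b * (cutm 0 t s2 + th * atom t s2))
     (a * cutm 1 t s1 + b * cutm 1 t s2) (a * cutm 2 t s1 + b * cutm 2 t s2)).
Proof.
have E a b : disc e
    (a * wsum (cst 1) (scale (cutoff t th) s1) +
     b * wsum (cst 1) (scale (cutoff t th) s2))
    (a * wsum id (scale (cutoff t th) s1) + b * wsum id (scale (cutoff t th) s2))
    (a * wsum (fun x => x ^+ 2) (scale (cutoff t th) s1) +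
     b * wsum (fun x => x ^+ 2) (scale (cutoff t th) s2)) = disc e
     (a * (cutm 0 t s1 + th * atom t s1) + b * (cutm 0 t s2 + th * atom t s2))
     (a * cutm 1 t s1 + b * cutm 1 t s2) (a * cutm 2 t s1 + b * cutm 2 t s2).
  rewrite !wsum_scale !wsum_cutoff1 !wsum_cutoff2.
  have W s : wsum (fun x => cutoff t th x * cst 1 x) s =
      cutm 0 t s + th * atom t s.
    by rewrite -wsum_cutoff; apply: eq_wsum => p _; rewrite mulr1.
  by rewrite !W -(disc_shift e t); congr (disc _ _ _ _); ring.
by split=> h a b a0 b0; have := h a b a0 b0; rewrite E.
Qed.

(** Induction on the number of atoms above [t]: removing the lowest of them completely, once the
    higher ones are gone, leaves exactly the cutoff that keeps all of [t]. *)
Lemma pair_ok_cutoff_top e s1 s2 t th : 0 < e -> monotone_bmo e s1 ->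
  monotone_bmo e s2 -> pair_ok e s1 s2 -> 0 <= th <= 1 ->
  pair_ok e (scale (cutoff t th) s1) (scale (cutoff t th) s2).
Proof.
move=> e0 m1 m2 ok th01; have [s10 _] := m1; have [s20 _] := m2.
have step u : pair_ok e (scale (cutoff u 1) s1) (scale (cutoff u 1) s2) ->
    forall v, 0 <= v <= 1 ->
    pair_ok e (scale (cutoff u v) s1) (scale (cutoff u v) s2).
  move=> /pair_ok_cutoffE; rewrite !mul1r => H v v01.
  apply/pair_ok_cutoffE => a b a0 b0; apply: disc_shrink_top_atom => //;
    do ?[exact: cutm_ge0|exact: atom_ge0|exact: cutm0_eq0];
    by apply: below_tangent_atom => //; exact: below_tangentP.
apply: (step t _ th) => // {th th01}.
have [n] := ubnP (count (fun p => t < p.1) (s1 ++ s2)).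
elim: n t => // n IH t; rewrite ltnS => cn.
have [/hasP[p0 p0s p0t]|/hasPn ts] :=
    boolP (has (fun p => t < p.1) (s1 ++ s2)); last first.
  have scale1 s : (forall p, p \in s -> cutoff t 1 p.1 = 1) ->
      scale (cutoff t 1) s = s.
    move=> E; rewrite -[RHS]map_id; apply/eq_in_map => -[x y] /E /= ->.
    by rewrite mul1r.
  have cut1 p : p \in s1 ++ s2 -> cutoff t 1 p.1 = 1.
    by move=> /ts; rewrite /cutoff; case: ltgtP.
  by rewrite !scale1// => p ps; rewrite cut1// mem_cat ps ?orbT.
have [|t' t'l t'min] :=
    @seq_min_exists R [seq p.1 | p <- (s1 ++ s2) & t < p.1].
  rewrite -size_eq0 size_map size_filter -lt0n -has_count.
  by apply/hasP; exists p0.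
have /mapP[p] := t'l; rewrite mem_filter => /andP[pt ps] t'p.
have t't : t < t' by rewrite t'p.
have t's : t' \in [seq p.1 | p <- s1 ++ s2] by rewrite t'p map_f.
have /step/(_ 0) := IH t' (leq_trans (count_gt_trans t's t't) cn).
rewrite lexx ler01 => /(_ isT); apply: pair_ok_eq_wsum => q qs.
rewrite /cutoff; case: (ltgtP q.1 t) => [qt|tq|->]; last by rewrite t't.
  by rewrite (lt_trans qt t't).
rewrite ltNge (t'min q.1) ?map_f ?mem_filter ?tq//=.
by case: ifP.
Qed.

Lemma pair_ok_cutoff_bot e s1 s2 t th : 0 < e -> monotone_bmo e s1 ->
  monotone_bmo e s2 -> pair_ok e s1 s2 -> 0 <= th <= 1 ->
  pair_ok e (scale (fun x => cutoff t th (- x)) s1)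
            (scale (fun x => cutoff t th (- x)) s2).
Proof.
move=> e0 /monotone_bmo_reflect m1 /monotone_bmo_reflect m2.
move=> /pair_ok_reflect ok th01.
have /pair_ok_reflect := pair_ok_cutoff_top t e0 m1 m2 ok th01.
have E s : reflect_values (scale (cutoff t th) (reflect_values s)) =
    scale (fun x => cutoff t th (- x)) s.
  rewrite /reflect_values /scale -!map_comp; apply: eq_map => p /=.
  by rewrite opprK.
by rewrite !E.
Qed.

Lemma scale_scale lam1 lam2 s :
  scale lam1 (scale lam2 s) = scale (fun x => lam1 x * lam2 x) s.
Proof. by rewrite /scale -map_comp; apply: eq_map => p /=; rewrite mulrA. Qed.

(** A window of the mixture is obtained by trimming from below and then from above. Trimming keeps
    both pieces in the class and the pair admissible, so the second trimming applies to the result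
    of the first. *)
Lemma monotone_bmo_cat e s1 s2 : 0 < e -> monotone_bmo e s1 ->
  monotone_bmo e s2 -> pair_ok e s1 s2 -> monotone_bmo e (s1 ++ s2).
Proof.
move=> e0 m1 m2 ok; split=> [|lam wlam].
  by case: m1 m2 => s10 _ [s20 _]; exact: nonneg_cat.
suff [mu muE oks] : exists2 mu, (forall p, p \in s1 ++ s2 -> mu p.1 = lam p.1) &
    pair_ok e (scale mu s1) (scale mu s2).
  have := oks 1 1 ler01 ler01; rewrite !mul1r -!wsum_cat -!map_cat.
  rewrite (_ : map _ _ = scale lam (s1 ++ s2)); last first.
    by apply/eq_in_map => p ps; rewrite muE.
  rewrite !wsum_scale /disc_sum.
  by under [X in disc _ X _ _]eq_wsum do rewrite mulr1.
have [lam01 lamw] := wlam.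
set V := [seq p.1 | p <- s1 ++ s2 & 0 < lam p.1].
have VP x : x \in V -> 0 < lam x.
  by move=> /mapP[p]; rewrite mem_filter => /andP[? _] ->.
have PV p : p \in s1 ++ s2 -> 0 < lam p.1 -> p.1 \in V.
  by move=> ps l0; rewrite map_f// mem_filter l0.
have [V0|Vn0] := eqVneq V [::].
  exists (cst 0) => [p ps|].
    have /andP[l0 _] := lam01 p.1; apply/eqP; rewrite eq_le l0 leNgt /=.
    by apply/negP => /(PV _ ps); rewrite V0.
  move=> a b _ _; rewrite !wsum_scale /= !wsumZ !mul0r !mulr0 !addr0.
  by rewrite /disc; nra.
have [tM tMV maxM] := seq_max_exists Vn0.
have [tm tmV minm] := seq_min_exists Vn0.
(* When the window sees a single value, its weight must not be counted twice. *)
pose thm := if tm == tM then 1 else lam tm.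
have thm01 : 0 <= thm <= 1 by rewrite /thm; case: ifP; rewrite ?ler01 ?lexx.
exists (fun x => cutoff tM (lam tM) x * cutoff (- tm) thm (- x)).
  move=> p ps; rewrite /cutoff ltrN2 eqr_opp.
  have [l0|l0] := ltP 0 (lam p.1).
    have pV := PV _ ps l0; have := maxM _ pV; have := minm _ pV.
    rewrite !le_eqVlt [tm == _]eq_sym.
    case: (eqVneq p.1 tM) => [->|_] /=; case: (eqVneq _ tm) => [E|nE] /=.
    - by rewrite -E !ltxx /thm E eqxx mulr1.
    - by move=> -> _; rewrite ltxx mulr1.
    - by rewrite E ltxx /thm => _ tmM; rewrite tmM mul1r lt_eqF.
    - move=> h1 h2; rewrite h1 h2 mulr1; apply/esym/(lamw tm _ tM).
      + by rewrite h1.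
      + exact: VP.
      + exact: VP.
  have lz : lam p.1 = 0.
    by have /andP[l0' _] := lam01 p.1; apply/eqP; rewrite eq_le l0 l0'.
  have nV x : x \in V -> p.1 != x.
    by move=> /VP; apply: contraTneq => <-; rewrite lz ltxx.
  rewrite lz (negbTE (nV _ tMV)) (negbTE (nV _ tmV)).
  case: (ltP p.1 tM) => [pM|_]; last by rewrite mul0r.
  case: (ltP tm p.1) => [mp|_]; last by rewrite mulr0.
  have := lamw tm p.1 tM; rewrite mp pM => /(_ isT (VP _ tmV) (VP _ tMV)).
  by rewrite lz => /esym/eqP; rewrite oner_eq0.
have okb := pair_ok_cutoff_bot (- tm) e0 m1 m2 ok thm01.
have wb := window_opp (window_cutoff (- tm) thm01).
have := pair_ok_cutoff_top tM e0 (monotone_bmo_scale wb m1)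
  (monotone_bmo_scale wb m2) okb (lam01 tM).
by rewrite !scale_scale.
Qed.

End mixture_theorem.

(** * Splitting of intervals and Bellman induction *)

Section splitting.
Context {R : realType}.
Implicit Types (F : R -> R) (x y : R * R) (d e : R).

Definition segment_in d x y := forall t, 0 <= t <= 1 ->
  Omega d ((1 - t) * x.1 + t * y.1, (1 - t) * x.2 + t * y.2).

(* On a line tangent to the upper boundary of [Omega d], this is the distance
   between the first coordinates of x and of the point of tangency. *)
Definition gap d x := Num.sqrt (d ^+ 2 - (x.2 - x.1 ^+ 2)).

Lemma gap_ge0 d x : 0 <= gap d x. Proof. exact: sqrtr_ge0. Qed.

Lemma gap_sqr d x : Omega d x -> gap d x ^+ 2 = d ^+ 2 - (x.2 - x.1 ^+ 2).
Proof. by move=> /andP[? ?]; rewrite sqr_sqrtr//; lra. Qed.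

Lemma Omega_le d e x : 0 <= e <= d -> Omega e x -> Omega d x.
Proof.
move=> /andP[e0 ed] /andP[x1 x2]; rewrite /Omega/= x1 (le_trans x2)// lerD2l.
by rewrite lerXn2r// nnegrE// (le_trans e0).
Qed.

Lemma Omega_lower d x y t : Omega d x -> Omega d y -> 0 <= t <= 1 ->
  ((1 - t) * x.1 + t * y.1) ^+ 2 <= (1 - t) * x.2 + t * y.2.
Proof.
move=> /andP[x1 _] /andP[y1 _] /andP[t0 t1].
have h1 : (1 - t) * x.1 ^+ 2 <= (1 - t) * x.2 by rewrite ler_wpM2l ?subr_ge0.
have h2 : t * y.1 ^+ 2 <= t * y.2 by rewrite ler_wpM2l.
have h3 : 0 <= (t * (1 - t)) * (x.1 - y.1) ^+ 2.
  by rewrite mulr_ge0 ?sqr_ge0// mulr_ge0 ?subr_ge0.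
by nra.
Qed.

(** Along the segment, [d ^+ 2] minus the variance is (1-t) gap(x)^2 + t gap(y)^2 - t (1-t) D^2,
    where D = x.1 - y.1. When |D| = gap(x) + gap(y) this is the square of (1-t) gap(x) - t gap(y):
    the case of tangency. *)
Lemma segment_in_gap d x y : Omega d x -> Omega d y ->
  `|x.1 - y.1| <= gap d x + gap d y -> segment_in d x y.
Proof.
move=> xO yO D t /andP[t0 t1]; have gx := gap_sqr xO; have gy := gap_sqr yO.
rewrite /Omega/=; apply/andP; split; first by apply: (Omega_lower xO yO); rewrite t0.
have D2 : (x.1 - y.1) ^+ 2 <= (gap d x + gap d y) ^+ 2.
  by rewrite -[leLHS]real_normK ?num_real// lerXn2r// nnegrE ?addr_ge0 ?gap_ge0.
have : (t * (1 - t)) * (x.1 - y.1) ^+ 2 <=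
    (t * (1 - t)) * (gap d x + gap d y) ^+ 2.
  by rewrite ler_wpM2l ?mulr_ge0 ?subr_ge0.
have := sqr_ge0 ((1 - t) * gap d x - t * gap d y).
by nra.
Qed.

Definition avg F (a b : R) := (F b - F a) / (b - a).
Definition bpoint F1 F2 (a b : R) := (avg F1 a b, avg F2 a b).

Lemma avg_split F l c r : l < c -> c < r ->
  (r - l) * avg F l r = (c - l) * avg F l c + (r - c) * avg F c r.
Proof.
by move=> lc cr; rewrite /avg; field; rewrite !gt_eqF// subr_gt0// (lt_trans lc).
Qed.

Lemma continuous_avg F r c : continuous F -> c != r ->
  {for c, continuous (fun w : R => avg F w r)}.
Proof.
move=> cF cr; apply: cvgM.
  by apply: cvgB; [exact: cvg_cst|exact: cF].
apply: cvgV; first by rewrite subr_eq0 eq_sym.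
by apply: cvgB; [exact: cvg_cst|exact: cvg_id].
Qed.

Lemma continuous_gap F1 F2 d r c : continuous F1 -> continuous F2 -> c != r ->
  {for c, continuous (fun w : R => gap d (bpoint F1 F2 w r))}.
Proof.
move=> c1 c2 cr; rewrite /gap /=.
apply: (@continuous_comp _ _ _
  (fun w : R => d ^+ 2 - (avg F2 w r - avg F1 w r ^+ 2)) Num.sqrt); last first.
  exact: sqrt_continuous.
apply: cvgB; first exact: cvg_cst.
by apply: cvgB; [|apply: cvgM]; exact: continuous_avg.
Qed.

(** On [Omega e] the gap is at least [Num.sqrt (d ^+ 2 - e ^+ 2)], and its ratio to [d] is what the
    tangent case of the splitting yields; halving it makes it at most 1/2, so that midpoints qualify
    too. *)
Definition split_rate d e : R := Num.sqrt (d ^+ 2 - e ^+ 2) / (2 * d).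

Lemma split_rate_gt0 d e : 0 < e < d -> 0 < split_rate d e.
Proof.
move=> /andP[e0 ed]; have d0 := lt_trans e0 ed.
rewrite divr_gt0 ?mulr_gt0// sqrtr_gt0 subr_gt0.
by rewrite ltr_pXn2r// nnegrE ltW.
Qed.

Lemma split_rate_le d e : 0 < e < d -> split_rate d e <= 2^-1.
Proof.
move=> /andP[e0 ed]; have d0 := lt_trans e0 ed.
rewrite /split_rate ler_pdivrMr ?mulr_gt0// mulrA mulVf// mul1r.
rewrite -[leRHS]ger0_norm ?(ltW d0)// -sqrtr_sqr ler_wsqrtr//.
by rewrite gerBl sqr_ge0.
Qed.

(** Move the cut from [l], where the right-hand mean point is that of the whole interval, to the
    midpoint, from which the segment to the whole leaves the strip. At some cut the line through
    these two points is tangent to the upper parabola. The left-hand mean point is on the same line,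
    and a tangent lies entirely below the parabola. *)
Lemma split_left F1 F2 d e l r : 0 < e < d -> l < r ->
  continuous F1 -> continuous F2 ->
  (forall a b, l <= a -> a < b -> b <= r -> Omega e (bpoint F1 F2 a b)) ->
  ~ segment_in d (bpoint F1 F2 l r) (bpoint F1 F2 ((l + r) / 2) r) ->
  exists c, [/\ split_rate d e * (r - l) <= c - l,
    split_rate d e * (r - l) <= r - c &
    segment_in d (bpoint F1 F2 l c) (bpoint F1 F2 c r)].
Proof.
move=> /andP[e0 ed] lr c1 c2 H nseg.
have d0 : 0 < d by exact: lt_trans ed.
have Hd a b : l <= a -> a < b -> b <= r -> Omega d (bpoint F1 F2 a b).
  by move=> la ab br; apply: (@Omega_le d e); rewrite ?(ltW e0) ?(ltW ed)//; exact: H.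
set m := (l + r) / 2; have lm : l < m by rewrite /m; lra.
have mr : m < r by rewrite /m; lra.
set x0 := bpoint F1 F2 l r; have x0d : Omega d x0 by exact: Hd.
pose psi c := gap d x0 + gap d (bpoint F1 F2 c r) - `|x0.1 - avg F1 c r|.
have psil : 0 <= psi l by rewrite /psi subrr normr0 subr0 addr_ge0 ?gap_ge0.
have psim : psi m < 0.
  rewrite /psi subr_lt0 ltNge; apply/negP => le; apply: nseg.
  by apply: segment_in_gap => //; apply: Hd => //; exact: ltW.
have [c] : exists2 c, c \in `[l, m] & psi c = 0.
  apply: IVT; first exact: ltW.
    apply: continuous_in_subspaceT => c; rewrite inE /= in_itv/= => /andP[lc cm].
    have cr : c != r by rewrite lt_eqF// (le_lt_trans cm).
    apply: cvgB; first by apply: cvgD; [exact: cvg_cst|exact: continuous_gap].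
    by apply: cvg_norm; apply: cvgB; [exact: cvg_cst|exact: continuous_avg].
  by rewrite ge_min le_max psil (ltW psim) orbT.
rewrite in_itv/= => /andP[lc' cm] psic.
have s00 : Num.sqrt (d ^+ 2 - e ^+ 2) <= gap d x0.
  have /andP[_ x0e] : Omega e x0 by exact: H.
  by rewrite ler_wsqrtr// lerD2l lerN2; lra.
have rt : 0 < Num.sqrt (d ^+ 2 - e ^+ 2).
  by rewrite sqrtr_gt0 subr_gt0 ltr_pXn2r// nnegrE ltW.
have lc : l < c.
  rewrite lt_neqAle lc' andbT; apply/eqP => E.
  move: psic; rewrite /psi -E subrr normr0 subr0 -/x0; lra.
have cr : c < r by exact: le_lt_trans mr.
set xm := bpoint F1 F2 l c; set xp := bpoint F1 F2 c r.
have xmd : Omega d xm by apply: Hd => //; exact: ltW.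
have xpd : Omega d xp by apply: Hd => //; exact: ltW.
have D2 : (x0.1 - xp.1) ^+ 2 = (gap d x0 + gap d xp) ^+ 2.
  rewrite -real_normK ?num_real//; congr (_ ^+ 2).
  by apply/esym/eqP; rewrite -subr_eq0; exact/eqP.
have gx0 := gap_sqr x0d; have gxp := gap_sqr xpd.
(* the line through x0 and xp is tangent to the upper boundary *)
have tangent t : d ^+ 2 - (((1 - t) * x0.2 + t * xp.2) -
    ((1 - t) * x0.1 + t * xp.1) ^+ 2) = ((1 - t) * gap d x0 - t * gap d xp) ^+ 2.
  transitivity ((1 - t) * gap d x0 ^+ 2 + t * gap d xp ^+ 2 -
    t * (1 - t) * (x0.1 - xp.1) ^+ 2); first by rewrite gx0 gxp; ring.
  by rewrite D2; ring.
(* On the line from [x0] to [xp] the left-hand point [xm] has parameter [- k]. *)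
pose k := (r - c) / (c - l).
have k0 : 0 < k by rewrite divr_gt0// subr_gt0.
have k1E : 1 + k = (r - l) / (c - l) by rewrite /k; field; lra.
have E1 : xm.1 = (1 + k) * x0.1 - k * xp.1.
  by rewrite /= k1E /k mulrAC (@avg_split _ l c r)//; field; lra.
have E2 : xm.2 = (1 + k) * x0.2 - k * xp.2.
  by rewrite /= k1E /k mulrAC (@avg_split _ l c r)//; field; lra.
exists c; split.
(* The horizontal distance from [xm] to the point of tangency is at most [d], because [xm] is above
   the lower parabola. This bounds [1 + k], that is, [(r - l) / (c - l)]. *)
- have := tangent (- k); rewrite !opprK !mulNr opprK -E1 -E2 => tm.
  have /andP[xm1 _] := xmd.
  have : ((1 + k) * gap d x0) ^+ 2 <= d ^+ 2.
    apply: (@le_trans _ _ (((1 + k) * gap d x0 + k * gap d xp) ^+ 2)).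
      have k0' := ltW k0; have k1' : 0 <= 1 + k by rewrite addr_ge0.
      have := mulr_ge0 k1' (gap_ge0 d x0); have := mulr_ge0 k0' (gap_ge0 d xp).
      by move=> ? ?; rewrite ler_pXn2r// ?nnegrE ?lerDl ?addr_ge0.
    by rewrite -tm; lra.
  rewrite ler_pXn2r ?nnegrE ?mulr_ge0 ?gap_ge0 ?addr_ge0 ?(ltW k0) ?(ltW d0)// => h.
  have {}h : (r - l) * gap d x0 <= d * (c - l).
    by rewrite -ler_pdivrMr ?subr_gt0// mulrAC -k1E.
  rewrite /split_rate mulrAC ler_pdivrMr ?mulr_gt0//.
  have : (r - l) * Num.sqrt (d ^+ 2 - e ^+ 2) <= (r - l) * gap d x0.
    by rewrite ler_wpM2l// subr_ge0 ltW.
  have : 0 <= d * (c - l) by rewrite mulr_ge0 ?subr_ge0 ?(ltW d0) ?(ltW lc).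
  by lra.
- apply: (@le_trans _ _ (2^-1 * (r - l))).
    by rewrite ler_wpM2r ?split_rate_le ?e0// subr_ge0 ltW.
  by move: cm; rewrite /m; lra.
- move=> t t01; rewrite /Omega/=; apply/andP; split; first exact: (Omega_lower xmd xpd).
  have := sqr_ge0 ((1 - (t - (1 - t) * k)) * gap d x0 - (t - (1 - t) * k) * gap d xp).
  rewrite -tangent.
  rewrite (_ : (1 - t) * avg F1 l c + t * avg F1 c r =
    (1 - (t - (1 - t) * k)) * x0.1 + (t - (1 - t) * k) * xp.1); last first.
    by rewrite -[avg F1 l c]/(xm.1) -[avg F1 c r]/(xp.1) E1; ring.
  rewrite (_ : (1 - t) * avg F2 l c + t * avg F2 c r =
    (1 - (t - (1 - t) * k)) * x0.2 + (t - (1 - t) * k) * xp.2); last first.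
    by rewrite -[avg F2 l c]/(xm.2) -[avg F2 c r]/(xp.2) E2; ring.
  by lra.
Qed.

Lemma segment_in_sym d x y : segment_in d x y -> segment_in d y x.
Proof.
move=> h t t01; have := h (1 - t); rewrite subKr [X in Omega _ (X, _)]addrC.
rewrite [X in Omega _ (_, X)]addrC; apply.
by move: t01 => /andP[? ?]; apply/andP; split; lra.
Qed.

(** If both halves are joined to the whole inside the strip, the midpoint works: the segment between
    the halves passes through the mean point of the whole. Otherwise one half fails and [split_left]
    applies, directly or after the reflection that turns F(w) into -F(-w). *)
Lemma splitting F1 F2 d e l r : 0 < e < d -> l < r ->
  continuous F1 -> continuous F2 ->
  (forall a b, l <= a -> a < b -> b <= r -> Omega e (bpoint F1 F2 a b)) ->
  exists c, [/\ split_rate d e * (r - l) <= c - l,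
    split_rate d e * (r - l) <= r - c &
    segment_in d (bpoint F1 F2 l c) (bpoint F1 F2 c r)].
Proof.
move=> ed lr c1 c2 H.
set m := (l + r) / 2; have lm : l < m by rewrite /m; lra.
have mr : m < r by rewrite /m; lra.
have [segp|] := pselect (segment_in d (bpoint F1 F2 l r) (bpoint F1 F2 m r));
  last exact: split_left.
have [segm|nseg] := pselect (segment_in d (bpoint F1 F2 l r) (bpoint F1 F2 l m)).
  exists m; have rate : split_rate d e * (r - l) <= 2^-1 * (r - l).
    by rewrite ler_wpM2r ?split_rate_le// subr_ge0 ltW.
  split; [rewrite (le_trans rate)// /m; lra|rewrite (le_trans rate)// /m; lra|].
  have mid F : avg F l r = (avg F l m + avg F m r) / 2.
    have := avg_split F lm mr; rewrite (_ : m - l = (r - l) / 2); last by rewrite /m; lra.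
    rewrite (_ : r - m = (r - l) / 2); last by rewrite /m; lra.
    move=> h; apply: (@mulfI _ (r - l)); first by rewrite gt_eqF// subr_gt0.
    by rewrite h; field.
  move=> t /andP[t0 t1]; have [t2|t2] := leP t 2^-1.
    have := segm (1 - 2 * t); rewrite /= !mid subKr => /(_ _)/wrap[]; first by apply/andP; split; lra.
    by congr (Omega _ (_, _)); field.
  have := segp (2 * t - 1); rewrite /= !mid => /(_ _)/wrap[]; first by apply/andP; split; lra.
  by congr (Omega _ (_, _)); field.
have avgN F a b : avg (fun w : R => - F (- w)) a b = avg F (- b) (- a).
  by rewrite /avg; congr (_ / _); ring.
have cN F : continuous F -> continuous (fun w : R => - F (- w)).
  move=> cF w; apply: cvgN; apply: (@continuous_comp _ _ _ -%R F).
    exact: opp_continuous.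
  exact: cF.
have [|||a b ra ab bl||c []] := @split_left (fun w : R => - F1 (- w))
   (fun w : R => - F2 (- w)) d e (- r) (- l) ed.
- by rewrite ltrN2.
- exact: cN.
- exact: cN.
- by rewrite /bpoint !avgN; apply: H; rewrite ?ltrN2//; lra.
- move=> h; apply: nseg; move: h; rewrite /bpoint !avgN !opprK.
  by rewrite (_ : - ((- r + - l) / 2) = m)// /m; field.
rewrite opprK [- l + r]addrC /bpoint !avgN !opprK => h1 h2 seg.
exists (- c); split.
- by move: h2; lra.
- by move: h1; lra.
- exact/segment_in_sym.
Qed.

End splitting.

(** * Bisection down to a point of differentiability *)

Section bellman_induction.
Context {R : realType}.
Implicit Types (F : R -> R) (G : R * R -> R) (x y : R * R) (d e : R).

Definition segment_concave d G := forall x y, Omega d x -> Omega d y ->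
  segment_in d x y -> forall t, 0 <= t <= 1 ->
  (1 - t) * G x + t * G y <=
  G ((1 - t) * x.1 + t * y.1, (1 - t) * x.2 + t * y.2).

(** The nested intervals contain [t] without being centred at it, so each endpoint is compared with
    [t] separately. *)
Lemma avg_cvg_derive F t D : derivable F t 1 -> derive1 F t = D ->
  forall e, 0 < e -> exists2 dlt, 0 < dlt &
    forall l r, l <= t -> t <= r -> l < r -> r - l < dlt -> `|avg F l r - D| <= e.
Proof.
move=> /cvg_ex[D' FD']; rewrite derive1E => DE e e0.
have D'E : D' = D by rewrite -DE; apply/esym/cvg_lim.
move/cvgrPdist_le : FD' => /(_ _ e0).
rewrite D'E => -[dlt /= dlt0 H]; exists dlt => // l r lt tr lr rl.
have {}H h : `|h| < dlt -> `|F (h + t) - F t - h * D| <= e * `|h|.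
  move=> hd; have [->|h0] := eqVneq h 0.
    by rewrite add0r subrr mul0r subrr normr0 mulr0.
  have := H h; rewrite /ball_/= sub0r normrN => /(_ hd h0).
  rewrite /GRing.scale/= mulr1 distrC => le.
  rewrite -[X in `|X|](@mulfVK _ h)// normrM ler_wpM2r//.
  by move: le; congr (`| _ | <= _); field.
have h1 := H (l - t); have h2 := H (r - t).
have : `|l - t| < dlt by rewrite ler0_norm; lra.
move=> /h1; rewrite subrK [`|l - t|]ler0_norm ?subr_le0// => h1'.
have : `|r - t| < dlt by rewrite ger0_norm; lra.
move=> /h2; rewrite subrK [`|r - t|]ger0_norm ?subr_ge0// => h2'.
have rl0 : 0 < r - l by rewrite subr_gt0.
have -> : avg F l r - D = (F r - F l - (r - l) * D) / (r - l).
  by rewrite /avg; field; rewrite gt_eqF.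
rewrite normrM normfV (gtr0_norm rl0) ler_pdivrMr//.
have -> : F r - F l - (r - l) * D =
  (F r - F t - (r - t) * D) - (F l - F t - (l - t) * D) by ring.
by rewrite (le_trans (ler_normB _ _))// (le_trans (lerD h2' h1'))//; lra.
Qed.

Lemma within_continuous_dist (A : set (R * R)) G p :
  {within A, continuous G} -> A p -> forall e, 0 < e ->
  exists2 dlt, 0 < dlt & forall y, A y -> `|y.1 - p.1| <= dlt ->
    `|y.2 - p.2| <= dlt -> `|G y - G p| <= e.
Proof.
move=> /subspace_continuousP/(_ p) cG Ap e e0.
have /cvgrPdist_le/(_ _ e0) := cG Ap.
rewrite near_withinE => /nbhs_ballP[dlt /= dlt0 H].
exists (dlt / 2); first by rewrite divr_gt0.
move=> y Ay y1 y2; rewrite distrC; apply: H => //.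
by split; rewrite -ball_normE /ball_/= distrC; [apply: le_lt_trans y1 _|
  apply: le_lt_trans y2 _]; lra.
Qed.

Lemma nested_intervals (u v : R ^nat) :
  (forall n, u n <= u n.+1) -> (forall n, v n.+1 <= v n) ->
  (forall n, u n <= v n) -> exists t, forall n, u n <= t <= v n.
Proof.
move=> uS vS uv.
have uM : {homo u : m n / (m <= n)%N >-> m <= n} by exact/nondecreasing_seqP.
have vM : {homo v : m n / (m <= n)%N >-> n <= m} by exact/nonincreasing_seqP.
have uvmn m n : u m <= v n.
  by rewrite (le_trans (uM _ _ (leq_maxl m n)))// (le_trans (uv _))// vM// leq_maxr.
exists (sup (range u)) => n; apply/andP; split.
  apply: ub_le_sup; last by exists n.
  by exists (v 0%N) => _ [m _ <-].
by apply: ge_sup; [exists (u 0%N), 0%N|move=> _ [m _ <-]].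
Qed.

Variables (F1 F2 Ff FO f phi : R -> R) (G : R * R -> R).
Variables (a b d e M : R) (O : set R).
Hypotheses (ed : 0 < e < d) (ab : a < b).
Hypotheses (cF1 : continuous F1) (cF2 : continuous F2).
Hypothesis F12 : forall l r, a <= l -> l < r -> r <= b ->
  Omega e (bpoint F1 F2 l r).
Hypotheses (Gconc : segment_concave d G)
  (Gcont : {within Omega d, continuous G}) (Gf : forall u, G (u, u ^+ 2) = f u).
Hypothesis FfM : forall l r, a <= l -> l < r -> r <= b -> avg Ff l r <= M.
Hypothesis GM : forall l r, a <= l -> l < r -> r <= b ->
  - M <= G (bpoint F1 F2 l r).
Hypothesis M0 : 0 <= M.
Hypothesis openO : open O.
Hypothesis FO0 : forall l r, a <= l -> l < r -> r <= b -> 0 <= avg FO l r.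
Hypothesis FO1 : forall l r, a <= l -> l < r -> r <= b ->
  `[l, r] `<=` O -> avg FO l r = 1.
Hypothesis diffO : forall t, a <= t <= b -> ~ O t ->
  [/\ derivable F1 t 1 /\ derive1 F1 t = phi t,
      derivable F2 t 1 /\ derive1 F2 t = phi t ^+ 2 &
      derivable Ff t 1 /\ derive1 Ff t = f (phi t)].

(* O is an open neighbourhood of the null set where the primitives are not
   differentiable; the penalty 2 * M on it keeps the bisection away from it. *)
Lemma bellman_induction :
  avg Ff a b <= G (bpoint F1 F2 a b) + 2 * M * avg FO a b.
Proof.
apply/ler_addgt0Pr => eta eta0; rewrite leNgt; apply/negP => bad.
(* [A] is the excess over the claim. By concavity [(r - l) * A l r] is at most the sum of the same
   quantities over the two parts of an admissible split, so a positive excess is inherited by one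
   part. *)
pose A l r := avg Ff l r - 2 * M * avg FO l r - G (bpoint F1 F2 l r) - eta.
pose P (lr : R * R) := [/\ a <= lr.1, lr.1 < lr.2, lr.2 <= b & 0 < A lr.1 lr.2].
have /andP[e0 ed'] := ed; have d0 : 0 < d by exact: lt_trans ed'.
have FM l r : a <= l -> l < r -> r <= b -> Omega d (bpoint F1 F2 l r).
  by move=> *; apply: (@Omega_le _ _ e); [rewrite !ltW|exact: F12].
set tau := split_rate d e; have tau0 : 0 < tau by exact: split_rate_gt0.
have tau1 : 0 <= 1 - tau by rewrite subr_ge0 (le_trans (split_rate_le ed))//; lra.
have step lr : exists lr', P lr -> [/\ P lr', lr.1 <= lr'.1, lr'.2 <= lr.2 &
    lr'.2 - lr'.1 <= (1 - tau) * (lr.2 - lr.1)].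
  have [[al lr12 rb Alr]|nP] := pselect (P lr); last by exists lr.
  case: lr al lr12 rb Alr => l r /= al lr rb Alr.
  have [|c [lc cr seg]] := splitting ed lr cF1 cF2.
    move=> l' r' ll' lr' rr'; apply: F12 => //.
      exact: le_trans ll'.
    exact: le_trans rb.
  rewrite -/tau in lc cr.
  have rl0 : 0 < tau * (r - l) by rewrite mulr_gt0// subr_gt0.
  have lc' : l < c by lra.
  have cr' : c < r by lra.
  have ac : a <= c by rewrite (le_trans al)// ltW.
  have cb : c <= b by rewrite (le_trans _ rb)// ltW.
  have superadd : (r - l) * A l r <= (c - l) * A l c + (r - c) * A c r.
    have h1 := avg_split Ff lc' cr'; have h2 := avg_split FO lc' cr'.
    pose t := (r - c) / (r - l).
    have rl : 0 < r - l by rewrite subr_gt0.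
    have t1 : 1 - t = (c - l) / (r - l) by rewrite /t; field; rewrite gt_eqF.
    have t01 : 0 <= t <= 1.
      rewrite /t; apply/andP; split; first by rewrite divr_ge0// ltW// subr_gt0.
      by rewrite ler_pdivrMr// mul1r; lra.
    have := Gconc (FM _ _ al lc' cb) (FM _ _ ac cr' rb) seg t01.
    rewrite (_ : (1 - t) * (bpoint F1 F2 l c).1 + _ = avg F1 l r); last first.
      apply: (mulfI (lt0r_neq0 rl)); rewrite (avg_split F1 lc' cr') t1 /t /=.
      by field; rewrite gt_eqF.
    rewrite (_ : (1 - t) * (bpoint F1 F2 l c).2 + _ = avg F2 l r); last first.
      apply: (mulfI (lt0r_neq0 rl)); rewrite (avg_split F2 lc' cr') t1 /t /=.
      by field; rewrite gt_eqF.
    rewrite -[G (avg _ l r, _)]/(G (bpoint F1 F2 l r)) => Gle.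
    have : (r - l) * ((1 - t) * G (bpoint F1 F2 l c) + t * G (bpoint F1 F2 c r))
        <= (r - l) * G (bpoint F1 F2 l r) by rewrite ler_pM2l.
    rewrite (_ : (r - l) * _ = (c - l) * G (bpoint F1 F2 l c) +
      (r - c) * G (bpoint F1 F2 c r)); last by rewrite t1 /t; field; rewrite gt_eqF.
    rewrite /A => GGle.
    have -> : (r - l) * (avg Ff l r - 2 * M * avg FO l r - G (bpoint F1 F2 l r) - eta)
      = (r - l) * avg Ff l r - 2 * M * ((r - l) * avg FO l r)
        - (r - l) * G (bpoint F1 F2 l r) - (r - l) * eta by ring.
    by rewrite h1 h2; lra.
  have : 0 < (r - l) * A l r by rewrite mulr_gt0// subr_gt0.
  move=> /lt_le_trans/(_ superadd).
  have [Alc _|Alc] := ltP 0 (A l c); last first.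
    have [Acr _|Acr] := ltP 0 (A c r).
      exists (c, r) => _ /=; split => //; first exact: ltW.
      by rewrite mulrBl mul1r; lra.
    have : (c - l) * A l c <= 0 by rewrite mulr_ge0_le0// subr_ge0 ltW.
    have : (r - c) * A c r <= 0 by rewrite mulr_ge0_le0// subr_ge0 ltW.
    by lra.
  exists (l, c) => _ /=; split => //; first exact: ltW.
  by rewrite mulrBl mul1r; lra.
have [g gP] := choice step.
pose w := fix w n := if n is m.+1 then g (w m) else (a, b).
have Pw n : P (w n).
  elim: n => [|n /gP[]//]; split => //=.
  by rewrite /A; lra.
have [t tw] : exists t, forall n, (w n).1 <= t <= (w n).2.
  apply: nested_intervals => n; have [h1 h2 h3 _] := gP _ (Pw n) => //.
  by have [_ /ltW] := Pw n.
have wlen n : (w n).2 - (w n).1 <= (1 - tau) ^+ n * (b - a).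
  elim: n => [|n IH]; first by rewrite expr0 mul1r.
  have [_ _ _ /le_trans] := gP _ (Pw n); apply.
  by rewrite exprS -mulrA ler_wpM2l.
have small dlt : 0 < dlt -> exists n, (w n).2 - (w n).1 < dlt.
  move=> dlt0; have /cvgrPdist_lt : (1 - tau) ^+ n * (b - a) @[n --> \oo] --> (0 : R).
    rewrite -(mul0r (b - a)); apply: cvgM; last exact: cvg_cst.
    by apply: cvg_expr; rewrite ger0_norm//; lra.
  move=> /(_ _ dlt0)[N _ /(_ N (leqnn N))]; rewrite sub0r normrN => h.
  by exists N; apply: le_lt_trans (wlen N) _; exact: le_lt_trans (ler_norm _) h.
(* Small intervals inside [O] bear the full penalty [2 * M], which outweighs [avg Ff <= M] and
   [- M <= G]. Outside [O] the mean points tend to the boundary point of [phi t], where [G] equals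
   the limit [f (phi t)] of the averages of [Ff]. *)
have [tO|tO] := pselect (O t).
  have /nbhs_ballP[dlt /= dlt0 dO] := open_nbhs_nbhs (conj openO tO).
  have [n wn] := small _ dlt0.
  have [al lr rb Alr] := Pw n; have /andP[lt tr] := tw n.
  move: Alr; rewrite /A FO1//.
    have := FfM al lr rb; have := GM al lr rb; lra.
  move=> z /=; rewrite in_itv/= => /andP[lz zr]; apply: dO.
  by rewrite /ball/= ltr_norml; lra.
have tab : a <= t <= b by exact: (tw 0%N).
have [[dF1 eF1] [dF2 eF2] [dFf eFf]] := diffO tab tO.
have pO : Omega d (phi t, phi t ^+ 2) by rewrite /Omega/= lexx lerDl sqr_ge0.
have eta3 : 0 < eta / 3 by rewrite divr_gt0.
have [d1 d10 H1] := within_continuous_dist Gcont pO eta3.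
have [d2 d20 H2] := avg_cvg_derive dF1 eF1 d10.
have [d3 d30 H3] := avg_cvg_derive dF2 eF2 d10.
have [d4 d40 H4] := avg_cvg_derive dFf eFf eta3.
have [|n] := small (Num.min d2 (Num.min d3 d4)).
  by rewrite !lt_min d20 d30.
rewrite !lt_min => /and3P[w2 w3 w4].
have [al lr rb Alr] := Pw n; have /andP[lt tr] := tw n.
have {}H4 := H4 _ _ lt tr lr w4.
have := H1 _ (FM _ _ al lr rb) (H2 _ _ lt tr lr w2) (H3 _ _ lt tr lr w3).
rewrite Gf => {}H1; move: Alr H4 H1; rewrite /A !ler_norml.
have := mulr_ge0 M0 (FO0 al lr rb).
by move=> h h1 /andP[_ h2] /andP[h3 _]; lra.
Qed.

End bellman_induction.

(** * Functions of bounded mean oscillation *)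

Section bounded_functions.
Context {R : realType}.
Notation mu := (@lebesgue_measure R).
Implicit Types (g : R -> R) (a b l r K : R).

(** Vanishing outside [a, b] makes the primitive based at -oo defined and continuous on the whole
    line, as the splitting lemmas require. *)
Definition bounded_on_itv a b K g := [/\ measurable_fun setT g,
  forall t, `|g t| <= K & forall t, ~~ (a <= t <= b) -> g t = 0].

Definition prim g x : R := \int[mu]_(t in `]-oo, x]) g t.

Lemma lebesgue_oc l r : l <= r -> mu `]l, r] = (r - l)%:E.
Proof.
move=> lr; rewrite lebesgue_measure_itv/= lte_fin; case: ltP => // rl.
by rewrite (le_anti (introT andP (conj lr rl))) subrr.
Qed.

Lemma lebesgue_bnd_lty (c1 c2 : bool) l r :
  (mu [set` Interval (BSide c1 l) (BSide c2 r)] < +oo)%E.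
Proof. by rewrite lebesgue_measure_itv/=; case: ifP => _; rewrite ?ltry. Qed.

Lemma bounded_on_itv_integrable a b K g (A : set R) : measurable A ->
  bounded_on_itv a b K g -> mu.-integrable A (EFin \o g).
Proof.
move=> mA [mg gK g0]; apply: (@integrableS _ _ _ mu setT) => //.
have -> : EFin \o g = (EFin \o g) \_ `[a, b].
  apply/funext => t; rewrite patchE; case: ifPn => //.
  by rewrite notin_setE/= in_itv/= => /negP/g0 ->.
apply/integrable_restrict => //; rewrite setTI.
apply: measurable_bounded_integrable => //.
- exact: lebesgue_bnd_lty.
- exact: measurable_funTS.
- exists K; split; first exact: num_real.
  by move=> x Kx t _; exact: le_trans (gK t) (ltW Kx).
Qed.

Lemma primB a b K g l r : bounded_on_itv a b K g -> l <= r ->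
  prim g r - prim g l = \int[mu]_(t in `]l, r]) g t.
Proof.
move=> gb lr; rewrite /prim Rintegral_itvB// ?bnd_simp//.
exact: bounded_on_itv_integrable gb.
Qed.

Lemma Rintegral_oc_cst (c l r : R) : l <= r ->
  \int[mu]_(t in `]l, r]) c = c * (r - l).
Proof. by move=> lr; rewrite Rintegral_cst//= lebesgue_oc. Qed.

Lemma integrable_oc_cst (c l r : R) :
  mu.-integrable `]l, r] (EFin \o (cst c)).
Proof.
apply: measurable_bounded_integrable => //.
- exact: lebesgue_bnd_lty.
- exists `|c|; split; first exact: num_real.
  by move=> x cx t _; exact: ltW.
Qed.

Lemma Rintegral_oc_bound a b K g l r : bounded_on_itv a b K g -> l <= r ->
  `|\int[mu]_(t in `]l, r]) g t| <= K * (r - l).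
Proof.
move=> gb lr; have [mg gK g0] := gb.
have ig : mu.-integrable `]l, r] (EFin \o g).
  exact: bounded_on_itv_integrable gb.
rewrite (le_trans (le_normr_Rintegral _ ig))// -Rintegral_oc_cst//.
apply: le_Rintegral => //; last exact: integrable_oc_cst.
exact: (integrable_abse ig).
Qed.

Lemma avg_prim a b K g l r : bounded_on_itv a b K g -> l < r ->
  avg (prim g) l r = (\int[mu]_(t in `]l, r]) g t) / (r - l).
Proof. by move=> gb lr; rewrite /avg (primB gb)// ltW. Qed.

Lemma continuous_prim a b K g : bounded_on_itv a b K g -> continuous (prim g).
Proof.
move=> gb x; have [_ gK _] := gb.
have K0 : 0 <= K by rewrite (le_trans _ (gK 0)).
have K1 : 0 < K + 1 by rewrite ltr_wpDl.
apply/cvgrPdist_le => e e0; near=> y.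
have xy : `|x - y| <= e / (K + 1).
  by near: y; apply: cvgr_dist_le; [exact: cvg_id|rewrite divr_gt0].
have : K * `|x - y| <= e.
  rewrite ler_pdivlMr// in xy; rewrite (le_trans _ xy)// mulrC ler_wpM2l// lerDl.
  exact: ler01.
apply: le_trans; have [yx|/ltW yx] := leP y x.
  rewrite (primB gb)// (ger0_norm (_ : 0 <= x - y)) ?subr_ge0//.
  exact: Rintegral_oc_bound gb _.
rewrite distrC (primB gb)// distrC (ger0_norm (_ : 0 <= y - x)) ?subr_ge0//.
exact: Rintegral_oc_bound gb _.
Unshelve. all: by end_near. Qed.

Lemma prim_derive_ae a b K g : bounded_on_itv a b K g ->
  {ae mu, forall x, derivable (prim g) x 1 /\ derive1 (prim g) x = g x}.
Proof.
move=> gb; apply: FTC1Ny => [y|]; first exact: bounded_on_itv_integrable gb.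
split; [by case: gb|exact: openT|].
move=> A _ cA; have iA := bounded_on_itv_integrable (compact_measurable cA) gb.
by case/integrableP : iA => _.
Qed.

Lemma bounded_on_itv_cut a b K g (A : set R) : measurable A ->
  measurable_fun setT g -> (forall t, `|g t| <= K) ->
  bounded_on_itv a b K (g \_ (A `&` `[a, b])).
Proof.
move=> mA mg gK; split=> [|t|t nt].
- apply/(measurable_restrictT _ _).1; first exact: measurableI.
  exact: measurable_funTS.
- by rewrite patchE; case: ifP => // _; rewrite normr0 (le_trans _ (gK t)).
- rewrite patchE; case: ifPn => //; rewrite inE => -[_] /=.
  by rewrite in_itv/= => tab; rewrite tab in nt.
Qed.

Lemma ae_open_cover (P : R -> Prop) (dlt : R) : {ae mu, forall x, P x} ->
  0 < dlt -> exists O : set R,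
    [/\ open O, (mu O < dlt%:E)%E & forall x, ~ O x -> P x].
Proof.
move=> [Z' [mZ' Z0' PZ']] dlt0.
have [Z [mZ Z0 PZ]] : exists Z : set R,
    [/\ measurable Z, mu Z = 0%E & ~` [set x | P x] `<=` Z] by exists Z'.
have [|O [oO ZO muO]] := lebesgue_regularity_outer mZ _ dlt0.
  apply: (@le_lt_trans _ _ 0%E); last exact: ltry.
  by rewrite le_eqVlt; apply/orP; left; apply/eqP; exact: Z0.
exists O; split => //.
  have mO : measurable O := open_measurable oO.
  have -> : mu O = (mu (O `\` Z) + mu (O `&` Z))%E := measureDI mu mO mZ.
  have -> : mu (O `&` Z) = 0%E.
    by apply/eqP; rewrite eq_le measure_ge0 andbT -[leRHS]Z0; exact: measureIr.
  by rewrite adde0; exact: muO.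
by move=> x Ox; apply: contrapT => Px; apply: Ox; apply: ZO; exact: PZ.
Qed.

(** This is [bellman_induction] for the primitives of psi, its square and f(psi), and for that of
    the indicator of a small open set covering the points where one of the former fails to have the
    right derivative. *)
Lemma bounded_supersolution (G : R * R -> R) (f : R -> R) a b d e N (psi : R -> R) :
  0 < e < d -> a < b -> bounded_on_itv a b N psi ->
  (forall l r, a <= l -> l < r -> r <= b ->
    Omega e ((\int[mu]_(t in `]l, r]) psi t) / (r - l),
             (\int[mu]_(t in `]l, r]) psi t ^+ 2) / (r - l))) ->
  segment_concave d G -> {within Omega d, continuous G} ->
  (forall u, G (u, u ^+ 2) = f u) -> continuous f ->
  (exists M, forall x, Omega d x -> `|x.1| <= N -> `|G x| <= M) ->
  (\int[mu]_(t in `]a, b]) f (psi t)) / (b - a) <=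
  G ((\int[mu]_(t in `]a, b]) psi t) / (b - a),
     (\int[mu]_(t in `]a, b]) psi t ^+ 2) / (b - a)).
Proof.
move=> ed ab pb psiO Gconc Gcont Gf cf [M GM].
have [mp pN p0] := pb; have N0 : 0 <= N by exact: le_trans (pN 0).
have M0 : 0 <= M.
  by rewrite (le_trans _ (GM (0, 0) _ _)) ?normr0// /Omega/= expr0n/= add0r lexx sqr_ge0.
have ba : 0 < b - a by rewrite subr_gt0.
have fpM t : `|f (psi t)| <= M.
  by rewrite -Gf GM//= /Omega/= lexx lerDl sqr_ge0.
have mfp : measurable_fun setT (f \o psi).
  by apply: measurableT_comp => //; exact: continuous_measurable_fun.
have pb2 : bounded_on_itv a b (N ^+ 2) (fun t => psi t ^+ 2).
  split=> [|t|t /p0 ->]; last by rewrite expr0n.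
  - exact: measurable_funX.
  - by rewrite normrX lerXn2r// nnegrE.
(* [f 0] may be nonzero, so [f \o psi] need not vanish outside [a, b]. *)
pose h := (f \o psi) \_ (setT `&` `[a, b]).
have hb : bounded_on_itv a b M h by exact: bounded_on_itv_cut.
have hE l r : a <= l -> r <= b ->
    \int[mu]_(t in `]l, r]) h t = \int[mu]_(t in `]l, r]) f (psi t).
  move=> al rb; apply: eq_Rintegral => t; rewrite inE/= in_itv/= => /andP[lt tr].
  rewrite /h patchE mem_set// setTI/= in_itv/=.
  by rewrite (le_trans al (ltW lt)) (le_trans tr rb).
rewrite -hE// -(avg_prim hb)//.
rewrite -(avg_prim pb)// -(avg_prim pb2)//.
apply/ler_addgt0Pr => eta eta0.
(* Makes the penalty [2 * M * (dlt / (b - a))] at most [eta]; the [+ 1] covers M = 0. *)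
pose dlt := eta * (b - a) / (2 * M + 1).
have M1 : 0 < 2 * M + 1 by rewrite ltr_wpDl ?mulr_ge0.
have dlt0 : 0 < dlt by rewrite divr_gt0 ?mulr_gt0.
have /ae_open_cover/(_ dlt0) [U0 [oO0 muO0 PO0]] : {ae mu, forall x,
   [/\ derivable (prim psi) x 1 /\ derive1 (prim psi) x = psi x,
      derivable (prim (fun t => psi t ^+ 2)) x 1 /\
        derive1 (prim (fun t => psi t ^+ 2)) x = psi x ^+ 2 &
      derivable (prim h) x 1 /\ derive1 (prim h) x = h x]}.
  have h1 := prim_derive_ae pb; have h2 := prim_derive_ae pb2.
  have h3 := prim_derive_ae hb.
  by apply: (@filterS3 _ _ (ae_filter_ringOfSetsType mu) _ _ _ _ _ h1 h2 h3).
have mO : measurable U0 by exact: open_measurable.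
pose k := (cst (1 : R)) \_ (U0 `&` `[a, b]).
have kb : bounded_on_itv a b 1 k.
  by apply: bounded_on_itv_cut => // t; rewrite normr1.
have kint l r : l < r -> avg (prim k) l r = (\int[mu]_(t in `]l, r]) k t) / (r - l).
  exact: avg_prim kb.
have k0 t : 0 <= k t by rewrite /k patchE; case: ifP.
have avgk : avg (prim k) a b <= dlt / (b - a).
  rewrite kint// ler_pM2r ?invr_gt0//.
  rewrite /k -Rintegral_mkcondr Rintegral_cst; last first.
    by apply: measurableI => //; exact: measurableI.
  rewrite mul1r -lee_fin fineK; last first.
    rewrite ge0_fin_numE//; apply: le_lt_trans (lebesgue_bnd_lty _ _ _ _).
    by apply: measureIl => //; exact: measurableI.
  apply: le_trans (ltW muO0); apply: le_measure; rewrite ?inE//.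
    by apply: measurableI => //; exact: measurableI.
  by move=> z [_ []].
have := @bellman_induction R (prim psi) (prim (fun t => psi t ^+ 2)) (prim h)
  (prim k) f psi G a b d e M U0 ed ab (continuous_prim pb) (continuous_prim pb2)
  _ Gconc Gcont Gf _ _ M0 oO0 _ _ _.
have bpE l r : l < r -> bpoint (prim psi) (prim (fun t => psi t ^+ 2)) l r =
   ((\int[mu]_(t in `]l, r]) psi t) / (r - l),
             (\int[mu]_(t in `]l, r]) psi t ^+ 2) / (r - l)).
  by move=> lr; rewrite /bpoint (avg_prim pb)// (avg_prim pb2).
move=> /(_ _ _ _ _ _ _)/wrap[]//.
- by move=> l r al lr rb; rewrite bpE//; exact: psiO.
- move=> l r al lr rb; rewrite (avg_prim hb)// ler_pdivrMr ?subr_gt0//.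
  exact: le_trans (ler_norm _) (Rintegral_oc_bound hb (ltW lr)).
- move=> l r al lr rb; rewrite bpE//.
  have ed' : 0 <= e <= d by case/andP: ed => ? ?; rewrite !ltW.
  have := GM _ (Omega_le ed' (psiO _ _ al lr rb)); rewrite /= normrM normfV.
  rewrite (gtr0_norm (_ : 0 < r - l)) ?subr_gt0// ler_pdivrMr ?subr_gt0//.
  move=> /(_ (Rintegral_oc_bound pb (ltW lr))).
  by rewrite ler_norml => /andP[].
- move=> l r al lr rb; rewrite kint// divr_ge0 ?subr_ge0 ?(ltW lr)//.
  exact: Rintegral_ge0.
- move=> l r al lr rb lrO; rewrite kint//.
  rewrite (_ : \int[mu]_(t in _) _ = \int[mu]_(t in `]l, r]) 1).
    by rewrite Rintegral_oc_cst ?(ltW lr)// mul1r divff// gt_eqF// subr_gt0.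
  apply: eq_Rintegral => t; rewrite inE/= in_itv/= => /andP[lt tr].
  rewrite /k patchE mem_set//; split.
    by apply: lrO; rewrite /= in_itv/= (ltW lt).
  by rewrite /= in_itv/= (le_trans al (ltW lt)) (le_trans tr rb).
- move=> t tab /PO0[? ? [dh eh]]; split => //; split => //.
  by rewrite eh /h patchE mem_set//; split.
move=> /le_trans; apply; rewrite lerD2l.
apply: (@le_trans _ _ (2 * M * (dlt / (b - a)))).
  by rewrite ler_wpM2l// mulr_ge0.
rewrite /dlt (_ : _ * _ = 2 * M / (2 * M + 1) * eta); last first.
  by field; rewrite !gt_eqF.
by rewrite ler_piMl ?(ltW eta0)// ler_pdivrMr// mul1r lerDl.
Qed.

End bounded_functions.

(** * Functions of bounded mean oscillation and their Lipschitz images *)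

Section bmo_functions.
Context {R : realType}.
Notation mu := (@lebesgue_measure R).
Implicit Types (phi kap : R -> R) (a b l r e : R).

Lemma bounded_nondegenerateP (I : interval R) : bounded_nondegenerate I ->
  exists c1 c2 a b, a < b /\ I = Interval (BSide c1 a) (BSide c2 b).
Proof.
rewrite /bounded_nondegenerate lebesgue_measure_itv.
case: I => [[c1 a|[]] [c2 b|[]]] //=; rewrite ?ltxx//.
- rewrite lte_fin; case: (ltP a b) => [ab _|_]; last by rewrite ltxx.
  by exists c1, c2, a, b.
- by rewrite ltry addye// ltxx andbF.
- by rewrite ltNyr addey// ltxx andbF.
- by rewrite andbF.
Qed.

Lemma lebesgue_itv (c1 c2 : bool) a b : a <= b ->
  mu [set` Interval (BSide c1 a) (BSide c2 b)] = (b - a)%:E.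
Proof.
move=> ab; rewrite lebesgue_measure_itv/= lte_fin; case: ltP => // ba.
by rewrite (le_anti (introT andP (conj ab ba))) subrr.
Qed.

Lemma integral_itv_oc (c1 c2 : bool) a b (h : R -> \bar R) :
  measurable_fun `]a, b[ h ->
  (\int[mu]_(t in [set` Interval (BSide c1 a) (BSide c2 b)]) h t =
   \int[mu]_(t in `]a, b]) h t)%E.
Proof. by move=> mh; rewrite !integral_itv_bndoo. Qed.

Lemma mean_itv (c1 c2 : bool) a b (h : R -> R) : a < b ->
  measurable_fun `]a, b[ h ->
  mean (Interval (BSide c1 a) (BSide c2 b)) h =
  ((b - a)^-1%:E * \int[mu]_(t in `]a, b]) (h t)%:E)%E.
Proof.
move=> ab mh; rewrite /mean lebesgue_itv ?(ltW ab)//.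
rewrite inver gt_eqF ?subr_gt0// integral_itv_oc//.
exact/measurable_EFinP.
Qed.

(** The centre [m] is arbitrary: the mean minimizes the integral, so nothing is lost, and composing
    with a Lipschitz [kap] just moves the centre to [kap m]. The extended integral makes sense
    before square integrability is known. *)
Definition bmo_fun a b e phi := measurable_fun setT phi /\
  forall l r, a <= l -> l < r -> r <= b -> exists m,
    (\int[mu]_(t in `]l, r]) ((phi t - m) ^+ 2)%:E <= (e ^+ 2 * (r - l))%:E)%E.

Lemma patch_oo_integral a b (h phi : R -> R) : measurable_fun `]a, b[ phi ->
  measurable_fun setT h ->
  (\int[mu]_(t in `]a, b]) (h (phi t))%:E =
   \int[mu]_(t in `]a, b]) (h ((phi \_ `]a, b[) t))%:E)%E.
Proof.
move=> mphi mh.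
rewrite [LHS]integral_itv_bndoo; last first.
  by apply/measurable_EFinP; apply: measurableT_comp.
rewrite [RHS]integral_itv_bndoo; last first.
  apply/measurable_EFinP; apply: measurableT_comp => //.
  by apply: measurable_funTS; apply/(measurable_restrictT _ _).1.
by apply: eq_integral => t tab; rewrite patchE tab.
Qed.

Lemma mean_patch (c1 c2 : bool) a b (h phi : R -> R) : a < b ->
  measurable_fun `]a, b[ phi -> measurable_fun setT h ->
  mean (Interval (BSide c1 a) (BSide c2 b)) (h \o phi) =
  ((b - a)^-1%:E * \int[mu]_(t in `]a, b]) (h ((phi \_ `]a, b[) t))%:E)%E.
Proof.
move=> ab mphi mh; rewrite mean_itv//; last exact: measurableT_comp.
by rewrite -patch_oo_integral.
Qed.

(** Restricting to the open interval treats all types of endpoints alike, since endpoints are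
    null. *)
Lemma BMO_bmo_fun (c1 c2 : bool) a b e phi : a < b ->
  BMO e (Interval (BSide c1 a) (BSide c2 b)) phi ->
  measurable_fun `]a, b[ phi /\ bmo_fun a b e (phi \_ `]a, b[).
Proof.
move=> ab [iphi bmo].
have sub : `]a, b[ `<=` [set` Interval (BSide c1 a) (BSide c2 b)].
  by apply: subset_itv; rewrite bnd_simp; case: c1 c2 {iphi bmo} => [] [].
have mphi : measurable_fun `]a, b[ phi.
  by apply/measurable_EFinP; apply: measurable_funS sub (measurable_int _ iphi).
split => //; split; first exact/(measurable_restrictT _ _).1.
move=> l r al lr rb; pose J := `]l, r[; pose m := fine (mean J phi).
exists m; have Jsub : [set` J] `<=` `]a, b[ by apply: subset_itv; rewrite bnd_simp.
have Jok : bounded_nondegenerate J.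
  by rewrite /bounded_nondegenerate lebesgue_itv ?(ltW lr)// lte_fin subr_gt0 lr ltry.
have : (mean J (fun t => (`|phi t - m| ^+ 2)%R) <= (e ^+ 2)%:E)%E.
  apply: le_trans bmo; apply: ereal_sup_ubound; exists J => //; split => //.
  exact: subset_trans sub.
have mphiJ : measurable_fun `]l, r[ phi by exact: measurable_funS mphi.
have mh : measurable_fun setT (fun s : R => `|s - m| ^+ 2).
  by apply: measurable_funX; apply: measurableT_comp => //; exact: measurable_funB.
rewrite mean_itv//; last first.
  exact: (measurableT_comp mh mphiJ).
rewrite -lee_pdivlMl ?invr_gt0 ?subr_gt0// invrK -EFinM mulrC => le.
apply: le_trans le; rewrite le_eqVlt; apply/orP; left; apply/eqP.
rewrite [LHS]integral_itv_bndoo; last first.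
  apply/measurable_EFinP; apply: measurable_funX; apply: measurable_funB => //.
  by apply: measurable_funTS; apply/(measurable_restrictT _ _).1.
rewrite [RHS]integral_itv_bndoo; last first.
  by apply/measurable_EFinP; exact: (measurableT_comp mh mphiJ).
apply: eq_integral => t; rewrite inE => tJ.
by rewrite patchE mem_set ?real_normK ?num_real//; exact: Jsub.
Qed.

Lemma lipschitz_continuous (rho : R) kap :
  (forall s t, `|kap s - kap t| <= rho * `|s - t|) -> continuous kap.
Proof.
move=> kapL x.
have r0 : 0 <= rho.
  have := kapL 1 0; rewrite (_ : `|1 - 0 : R| = 1) ?subr0 ?normr1 ?mulr1//.
  exact: le_trans (normr_ge0 _).
have r1 : 0 < rho + 1 by rewrite ltr_wpDl.
apply/cvgrPdist_le => eps eps0; near=> y.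
have xy : `|x - y| <= eps / (rho + 1).
  by near: y; apply: cvgr_dist_le; [exact: cvg_id|rewrite divr_gt0].
rewrite (le_trans (kapL _ _))//; rewrite ler_pdivlMr// in xy.
by rewrite (le_trans _ xy)// mulrC ler_wpM2l// lerDl ler01.
Unshelve. all: by end_near. Qed.

Lemma Omega_window (psi : R -> R) a b N e l r c : bounded_on_itv a b N psi ->
  l < r ->
  (\int[mu]_(t in `]l, r]) ((psi t - c) ^+ 2)%:E <= (e ^+ 2 * (r - l))%:E)%E ->
  Omega e ((\int[mu]_(t in `]l, r]) psi t) / (r - l),
           (\int[mu]_(t in `]l, r]) psi t ^+ 2) / (r - l)).
Proof.
move=> pb lr le; have rl : 0 < r - l by rewrite subr_gt0.
have [mp pN p0] := pb; have N0 : 0 <= N by exact: le_trans (pN 0).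
have pb2 : bounded_on_itv a b (N ^+ 2) (fun t => psi t ^+ 2).
  split=> [|t|t /p0 ->]; last by rewrite expr0n.
  - exact: measurable_funX.
  - by rewrite normrX lerXn2r// nnegrE.
set P := _ / _; set Q := (X in (_, X)).
have ip : mu.-integrable `]l, r] (EFin \o psi).
  exact: bounded_on_itv_integrable pb.
have ip2 : mu.-integrable `]l, r] (EFin \o (fun t => psi t ^+ 2)).
  exact: bounded_on_itv_integrable pb2.
(* The choice k = P gives the lower bound of [Omega], the choice k = c the upper one. *)
have var k : \int[mu]_(t in `]l, r]) (psi t - k) ^+ 2 =
    (r - l) * (Q - P ^+ 2 + (P - k) ^+ 2).
  under eq_Rintegral do rewrite sqrrB.
  have ipk : mu.-integrable `]l, r] (EFin \o (fun t => psi t * k *+ 2)).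
    have -> : (fun t => psi t * k *+ 2) = (fun t => k *+ 2 * psi t).
      by apply/funext => t; rewrite mulrnAl mulrC.
    suff : mu.-integrable `]l, r] (fun t => (k *+ 2)%:E * (EFin \o psi) t)%E.
      exact: eq_integrable.
    exact: integrableZl.
  rewrite RintegralD//=; last 2 first.
  - suff : mu.-integrable `]l, r] (fun t => (EFin \o (fun t => psi t ^+ 2)%R) t -
        (EFin \o (fun t => psi t * k *+ 2)%R) t)%E by exact: eq_integrable.
    exact: integrableB.
  - exact: integrable_oc_cst.
  rewrite RintegralB//= Rintegral_oc_cst ?(ltW lr)//.
  under [X in _ - X]eq_Rintegral do rewrite -mulrnAr.
  rewrite RintegralZr// /P /Q; field; exact: lt0r_neq0.
rewrite /Omega/=; apply/andP; split.
  have := var P; rewrite subrr expr0n addr0 => E.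
  have : 0 <= (r - l) * (Q - P ^+ 2).
    by rewrite -E; apply: Rintegral_ge0 => t _; exact: sqr_ge0.
  by rewrite pmulr_rge0// subr_ge0.
have : (r - l) * (Q - P ^+ 2 + (P - c) ^+ 2) <= e ^+ 2 * (r - l).
  rewrite -var /Rintegral -lee_fin fineK// ge0_fin_numE.
    by apply: le_lt_trans le _; rewrite ltry.
  by apply: integral_ge0 => t _; rewrite lee_fin sqr_ge0.
rewrite mulrC ler_pM2r// => h; have := sqr_ge0 (P - c); lra.
Qed.

Lemma lipschitz_Omega a b e N rho phi kap l r :
  0 < rho -> bmo_fun a b e phi ->
  (forall s t, `|kap s - kap t| <= rho * `|s - t|) -> (forall s, `|kap s| <= N) ->
  a <= l -> l < r -> r <= b ->
  Omega (rho * e) ((\int[mu]_(t in `]l, r]) kap (phi t)) / (r - l),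
                   (\int[mu]_(t in `]l, r]) kap (phi t) ^+ 2) / (r - l)).
Proof.
move=> rho0 [mphi bmo] kapL kapN al lr rb.
pose psi := (kap \o phi) \_ (setT `&` `[a, b]).
have mk : measurable_fun setT kap.
  exact: continuous_measurable_fun (lipschitz_continuous kapL).
have pb : bounded_on_itv a b N psi.
  apply: bounded_on_itv_cut; [by []| |by move=> t; exact: kapN].
  exact: (measurableT_comp mk mphi).
have pE t : t \in `]l, r]%classic -> psi t = kap (phi t).
  rewrite inE/= in_itv/= => /andP[lt tr].
  rewrite /psi patchE mem_set// setTI/= in_itv/=.
  by rewrite (le_trans al (ltW lt)) (le_trans tr rb).
have E h : \int[mu]_(t in `]l, r]) h (psi t) = \int[mu]_(t in `]l, r]) h (kap (phi t)).
  by apply: eq_Rintegral => t /pE ->.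
rewrite -(E id) -(E (fun s => s ^+ 2)).
have [m le] := bmo _ _ al lr rb.
apply: (@Omega_window _ _ _ _ _ _ _ (kap m) pb lr).
have mpm : measurable_fun `]l, r] (fun t => ((phi t - m) ^+ 2)%:E).
  apply/measurable_EFinP; apply: measurable_funX; apply: measurable_funB => //.
  exact: measurable_funTS.
apply: (@le_trans _ _ ((rho ^+ 2)%:E * \int[mu]_(t in `]l, r]) ((phi t - m) ^+ 2)%:E)%E).
  rewrite -ge0_integralZl//; last 2 first.
  - by move=> t _; rewrite lee_fin sqr_ge0.
  - by rewrite lee_fin sqr_ge0.
  apply: ge0_le_integral => //.
  - by move=> t _; rewrite lee_fin sqr_ge0.
  - apply/measurable_EFinP; apply: measurable_funX; apply: measurable_funB => //.
    by apply: measurable_funTS; case: pb.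
  - exact: measurable_funeM.
  - move=> t tlr; rewrite -EFinM lee_fin pE//; last exact: mem_set.
    rewrite -exprMn -[leLHS]real_normK ?num_real// -[leRHS]real_normK ?num_real//.
    rewrite lerXn2r ?nnegrE// (le_trans (kapL _ _))//.
    by rewrite normrM (gtr0_norm rho0).
by rewrite exprMn -mulrA [leRHS]EFinM lee_pmul2l// ?lte_fin ?exprn_gt0.
Qed.

Lemma lipschitz_supersolution (G : R * R -> R) (f : R -> R) a b d e N rho phi kap :
  0 < rho -> 0 < rho * e < d -> a < b -> bmo_fun a b e phi ->
  (forall s t, `|kap s - kap t| <= rho * `|s - t|) -> (forall s, `|kap s| <= N) ->
  segment_concave d G -> {within Omega d, continuous G} ->
  (forall u, G (u, u ^+ 2) = f u) -> continuous f ->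
  (exists M, forall x, Omega d x -> `|x.1| <= N -> `|G x| <= M) ->
  (\int[mu]_(t in `]a, b]) f (kap (phi t))) / (b - a) <=
  G ((\int[mu]_(t in `]a, b]) kap (phi t)) / (b - a),
     (\int[mu]_(t in `]a, b]) kap (phi t) ^+ 2) / (b - a)).
Proof.
move=> rho0 red ab bphi kapL kapN Gconc Gcont Gf cf GM; have [mphi _] := bphi.
pose psi := (kap \o phi) \_ (setT `&` `[a, b]).
have pb : bounded_on_itv a b N psi.
  apply: bounded_on_itv_cut; [by []| |by move=> t; exact: kapN].
  apply: measurableT_comp => //.
  exact: continuous_measurable_fun (lipschitz_continuous kapL).
have E l r h : a <= l -> r <= b ->
    \int[mu]_(t in `]l, r]) h (psi t) = \int[mu]_(t in `]l, r]) h (kap (phi t)).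
  move=> al rb; apply: eq_Rintegral => t; rewrite inE/= in_itv/= => /andP[lt tr].
  rewrite /psi patchE mem_set// setTI/= in_itv/=.
  by rewrite (le_trans al (ltW lt)) (le_trans tr rb).
have := @bounded_supersolution R G f a b d (rho * e) N psi red ab pb _ Gconc
  Gcont Gf cf GM.
rewrite (E a b f)// (E a b id)// (E a b (fun s => s ^+ 2))//; apply.
move=> l r al lr rb; rewrite (E l r id)// (E l r (fun s => s ^+ 2))//.
exact: lipschitz_Omega kapL kapN al lr rb.
Qed.

End bmo_functions.

(** * Exponential estimates *)

Section exponential_supersolution.
Context {R : realType}.
Implicit Types (x y : R * R) (d lam : R).

Lemma is_derive_le (g dg : R -> R) (a b : R) : a <= b ->
  (forall t : R, a <= t <= b -> is_derive t 1 g (dg t)) ->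
  exists2 c, a <= c <= b & g b - g a = dg c * (b - a).
Proof.
rewrite le_eqVlt => /predU1P[->|ab] dgP.
  by exists b; rewrite ?lexx// !subrr mulr0.
have [t||c] := @MVT R g dg a b ab.
- by rewrite in_itv/= => /andP[at_ tb]; apply: dgP; rewrite !ltW.
- apply: derivable_within_continuous => t; rewrite in_itv/= => tab.
  exact: (@ex_derive _ _ _ _ _ _ _ (dgP t tab)).
- by rewrite in_itv/= => /andP[ac cb] E; exists c => //; rewrite !ltW.
Qed.

(** Mean value theorem on [0, t] and on [t, 1]. *)
Lemma concave_chord (g dg : R -> R) (t : R) : 0 <= t <= 1 ->
  (forall s : R, 0 <= s <= 1 -> is_derive s 1 g (dg s)) ->
  (forall s u, 0 <= s -> s <= u -> u <= 1 -> dg u <= dg s) ->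
  (1 - t) * g 0 + t * g 1 <= g t.
Proof.
move=> /andP[t0 t1] gd dgn.
have [s|c /andP[c0 ct] Ec] := @is_derive_le g dg 0 t t0.
  by move=> /andP[s0 st]; apply: gd; rewrite s0 (le_trans st).
have [s|u /andP[tu u1] Eu] := @is_derive_le g dg t 1 t1.
  by move=> /andP[ts s1]; apply: gd; rewrite s1 (le_trans t0).
have := dgn c u c0 (le_trans ct tu) u1.
have h : 0 <= t * (1 - t) by rewrite mulr_ge0// subr_ge0.
move=> /(ler_wpM2l h); move: Ec Eu; rewrite subr0 => Ec Eu; nra.
Qed.

Lemma concave_chord2 (g dg ddg : R -> R) (t : R) : 0 <= t <= 1 ->
  (forall s : R, 0 <= s <= 1 -> is_derive s 1 g (dg s)) ->
  (forall s : R, 0 <= s <= 1 -> is_derive s 1 dg (ddg s)) ->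
  (forall s, 0 <= s <= 1 -> ddg s <= 0) ->
  (1 - t) * g 0 + t * g 1 <= g t.
Proof.
move=> t01 gd dgd ddg0; apply: concave_chord t01 gd _ => s u s0 su u1.
have [w|c /andP[sc cu] E] := @is_derive_le dg ddg s u su.
  by move=> /andP[sw wu]; apply: dgd; rewrite (le_trans s0 sw) (le_trans wu).
rewrite -subr_le0 E mulr_le0_ge0 ?subr_ge0// ddg0//.
by rewrite (le_trans s0 sc) (le_trans cu).
Qed.

(* The second derivative is - S (be + S')^2 exp(al + be t + S), S = sqrt Q. *)
Lemma exp_sqrt_concave (al be B C t : R) : 0 <= t <= 1 ->
  let Q s := be ^+ 2 * s ^+ 2 + B * s + C in
  (forall s, 0 <= s <= 1 -> 0 < Q s) ->
  let g s := (1 - Num.sqrt (Q s)) * expR (al + be * s + Num.sqrt (Q s)) in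
  is_true ((1 - t) * g 0 + t * g 1 <= g t).
Proof.
move=> t01 Q Q0 g.
pose S s := Num.sqrt (Q s); pose dQ s := 2 * be ^+ 2 * s + B.
pose dS s := dQ s / (2 * S s).
pose X s := al + be * s + S s.
have S0 (s : R) : 0 <= s <= 1 -> 0 < S s by move=> s01; rewrite sqrtr_gt0 Q0.
have SdS (s : R) : 0 <= s <= 1 -> S s * dS s = dQ s / 2.
  by move=> s01; rewrite /dS; field; rewrite gt_eqF// S0.
have QD (s : R) : is_derive s 1 Q (dQ s).
  rewrite /Q; apply: is_derive_eq.
  by rewrite /dQ /GRing.scale/=; ring.
have SD (s : R) : 0 <= s <= 1 -> is_derive s 1 S (dS s).
  move=> s01; have := @is_derive1_comp R (@Num.sqrt R) Q s _ _
    (is_derive1_sqrt (Q0 s s01)) (QD s).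
  move=> h; apply: (is_derive_eq h).
  by rewrite /dS /S mulrC.
have XD (s : R) : 0 <= s <= 1 -> is_derive s 1 X (be + dS s).
  move=> s01; have := SD s s01 => h; rewrite /X; apply: is_derive_eq.
  by rewrite /GRing.scale/=; ring.
have eD (s : R) : 0 <= s <= 1 -> is_derive s 1 (expR \o X) (expR (X s) * (be + dS s)).
  by move=> s01; exact: is_derive1_comp (XD s s01).
pose dg s := expR (X s) * (be - S s * be - dQ s / 2).
pose ddg s := - (S s * (be + dS s) ^+ 2 * expR (X s)).
apply: (@concave_chord2 g dg ddg) => // s s01.
- have h1 := SD s s01; have h2 := eD s s01.
  have -> : g = (fun s => (1 - S s) * (expR \o X) s) by [].
  apply: is_derive_eq; rewrite /GRing.scale/= /dg -(SdS s s01); ring.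
- have h1 := SD s s01; have h2 := eD s s01.
  have -> : dg = (fun s => (expR \o X) s * (be - S s * be - (be ^+ 2 * s + B / 2))).
    by apply/funext => u; rewrite /dg /dQ /=; congr (_ * _); field.
  apply: is_derive_eq; rewrite /GRing.scale/= /ddg.
  have := SdS s s01; rewrite /dQ => E.
  have -> : B / 2 = S s * dS s - be ^+ 2 * s by rewrite E; field.
  by ring.
- rewrite /ddg oppr_le0 mulr_ge0 ?expR_ge0// mulr_ge0 ?sqr_ge0//.
  exact/ltW/S0.
Qed.

(** The Bellman function of the integral John-Nirenberg inequality for exp(lam u). It is linear on
    the part of each tangent to the upper parabola that lies to the left of the tangency point,
    where [x.1 + gap d x] is constant. *)
Definition exp_super lam d x : R :=
  (1 - lam * gap d x) / (1 - lam * d) * expR (lam * (x.1 + gap d x - d)).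

Lemma exp_super_boundary lam d u : 0 <= d -> lam * d < 1 ->
  exp_super lam d (u, u ^+ 2) = expR (lam * u).
Proof.
move=> d0 ld; rewrite /exp_super /gap /= subrr subr0 sqrtr_sqr ger0_norm//.
by rewrite divff ?mul1r ?addrK// gt_eqF// subr_gt0.
Qed.

Lemma exp_super_concave lam d d' : 0 < lam -> 0 <= d < d' -> lam * d' < 1 ->
  segment_concave d (exp_super lam d').
Proof.
move=> l0 /andP[d0 dd'] ld x y xO yO seg t t01.
have l10 : 0 < 1 - lam * d' by rewrite subr_gt0.
pose z s := ((1 - s) * x.1 + s * y.1, (1 - s) * x.2 + s * y.2).
pose al := lam * (x.1 - d'); pose be := lam * (y.1 - x.1).
pose C := lam ^+ 2 * (d' ^+ 2 - x.2 + x.1 ^+ 2).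
pose B := lam ^+ 2 * (x.2 - y.2 + 2 * x.1 * (y.1 - x.1)).
have dd2 : d ^+ 2 < d' ^+ 2 by rewrite ltr_pXn2r// nnegrE// (le_trans d0)// ltW.
have QE (s : R) : be ^+ 2 * s ^+ 2 + B * s + C =
    lam ^+ 2 * (d' ^+ 2 - ((z s).2 - (z s).1 ^+ 2)).
  by rewrite /be /B /C /z /=; ring.
have Q0 (s : R) : 0 <= s <= 1 -> 0 < be ^+ 2 * s ^+ 2 + B * s + C.
  move=> /seg; rewrite /Omega/= => /andP[_ h].
  by rewrite QE mulr_gt0 ?exprn_gt0// subr_gt0 /z/=; lra.
have sqE (s : R) : Num.sqrt (be ^+ 2 * s ^+ 2 + B * s + C) = lam * gap d' (z s).
  by rewrite QE sqrtrM ?sqr_ge0// sqrtr_sqr (gtr0_norm l0).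
have zE (s : R) : exp_super lam d' (z s) = (1 - lam * d')^-1 *
    ((1 - Num.sqrt (be ^+ 2 * s ^+ 2 + B * s + C)) *
     expR (al + be * s + Num.sqrt (be ^+ 2 * s ^+ 2 + B * s + C))).
  rewrite /exp_super sqE mulrA [_^-1 * _]mulrC; congr (_ * expR _).
  by rewrite /al /be /z /=; ring.
have xz : x = z 0 by rewrite /z subr0 !mul1r !mul0r !addr0; case: (x).
have yz : y = z 1 by rewrite /z subrr !mul0r !mul1r !add0r; case: (y).
rewrite [X in X <= _](_ : _ = (1 - t) * exp_super lam d' (z 0) +
  t * exp_super lam d' (z 1)); last by rewrite -xz -yz.
rewrite -[X in _ <= X]/(exp_super lam d' (z t)) !zE.
rewrite !(mulrCA _ (1 - lam * d')^-1) -mulrDr ler_pM2l ?invr_gt0//.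
by have := @exp_sqrt_concave al be B C t t01 Q0.
Qed.

Lemma gap_continuous d : continuous (gap d : R * R -> R).
Proof.
move=> x; rewrite /gap; apply: (@continuous_comp _ _ _
  (fun x : R * R => d ^+ 2 - (x.2 - x.1 ^+ 2)) Num.sqrt); last exact: sqrt_continuous.
apply: cvgB; first exact: cvg_cst.
by apply: cvgB; [exact: cvg_snd|apply: cvgM; exact: cvg_fst].
Qed.

Lemma exp_super_continuous lam d : continuous (exp_super lam d).
Proof.
move=> x; rewrite /exp_super; have cgap := @gap_continuous d x.
apply: cvgM.
  apply: cvgM; last exact: cvg_cst.
  by apply: cvgB; [exact: cvg_cst|apply: cvgM; [exact: cvg_cst|]].
apply: (@continuous_comp _ _ _
    (fun x : R * R => lam * (x.1 + gap d x - d)) expR); last exact: continuous_expR.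
apply: cvgM; first exact: cvg_cst.
apply: cvgB; last exact: cvg_cst.
by apply: cvgD; [exact: cvg_fst|].
Qed.

Lemma gap_le d x : 0 <= d -> x.1 ^+ 2 <= x.2 -> gap d x <= d.
Proof.
move=> d0 x0; rewrite -[leRHS]ger0_norm// -sqrtr_sqr ler_wsqrtr//.
by rewrite gerBl subr_ge0.
Qed.

Lemma exp_super_bounds lam d x : 0 < lam -> 0 <= d -> lam * d < 1 ->
  x.1 ^+ 2 <= x.2 -> 0 <= exp_super lam d x <= (1 - lam * d)^-1 * expR (lam * x.1).
Proof.
move=> l0 d0 ld x0; have gd := gap_le d0 x0; have g0 := gap_ge0 d x.
have l10 : 0 < 1 - lam * d by rewrite subr_gt0.
have lg : lam * gap d x <= lam * d by rewrite ler_pM2l.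
rewrite /exp_super; apply/andP; split.
  by rewrite mulr_ge0 ?expR_ge0// divr_ge0 ?(ltW l10)//; lra.
apply: ler_pM; rewrite ?expR_ge0//.
- by rewrite divr_ge0 ?(ltW l10)//; lra.
- rewrite ler_piMl ?invr_ge0 ?(ltW l10)//.
  by have := mulr_ge0 (ltW l0) g0; lra.
- by rewrite ler_expR ler_pM2l//; lra.
Qed.

End exponential_supersolution.

(** * Truncation of unbounded functions and passage to the limit *)

Section truncation_limit.
Context {R : realType}.
Notation mu := (@lebesgue_measure R).
Implicit Types (phi f : R -> R) (a b d e s t : R) (x : R * R) (n : nat).

Definition clip n s : R := Num.max (- n%:R) (Num.min n%:R s).

Lemma max_lipschitz (c s t : R) : `|Num.max c s - Num.max c t| <= `|s - t|.
Proof.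
have := ler_norm (s - t); have := lerNnormlW (lexx `|s - t|); rewrite ler_norml.
by case: (leP c s) => ?; case: (leP c t) => ? ? ?; apply/andP; split; lra.
Qed.

Lemma min_lipschitz (c s t : R) : `|Num.min c s - Num.min c t| <= `|s - t|.
Proof.
have := ler_norm (s - t); have := lerNnormlW (lexx `|s - t|); rewrite ler_norml.
by case: (leP c s) => ?; case: (leP c t) => ? ? ?; apply/andP; split; lra.
Qed.

Lemma clip_lipschitz n s t : `|clip n s - clip n t| <= `|s - t|.
Proof. exact: le_trans (max_lipschitz _ _ _) (min_lipschitz _ _ _). Qed.

Lemma clip_le n s : `|clip n s| <= n%:R.
Proof.
have n0 : 0 <= n%:R :> R by [].
by rewrite ler_norml /clip le_max lexx ge_max ge_min lexx !andbT/=; lra.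
Qed.

Lemma clip_abs n s : `|clip n s| <= `|s|.
Proof.
have := clip_lipschitz n s 0; rewrite subr0.
have n0 : 0 <= n%:R :> R by [].
suff -> : clip n 0 = 0 by rewrite subr0.
rewrite /clip (@min_r _ _ n%:R)//.
by rewrite max_r// oppr_le0.
Qed.

Lemma clip_id n s : `|s| <= n%:R -> clip n s = s.
Proof.
by rewrite ler_norml /clip => /andP[s1 s2]; rewrite min_r// max_r.
Qed.

(** The shift by 2 keeps the factor strictly between 0 and 1 for every [n], so that
    [shrink n * e < d] even when d = e. *)
Definition shrink n : R := 1 - n.+2%:R^-1.

Lemma shrink_itv n : 0 < shrink n < 1.
Proof.
rewrite /shrink subr_gt0 invf_lt1 ?ltr0n// ltr1n /=.
by rewrite gtrBl invr_gt0 ltr0n.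
Qed.

Definition trunc n s : R := shrink n * clip n s.

Lemma trunc_lipschitz n s t : `|trunc n s - trunc n t| <= shrink n * `|s - t|.
Proof.
have /andP[s0 _] := shrink_itv n.
by rewrite /trunc -mulrBr normrM (gtr0_norm s0) ler_pM2l// clip_lipschitz.
Qed.

Lemma trunc_le n s : `|trunc n s| <= n%:R.
Proof.
have /andP[s0 s1] := shrink_itv n.
rewrite /trunc normrM (gtr0_norm s0) -[leRHS]mul1r.
by rewrite ler_pM ?(ltW s0) ?(ltW s1)// clip_le.
Qed.

Lemma trunc_abs n s : `|trunc n s| <= `|s|.
Proof.
have /andP[s0 s1] := shrink_itv n.
rewrite /trunc normrM (gtr0_norm s0) -[leRHS]mul1r.
by rewrite ler_pM ?(ltW s0) ?(ltW s1)// clip_abs.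
Qed.

Lemma cvg_trunc s : trunc n s @[n --> \oo] --> s.
Proof.
rewrite -[X in _ --> X](mul1r s); apply: cvgM.
  rewrite -[X in _ --> X](subr0 1); apply: cvgB; first exact: cvg_cst.
  have := @cvg_harmonic R; rewrite -(cvg_shiftS (@harmonic R)); exact.
apply: cvg_near_cst; exists (Num.truncn `|s|).+1 => // n /= sn.
apply: clip_id; rewrite (le_trans (ltW (truncnS_gt _)))// ler_nat//.
Qed.

Lemma continuous_trunc n : continuous (trunc n).
Proof. exact: lipschitz_continuous (trunc_lipschitz n). Qed.

Lemma within_continuous_cvg (A : set (R * R)) (G : R * R -> R) (u : nat -> R * R) x :
  {within A, continuous G} -> A x -> (forall n, A (u n)) ->
  (u n).1 @[n --> \oo] --> x.1 -> (u n).2 @[n --> \oo] --> x.2 ->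
  G (u n) @[n --> \oo] --> G x.
Proof.
move=> cG Ax Au u1 u2; apply/cvgrPdist_le => eps eps0.
have [dlt dlt0 H] := within_continuous_dist cG Ax eps0.
move/cvgrPdist_le : u1 => /(_ _ dlt0) u1; move/cvgrPdist_le : u2 => /(_ _ dlt0) u2.
near=> n; rewrite distrC; apply: H => //.
  by rewrite distrC; near: n.
by rewrite distrC; near: n.
Unshelve. all: by end_near. Qed.

Lemma dominated_cvg_Rintegral a b (u : nat -> R -> R) (v h : R -> R) :
  (forall n, measurable_fun setT (u n)) -> measurable_fun setT v ->
  mu.-integrable `]a, b] (EFin \o h) ->
  (forall t, u n t @[n --> \oo] --> v t) -> (forall n t, `|u n t| <= h t) ->
  \int[mu]_(t in `]a, b]) u n t @[n --> \oo] --> \int[mu]_(t in `]a, b]) v t.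
Proof.
move=> mu_ mv ih uv uh.
have vh t : `|v t| <= h t.
  by apply: (ler_cvg_to (cvg_norm (uv t)) (cvg_cst (h t))); exact: nearW.
have iv : mu.-integrable `]a, b] (EFin \o v).
  apply: le_integrable ih => //.
    by apply/measurable_EFinP; exact: measurable_funTS.
  by move=> t _ /=; rewrite lee_fin (le_trans (vh t))// ler_norm.
have dc : (\int[mu]_(t in `]a, b]) (EFin \o u n) t)%E @[n --> \oo] -->
    (\int[mu]_(t in `]a, b]) (EFin \o v) t)%E.
  apply: (@dominated_cvg _ _ R mu _ _ (fun n => EFin \o u n) (EFin \o v) (EFin \o h)) => //.
  - by move=> n; apply/measurable_EFinP; apply: measurable_funTS; exact: mu_.
  - by move=> t _; apply: cvg_EFin; [exact: nearW|exact: uv].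
  - by move=> n t _ /=; rewrite lee_fin.
apply: fine_cvg; rewrite fineK; first exact: dc.
exact: integrable_fin_num.
Qed.

Variables (phi f : R -> R) (G : R * R -> R) (a b d e : R) (x : R * R).
Hypotheses (e0 : 0 < e) (ed : e <= d) (ab : a < b) (bphi : bmo_fun a b e phi).
Hypotheses (int1 : mu.-integrable `]a, b] (EFin \o phi))
  (x1E : \int[mu]_(t in `]a, b]) phi t = x.1 * (b - a))
  (x2E : (\int[mu]_(t in `]a, b]) (phi t ^+ 2)%:E = (x.2 * (b - a))%:E)%E)
  (xO : Omega d x).
Hypotheses (Gconc : segment_concave d G) (Gcont : {within Omega d, continuous G})
  (Gf : forall u, G (u, u ^+ 2) = f u) (cf : continuous f).
Hypothesis GM : forall n : nat,
  exists M, forall x, Omega d x -> `|x.1| <= n%:R -> `|G x| <= M.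

Let psi n := trunc n \o phi.
Let xn n := ((\int[mu]_(t in `]a, b]) psi n t) / (b - a),
             (\int[mu]_(t in `]a, b]) psi n t ^+ 2) / (b - a)).

Let ba : 0 < b - a. Proof. by rewrite subr_gt0. Qed.

Let mphi : measurable_fun setT phi. Proof. by case: bphi. Qed.

Let mpsi n : measurable_fun setT (psi n).
Proof.
by apply: measurableT_comp => //; apply: continuous_measurable_fun;
  exact: continuous_trunc.
Qed.

Let int2 : mu.-integrable `]a, b] (EFin \o (fun t => phi t ^+ 2)).
Proof.
apply/integrableP; split.
  by apply/measurable_EFinP; apply: measurable_funX; exact: measurable_funTS.
under eq_integral do rewrite /= ger0_norm ?sqr_ge0//.
by rewrite x2E ltry.
Qed.

Let re_lt n : 0 < shrink n * e < d.
Proof.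
have /andP[s0 s1] := shrink_itv n.
by rewrite mulr_gt0//= (lt_le_trans _ ed)// gtr_pMl.
Qed.

Let approx n : (\int[mu]_(t in `]a, b]) f (psi n t)) / (b - a) <= G (xn n).
Proof.
have /andP[s0 _] := shrink_itv n.
exact: (@lipschitz_supersolution _ G f a b d e n%:R (shrink n) phi (trunc n) s0
  (re_lt n) ab bphi (trunc_lipschitz n) (trunc_le n) Gconc Gcont Gf cf (GM n)).
Qed.

Let cvg_Rintegral (g h : R -> R) : continuous g -> measurable_fun setT h ->
  mu.-integrable `]a, b] (EFin \o h) ->
  (forall n t, `|g (psi n t)| <= h t) ->
  \int[mu]_(t in `]a, b]) g (psi n t) @[n --> \oo] -->
  \int[mu]_(t in `]a, b]) g (phi t).
Proof.
move=> cg mh ih gh.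
have mg : measurable_fun setT g by exact: continuous_measurable_fun.
have mgpsi n : measurable_fun setT (g \o psi n) by exact: measurableT_comp.
have gcvg t : g (psi n t) @[n --> \oo] --> g (phi t).
  by apply: continuous_cvg; [exact: cg|exact: cvg_trunc].
apply: dominated_cvg_Rintegral ih _ _ => //.
exact: measurableT_comp.
Qed.

Let cvg_xn1 : (xn n).1 @[n --> \oo] --> x.1.
Proof.
have -> : x.1 = (\int[mu]_(t in `]a, b]) phi t) / (b - a).
  by rewrite x1E mulfK// gt_eqF.
apply: cvgM; last exact: cvg_cst.
apply: (@cvg_Rintegral id (fun t => `|phi t|)).
- by move=> ?; exact: cvg_id.
- exact: measurableT_comp.
- exact: (integrable_abse int1).
- by move=> n t; exact: trunc_abs.
Qed.

Let cvg_xn2 : (xn n).2 @[n --> \oo] --> x.2.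
Proof.
have -> : x.2 = (\int[mu]_(t in `]a, b]) phi t ^+ 2) / (b - a).
  by rewrite /Rintegral x2E /= mulfK// gt_eqF.
apply: cvgM; last exact: cvg_cst.
apply: (@cvg_Rintegral (fun s => s ^+ 2) (fun t => phi t ^+ 2)) => //.
- by move=> ?; exact: exprn_continuous.
- exact: measurable_funX.
- move=> n t; rewrite ger0_norm ?sqr_ge0//.
  rewrite -[leLHS]real_normK ?num_real// -[leRHS]real_normK ?num_real//.
  by rewrite lerXn2r ?nnegrE// trunc_abs.
Qed.

Let xnO n : Omega d (xn n).
Proof.
have /andP[s0 _] := shrink_itv n; have /andP[re0 red] := re_lt n.
apply: (@Omega_le _ _ (shrink n * e)); first by rewrite !ltW.
exact: (lipschitz_Omega s0 bphi (trunc_lipschitz n) (trunc_le n) (lexx a) ab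
  (lexx b)).
Qed.

Let cvg_G : G (xn n) @[n --> \oo] --> G x.
Proof. exact: (within_continuous_cvg Gcont xO xnO cvg_xn1 cvg_xn2). Qed.

(** Dominated convergence; the condition on [h] bounds [f] at all truncations of a value at once. *)
Lemma supersolution_integrable_bound (h : R -> R) : measurable_fun setT h ->
  mu.-integrable `]a, b] (EFin \o (h \o phi)) ->
  (forall s t, `|s| <= `|t| -> `|f s| <= h t) ->
  \int[mu]_(t in `]a, b]) f (phi t) <= (b - a) * G x.
Proof.
move=> mh ih fh; rewrite mulrC -ler_pdivrMr//.
apply: (ler_cvg_to _ cvg_G); last exact: nearW approx.
apply: cvgM; last exact: cvg_cst.
apply: (@cvg_Rintegral f (h \o phi)) => //; first exact: measurableT_comp.
by move=> n t; apply: fh; exact: trunc_abs.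
Qed.

(** Fatou's lemma, with no integrability of [f \o phi] assumed. This version serves the exponential,
    for which no dominating function is available yet. *)
Lemma supersolution_nonneg_bound : (forall s, 0 <= f s) ->
  (\int[mu]_(t in `]a, b]) (f (phi t))%:E <= ((b - a) * G x)%:E)%E.
Proof.
move=> f0; have mf := continuous_measurable_fun cf.
have ifn n : (\int[mu]_(t in `]a, b]) (f (psi n t))%:E)%E =
    (\int[mu]_(t in `]a, b]) f (psi n t))%:E.
  have /andP[s0 _] := shrink_itv n.
  rewrite /Rintegral fineK// ge0_fin_numE; last first.
    by apply: integral_ge0 => t _; rewrite lee_fin.
  have [M HM] := GM n.
  apply: (@le_lt_trans _ _ (\int[mu]_(t in `]a, b]) M%:E)%E).
    apply: ge0_le_integral => //.
    - by move=> t _; rewrite lee_fin.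
    - by apply/measurable_EFinP; apply: measurable_funTS;
    exact: (measurableT_comp mf (mpsi n)).
    - move=> t _; rewrite lee_fin -Gf (le_trans (ler_norm _))// HM ?trunc_le//.
      by rewrite /Omega/= lexx lerDl sqr_ge0.
  by rewrite integral_cst//= lebesgue_oc ?(ltW ab)// -EFinM ltry.
have fcvg t : (f (psi n t))%:E @[n --> \oo] --> (f (phi t))%:E.
  apply: cvg_EFin; first exact: nearW.
  by apply: continuous_cvg; [exact: cf|exact: cvg_trunc].
have -> : (\int[mu]_(t in `]a, b]) (f (phi t))%:E =
    \int[mu]_(t in `]a, b]) limn_einf (fun n => (f (psi n t))%:E))%E.
  by apply: eq_integral => t _; rewrite (cvg_limn_einf_sup (fcvg t)).1.
apply: le_trans (fatou _ _ _ _) _ => //.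
- move=> n; apply/measurable_EFinP; apply: measurable_funTS.
  exact: (measurableT_comp mf (mpsi n)).
- by move=> n t _; rewrite lee_fin.
rewrite limn_einf_lim.
have vcvg : ((b - a) * G (xn n))%:E @[n --> \oo] --> ((b - a) * G x)%:E.
  by apply: cvg_EFin; [exact: nearW|apply: cvgM; [exact: cvg_cst|exact: cvg_G]].
rewrite -(cvg_lim _ vcvg)//; apply: lee_lim.
- exact: is_cvg_einfs.
- by apply/cvg_ex; eexists; exact: vcvg.
near=> n; apply: (@le_trans _ _ (\int[mu]_(t in `]a, b]) (f (psi n t))%:E)%E).
  by apply: ereal_inf_lbound; exists n => /=.
by rewrite ifn lee_fin mulrC -ler_pdivrMr//; exact: approx.
Unshelve. all: by end_near. Qed.

End truncation_limit.

(** * Exponential growth and Taylor bounds *)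

Section growth.
Context {R : realType}.
Implicit Types (f h V : R -> R) (a b t u lam C : R).

Lemma stieltjes_oc (V : cumulative R R) a b : a <= b ->
  lebesgue_stieltjes_measure V `]a, b]%classic = (V b - V a)%:E.
Proof.
move=> ab; rewrite /lebesgue_stieltjes_measure/= /measure_extension/=.
by rewrite measurable_mu_extE/= ?wlength_itv_bnd//; exact: is_ocitv.
Qed.

(** Chebyshev's inequality: between 0 and t the weight is at least exp(-lam |t|), so the variation
    of [h] there is at most W exp(lam |t|), with W the integral of the weight. *)
Lemma stieltjes_abs_convergent_growth lam h : 0 <= lam ->
  stieltjes_abs_convergent (fun t => expR (- (lam * `|t|))) h ->
  exists2 C, 0 <= C & forall t, `|h t| <= C * expR (lam * `|t|).
Proof.
move=> l0 [V [TV iw]]; set nu := lebesgue_stieltjes_measure V in iw.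
pose w t := expR (- (lam * `|t|)).
pose W := fine (\int[nu]_t (w t)%:E)%E.
have iE : (\int[nu]_t (w t)%:E)%E = W%:E.
  by rewrite fineK//; apply: integrable_fin_num.
have w0 t : (0 <= (w t)%:E)%E by rewrite lee_fin expR_ge0.
have W0 : 0 <= W by rewrite -lee_fin -iE integral_ge0.
have bound a b t : a <= b -> (forall s, a <= s <= b -> `|s| <= `|t|) ->
    `|h b - h a| <= W * expR (lam * `|t|).
  move=> ab st.
  have hV : `|h b - h a| <= V b - V a by rewrite -lee_fin -TV// total_variation_ge.
  rewrite (le_trans hV)// mulrC -ler_pdivrMl ?expR_gt0// -expRN.
  rewrite -lee_fin EFinM -(stieltjes_oc V ab) -/nu -iE.
  rewrite -integral_cst//; apply: (@le_trans _ _ (\int[nu]_(s in `]a, b]) (w s)%:E)%E).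
    apply: ge0_le_integral => //.
    - by move=> s _; rewrite lee_fin expR_ge0.
    - by apply: measurable_funTS; case/integrableP : iw.
    - move=> s /=; rewrite in_itv/= => /andP[as_ sb].
      by rewrite lee_fin ler_expR lerN2 ler_wpM2l// st// ltW.
  apply: ge0_subset_integral => //.
  by case/integrableP : iw.
exists (`|h 0| + W); first by rewrite addr_ge0.
move=> t; have e1 : 1 <= expR (lam * `|t|) by rewrite -expR0 ler_expR mulr_ge0.
have : `|h t - h 0| <= W * expR (lam * `|t|).
  have [t0|/ltW t0] := leP 0 t.
    by apply: bound => // s /andP[s0 st]; rewrite !ger0_norm.
  by rewrite distrC; apply: bound => // s /andP[s0 st]; rewrite !ler0_norm ?lerN2.
have : `|h 0| <= `|h 0| * expR (lam * `|t|) by rewrite ler_peMr.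
have := ler_normD (h 0) (h t - h 0); rewrite subrKC mulrDl; lra.
Qed.

Definition cosh2 lam t : R := expR (lam * t) + expR (- (lam * t)).

Lemma cosh2_ge2 lam t : 2 <= cosh2 lam t.
Proof.
rewrite /cosh2; have := expR_ge1Dx (lam * t); have := expR_ge1Dx (- (lam * t)); lra.
Qed.

Lemma exp_abs_le_cosh2 lam t : expR (lam * `|t|) <= cosh2 lam t.
Proof.
rewrite /cosh2; have := expR_ge0 (lam * t); have := expR_ge0 (- (lam * t)).
by case: (ger0P t) => t0; rewrite ?mulrN; lra.
Qed.

Lemma cosh2_abs lam t : 0 <= lam ->
  cosh2 lam t = expR (lam * `|t|) + expR (- (lam * `|t|)).
Proof.
by move=> l0; rewrite /cosh2; case: (ger0P t) => t0//; rewrite mulrN opprK addrC.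
Qed.

(** Both sides have the form x + 1/x with x >= 1, a range where this function increases. *)
Lemma cosh2_le lam s t : 0 <= lam -> `|s| <= `|t| -> cosh2 lam s <= cosh2 lam t.
Proof.
move=> l0 st; rewrite !cosh2_abs//.
have /andP[x1 xy] : 1 <= expR (lam * `|s|) <= expR (lam * `|t|).
  by rewrite -{1}expR0 !ler_expR mulr_ge0//= ler_wpM2l.
rewrite !expRN; set x := expR _ in x1 xy *; set y := expR _ in xy *.
have x0 : 0 < x by lra. have y0 : 0 < y by lra.
rewrite -subr_ge0.
have -> : y + y^-1 - (x + x^-1) = (y - x) * (x * y - 1) / (x * y).
  by field; rewrite !gt_eqF.
rewrite divr_ge0 ?mulr_ge0 ?subr_ge0 ?(ltW x0) ?(ltW y0)//.
by have := ler_pM ler01 ler01 x1 (le_trans x1 xy); rewrite mulr1.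
Qed.

Lemma nonpos_of_second_derivative (g dg ddg : R -> R) u :
  (forall t : R, is_derive t 1 g (dg t)) -> (forall t : R, is_derive t 1 dg (ddg t)) ->
  (forall t, ddg t <= 0) -> g u = 0 -> dg u = 0 -> forall t, g t <= 0.
Proof.
move=> gd dgd ddg0 gu dgu t; have [ut|/ltW tu] := leP u t.
  have [c /andP[uc ct]] := @is_derive_le R g dg u t ut.
  rewrite gu subr0 => ->; rewrite mulr_le0_ge0 ?subr_ge0//.
  have [c' _] := @is_derive_le R dg ddg u c uc.
  by rewrite dgu subr0 => ->; rewrite mulr_le0_ge0 ?subr_ge0.
have [c /andP[tc cu]] := @is_derive_le R g dg t u tu.
rewrite gu sub0r => /eqP; rewrite eqr_oppLR => /eqP ->.
rewrite oppr_le0 mulr_ge0 ?subr_ge0//.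
have [c' _] := @is_derive_le R dg ddg c u cu.
rewrite dgu sub0r => /eqP; rewrite eqr_oppLR => /eqP ->.
by rewrite oppr_ge0 mulr_le0_ge0 ?subr_ge0.
Qed.

(** Comparison of second derivatives. That of the last term is C exp(lam |u|) cosh2 lam (t - u),
    which dominates C exp(lam |t|) because |t| <= |u| + |t - u|; hence the constant
    [C / lam ^+ 2]. *)
Lemma taylor_upper (f df ddf : R -> R) lam C u : 0 < lam -> 0 <= C ->
  (forall t : R, is_derive t 1 f (df t)) -> (forall t : R, is_derive t 1 df (ddf t)) ->
  (forall t, ddf t <= C * expR (lam * `|t|)) -> forall t,
  f t <= f u + df u * (t - u) +
    C / lam ^+ 2 * expR (lam * `|u|) * (cosh2 lam (t - u) - 2).
Proof.
move=> l0 C0 fd dfd ddfC t; rewrite -subr_le0.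
set K := C / lam ^+ 2 * expR (lam * `|u|).
pose g s := f s - (f u + df u * (s - u) + K * (cosh2 lam (s - u) - 2)).
pose dg s := df s - (df u + K * (lam * (expR (lam * (s - u)) - expR (- (lam * (s - u)))))).
pose ddg s := ddf s - K * (lam ^+ 2 * cosh2 lam (s - u)).
have expd c (s : R) : is_derive s 1 (fun s => expR (c * (s - u))) (c * expR (c * (s - u))).
  have h : is_derive s 1 (fun s => c * (s - u)) c.
    by apply: is_derive_eq; rewrite /GRing.scale/=; ring.
  have := @is_derive1_comp R expR (fun v => c * (v - u)) s _ _ (is_derive_expR _) h.
  by move=> h'; apply: (is_derive_eq h'); rewrite mulrC.
apply: (@nonpos_of_second_derivative g dg ddg u) => [s|s|s||].
- have h1 := expd lam s; have h2 := expd (- lam) s; have h3 := fd s.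
  have -> : g = fun s => f s - (f u + df u * (s - u) + K * (expR (lam * (s - u)) +
      expR (- lam * (s - u)) - 2)).
    by apply/funext => v; rewrite /g /cosh2 mulNr.
  apply: is_derive_eq; rewrite /GRing.scale/= /dg !mulNr; ring.
- have h1 := expd lam s; have h2 := expd (- lam) s; have h3 := dfd s.
  have -> : dg = fun s => df s - (df u + K * (lam * (expR (lam * (s - u)) -
      expR (- lam * (s - u))))).
    by apply/funext => v; rewrite /dg mulNr.
  apply: is_derive_eq; rewrite /GRing.scale/= /ddg /cosh2 !mulNr; ring.
- rewrite /ddg subr_le0 (le_trans (ddfC s))//.
  rewrite (_ : K * _ = C * (expR (lam * `|u|) * cosh2 lam (s - u))); last first.
    by rewrite /K; field; rewrite gt_eqF.
  rewrite ler_wpM2l//; apply: (@le_trans _ _ (expR (lam * `|u|) * expR (lam * `|s - u|))).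
    rewrite -expRD -mulrDr ler_expR ler_pM2l//.
    by have := ler_normD u (s - u); rewrite subrKC.
  by rewrite ler_pM2l ?expR_gt0// exp_abs_le_cosh2.
- by rewrite /g /cosh2 subrr !mulr0 oppr0 expR0; lra.
- by rewrite /dg subrr !mulr0 oppr0 expR0 subrr !mulr0 addr0 subrr.
Qed.

End growth.

(** * Realization of discrete distributions *)

Section realization.
Context {R : realType}.
Notation mu := (@lebesgue_measure R).
Implicit Types (g h c : R -> R) (l r t v m : R).

Lemma integral_step (D : set R) (A : R -> set R) (vs : seq R) c :
  measurable D -> (mu D < +oo)%E -> (forall v, measurable (A v)) ->
  mu.-integrable D (EFin \o (fun t => \sum_(v <- vs) c v * \1_(A v) t)) /\
  \int[mu]_(t in D) (\sum_(v <- vs) c v * \1_(A v) t) =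
  \sum_(v <- vs) c v * fine (mu (D `&` A v)).
Proof.
move=> mD Doo mA; elim: vs => [|v vs [IHi IHe]].
  under eq_fun do rewrite big_nil.
  rewrite big_nil; split; last by rewrite Rintegral_cst// mul0r.
  exact: integrable0.
have iv : mu.-integrable D (EFin \o (fun t => c v * \1_(A v) t)).
  apply: measurable_bounded_integrable => //.
  - by apply: measurable_funM; [exact: measurable_cst|exact: (measurable_indic (mA v))].
  - exists `|c v|; split; first exact: num_real.
    move=> x cx t _ /=; rewrite (le_trans _ (ltW cx))// normrM indicE.
    by rewrite ler_piMr//; case: (_ \in _); rewrite ?normr1 ?normr0.
under eq_fun do rewrite big_cons.
rewrite big_cons; split.
  suff : mu.-integrable D (fun t => (EFin \o (fun t => c v * \1_(A v) t)%R) t +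
     (EFin \o (fun t => \sum_(j <- vs) c j * \1_(A j) t)%R) t)%E.
    exact: eq_integrable.
  exact: integrableD.
rewrite RintegralD// IHe; congr (_ + _).
rewrite RintegralZl//; last first.
  apply: measurable_bounded_integrable => //; first exact: (measurable_indic (mA v)).
  exists 1; split; first exact: num_real.
  move=> x cx t _ /=; rewrite (le_trans _ (ltW cx))// indicE.
  by case: (_ \in _); rewrite ?normr1 ?normr0.
rewrite /Rintegral (integral_indic mu mD (mA v)) [in RHS]setIC//.
Qed.

Variables (s : seq (R * R)) (e a b : R).
Hypotheses (s_bmo : monotone_bmo e s) (mass1 : wsum (cst 1) s = 1) (ab : a < b).

Let s0 : nonneg s. Proof. by case: s_bmo. Qed.

Let ba : 0 < b - a. Proof. by rewrite subr_gt0. Qed.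

(** The quantile function of the distribution, transported to [a, b[: the value [v] occupies a cell
    of length [b - a] times its mass, cells following the order of the values. [undup] is there
    because [s] may list a value several times. *)
Let vals := undup [seq p.1 | p <- s].
Let Dl v := a + (b - a) * wsum (fun x => (x < v)%R%:R) s.
Let Dr v := a + (b - a) * wsum (fun x => (x <= v)%R%:R) s.
Let cell v := `[Dl v, Dr v[%classic.
Let phi t := \sum_(v <- vals) v * \1_(cell v) t.

Let wsum_le g h : (forall x, g x <= h x) -> wsum g s <= wsum h s.
Proof.
move=> gh; rewrite /wsum big_seq [leRHS]big_seq ler_sum// => p ps.
by rewrite ler_wpM2l// s0.
Qed.

Let DrE v : Dr v = Dl v + (b - a) * atom v s.
Proof.
rewrite /Dr /Dl /atom -addrA -mulrDr -wsumD; congr (_ + _ * _).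
by apply: eq_wsum => p _; case: ltgtP => _; rewrite ?addr0 ?add0r.
Qed.

Let Dlr v : Dl v <= Dr v.
Proof. by rewrite DrE lerDl mulr_ge0 ?(ltW ba)// atom_ge0. Qed.

Let Drl v w : v < w -> Dr v <= Dl w.
Proof.
move=> vw; rewrite lerD2l ler_pM2l//; apply: wsum_le => x.
by case: (leP x v) => [xv|_]; rewrite ?ler0n// (le_lt_trans xv vw).
Qed.

(** Take the least value [v] with [t < Dr v]; its cell begins where the cell of the preceding value
    ends, or at [a]. *)
Let cell_exists t : a <= t < b -> exists2 v, v \in vals & cell v t.
Proof.
move=> /andP[at_ tb].
have vals_neq0 : vals != [::].
  rewrite /vals; case: (s) mass1 => [|p q _] /=.
    by rewrite /wsum big_nil => /esym/eqP; rewrite oner_eq0.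
  case: ifP => //= pq; apply: contraTneq pq => q0.
  by rewrite -mem_undup q0.
have [vM vMs vMmax] := seq_max_exists vals_neq0.
have DM : Dr vM = b.
  have cM : wsum (fun x => (x <= vM)%R%:R) s = wsum (cst 1) s.
    by apply: eq_wsum => p ps; rewrite vMmax// mem_undup map_f.
  by rewrite /Dr cM mass1 mulr1 subrKC.
have [|v vs vmin] := @seq_min_exists R [seq v <- vals | t < Dr v].
  rewrite -size_eq0 size_filter -lt0n -has_count; apply/hasP; exists vM => //.
  by rewrite DM.
move: vs; rewrite mem_filter => /andP[tv vs]; exists v => //.
rewrite /cell/= in_itv/= tv andbT.
have [/hasP[w ws wv]|/hasPn nw] := boolP (has (fun w => w < v) vals); last first.
  have c0 : wsum (fun x => (x < v)%R%:R) s = wsum (fun x => 0 * x) s.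
    apply: eq_wsum => p ps; rewrite mul0r (negbTE (nw p.1 _))//.
    by rewrite mem_undup map_f.
  by rewrite /Dl c0 wsumZ mul0r mulr0 addr0.
have [|w' w's w'max] := @seq_max_exists R [seq w <- vals | w < v].
  rewrite -size_eq0 size_filter -lt0n -has_count; apply/hasP; by exists w.
move: w's; rewrite mem_filter => /andP[w'v w's].
have -> : Dl v = Dr w'.
  rewrite /Dl /Dr; congr (_ + _ * _); apply: eq_wsum => p ps; congr ((nat_of_bool _)%:R).
  have pv : p.1 \in vals by rewrite mem_undup map_f.
  apply/idP/idP => [pv'|/le_lt_trans]; last exact.
  by apply: w'max; rewrite mem_filter pv' pv.
rewrite leNgt; apply/negP => tw'.
have := vmin w'; rewrite mem_filter tw' w's => /(_ isT).
by rewrite leNgt w'v.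
Qed.

Let cell_unique t v w : cell v t -> cell w t -> v = w.
Proof.
rewrite /cell/= !in_itv/= => /andP[v1 v2] /andP[w1 w2].
by have [vw|wv|//] := ltgtP v w; [have := Drl vw|have := Drl wv]; lra.
Qed.

Let sum_cell c t v : v \in vals -> cell v t ->
  \sum_(w <- vals) c w * \1_(cell w) t = c v.
Proof.
move=> vs vt; rewrite (bigD1_seq v) ?undup_uniq//= indicE mem_set// mulr1.
rewrite big1 ?addr0// => w wv; rewrite indicE memNset ?mulr0// => wt.
by move/eqP : wv; apply; exact: cell_unique wt vt.
Qed.

Let phiE g t : a <= t < b ->
  g (phi t) = \sum_(v <- vals) g v * \1_(cell v) t.
Proof.
move=> /cell_exists[v vs vt].
by rewrite (sum_cell g vs vt) /phi (sum_cell id vs vt).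
Qed.

Let mcell v : measurable (cell v). Proof. exact: measurable_itv. Qed.

Section subinterval.
Variables (l r : R).
Hypotheses (al : a <= l) (lr : l < r) (rb : r <= b).

Let len v := Num.max 0 (Num.min r (Dr v) - Num.max l (Dl v)).

(** The fraction of the cell of [v] inside [l, r]. Empty cells need a value as well, because a
    window must equal 1 at every real between two values of positive weight, whether or not it
    carries mass. *)
Let lam v := if Dl v < Dr v then len v / (Dr v - Dl v)
  else ((l < Dr v)%R && (Dl v < r)%R)%:R.

Let len_le v : len v <= Dr v - Dl v.
Proof.
rewrite /len ge_max subr_ge0 Dlr/=.
have : Num.min r (Dr v) <= Dr v by rewrite ge_min lexx orbT.
have : Dl v <= Num.max l (Dl v) by rewrite le_max lexx orbT.
lra.
Qed.

Let len_full v : l <= Dl v -> Dr v <= r -> len v = Dr v - Dl v.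
Proof. by move=> h1 h2; rewrite /len min_r// max_r// max_r// subr_ge0 Dlr. Qed.

Let len_gt0 v : 0 < len v -> l < Dr v /\ Dl v < r.
Proof.
rewrite /len lt_max ltxx/= subr_gt0 lt_min !gt_max => /andP[/andP[_ h1] /andP[h2 _]].
by [].
Qed.

Let window_lam : window lam.
Proof.
have pos v : 0 < lam v -> l < Dr v /\ Dl v < r.
  rewrite /lam; case: ifPn => [lt|_].
    by rewrite pmulr_lgt0 ?invr_gt0 ?subr_gt0//; exact: len_gt0.
  by case: (l < Dr v); case: (Dl v < r); rewrite /= ?ltxx.
split=> [v|x y z /andP[xy yz] /pos[lx _] /pos[_ zr]].
  rewrite /lam; case: ifPn => [lt|_]; last first.
    by case: (l < Dr v); case: (Dl v < r); rewrite /= ?lexx ?ler01.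
  rewrite divr_ge0 ?subr_ge0 ?(ltW lt)//=; last by rewrite /len le_max lexx.
  by rewrite ler_pdivrMr ?subr_gt0// mul1r len_le.
have ly : l < Dl y by exact: lt_le_trans (Drl xy).
have yr : Dr y < r by exact: le_lt_trans (Drl yz) _.
rewrite /lam; case: ifPn => [lt|_].
  by rewrite len_full ?ltW// divff// gt_eqF// subr_gt0.
by rewrite (lt_le_trans ly (Dlr y)) (le_lt_trans (Dlr y) yr).
Qed.

Let fine_mu v : fine (mu (`[l, r[ `&` cell v)) = (b - a) * (lam v * atom v s).
Proof.
have -> : (b - a) * (lam v * atom v s) = len v.
  rewrite mulrCA (_ : _ * atom v s = Dr v - Dl v); last by rewrite DrE; ring.
  rewrite /lam; case: ifPn => [lt|]; first by rewrite divfK// gt_eqF// subr_gt0.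
  rewrite -leNgt => le; have E : Dr v = Dl v by apply: le_anti; rewrite le Dlr.
  rewrite E subrr mulr0; apply/esym/max_l; rewrite E subr_le0.
  by rewrite ge_min [X in _ || X]le_max lexx !orbT.
have -> : `[l, r[ `&` cell v = `[Num.max l (Dl v), Num.min r (Dr v)[%classic.
  rewrite /cell; apply/seteqP; split=> t /=; rewrite !in_itv/= ge_max lt_min.
    by move=> [/andP[-> ->] /andP[-> ->]].
  by move=> /andP[/andP[-> ->] /andP[-> ->]].
rewrite lebesgue_measure_itv/= lte_fin /len.
case: (ltP (Num.max l (Dl v)) (Num.min r (Dr v))) => h /=.
  by rewrite [RHS]max_r// subr_ge0 ltW.
by rewrite [RHS]max_l// subr_le0.
Qed.

Let step_integral g :
  \int[mu]_(t in `[l, r[) (\sum_(v <- vals) g v * \1_(cell v) t) =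
  (b - a) * wsum (fun x => lam x * g x) s.
Proof.
have [_ ->] := integral_step vals g (measurable_itv `[l, r[)
  (lebesgue_bnd_lty true true l r) mcell.
under eq_bigr do rewrite fine_mu mulrCA.
rewrite -big_distrr/=; congr (_ * _).
under eq_bigr do rewrite mulrA [_ * lam _]mulrC big_distrr/=.
rewrite exchange_big/= /wsum; apply: eq_big_seq => p ps.
rewrite (bigD1_seq p.1) ?undup_uniq ?mem_undup ?map_f//= eqxx mulr1 big1 ?addr0.
  by rewrite mulrC.
by move=> v /negbTE; rewrite eq_sym => ->; rewrite !mulr0.
Qed.

Lemma step_function_mean (d1 d2 : bool) : exists2 lam, window lam &
  forall g, mean (Interval (BSide d1 l) (BSide d2 r)) (g \o phi) =
  ((b - a) * wsum (fun x => lam x * g x) s / (r - l))%:E.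
Proof.
exists lam; first exact: window_lam.
move=> g; have gE t : `]l, r[%classic t ->
    (g \o phi) t = \sum_(v <- vals) g v * \1_(cell v) t.
  rewrite /= in_itv/= => /andP[lt tr]; apply: phiE.
  by rewrite (le_trans al (ltW lt)) (lt_le_trans tr).
have mstep : measurable_fun setT (fun t => \sum_(v <- vals) g v * \1_(cell v) t).
  apply: measurable_sum => v.
  by apply: measurable_funM; [exact: measurable_cst|exact: (measurable_indic (mcell v))].
rewrite mean_itv//; last first.
  apply: (eq_measurable_fun (fun t => \sum_(v <- vals) g v * \1_(cell v) t)).
    by move=> t; rewrite inE => /gE ->.
  exact: measurable_funTS.
rewrite (_ : (\int[mu]_(t in `]l, r]) _)%E =
  \int[mu]_(t in `[l, r[) (\sum_(v <- vals) g v * \1_(cell v) t)%:E)%E; last first.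
  rewrite [LHS]integral_itv_bndoo; last first.
    apply/measurable_EFinP.
    apply: (eq_measurable_fun (fun t => \sum_(v <- vals) g v * \1_(cell v) t)).
      by move=> t; rewrite inE => /gE ->.
    exact: measurable_funTS.
  rewrite [RHS]integral_itv_bndoo; last first.
    by apply/measurable_EFinP; exact: measurable_funTS.
  by apply: eq_integral => t; rewrite inE => /gE ->.
have [it _] := integral_step vals g (measurable_itv `[l, r[)
  (lebesgue_bnd_lty true true l r) mcell.
rewrite -[X in (_ * X)%E]fineK; last exact: integrable_fin_num.
by rewrite -/(Rintegral _ _ _) step_integral -EFinM mulrC.
Qed.

End subinterval.

Lemma integrable_step_function (A : set R) : measurable A -> (mu A < +oo)%E ->
  mu.-integrable A (EFin \o phi).
Proof. by move=> mA Aoo; have [] := integral_step vals id mA Aoo mcell. Qed.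

(** Over a subinterval that sees a window of mass p, [e ^+ 2] minus the mean square oscillation is
    [disc_sum] divided by p^2. *)
Lemma step_function_bmo (c1 c2 : bool) :
  let I := Interval (BSide c1 a) (BSide c2 b) in
  exists phi, BMO e I phi /\ forall g, mean I (g \o phi) = (wsum g s)%:E.
Proof.
move=> I; exists phi.
have mean1 (d1 d2 : bool) l r : l < r ->
    mean (Interval (BSide d1 l) (BSide d2 r)) (cst 1 \o phi) = 1%:E.
  move=> lr; have I1 : (\int[mu]_(t in `]l, r]) ((cst 1 \o phi) t)%:E = (r - l)%:E)%E.
    transitivity (\int[mu]_(t in `]l, r]) cst 1%E t)%E; first by [].
    by rewrite integral_cst// mul1e; exact/lebesgue_oc/ltW.
  rewrite mean_itv//; last exact: measurable_cst.
  by rewrite I1 -EFinM mulVf// gt_eqF// subr_gt0.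
have meanJ (d1 d2 : bool) l r : a <= l -> l < r -> r <= b ->
    exists lam, [/\ window lam, 0 < wsum lam s &
    forall g, mean (Interval (BSide d1 l) (BSide d2 r)) (g \o phi) =
      (wsum (fun x => lam x * g x) s / wsum lam s)%:E].
  move=> al lr rb; have [lam wlam H] := step_function_mean al lr rb d1 d2.
  have rl : 0 < r - l by rewrite subr_gt0.
  have := H (cst 1); rewrite mean1// => -[].
  have -> : wsum (fun x => lam x * cst 1 x) s = wsum lam s.
    by apply: eq_wsum => p _; rewrite mulr1.
  move=> /esym/divr1_eq E.
  have W0 : 0 < wsum lam s by rewrite -(pmulr_rgt0 _ ba) E.
  exists lam; split => // g; rewrite H -E; congr (_%:E).
  by field; rewrite !gt_eqF.
split; last first.
  move=> g; have [lam wlam H] := step_function_mean (lexx a) ab (lexx b) c1 c2.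
  have [lam01 _] := wlam.
  have E : wsum lam s = 1.
    have := H (cst 1); rewrite mean1// mulrAC divff ?gt_eqF// mul1r => -[->].
    by apply: eq_wsum => p _; rewrite mulr1.
  rewrite H mulrAC divff ?gt_eqF// mul1r; congr (_%:E).
  (* On the whole interval the window can differ from 1 only at values of mass zero: the missing
     weights are nonnegative and sum to 0. *)
  have : wsum (fun x => 1 - lam x) s == 0.
    apply/eqP; have := wsumD (fun x => 1 - lam x) lam s; rewrite E.
    have -> : wsum (fun x => 1 - lam x + lam x) s = 1.
      by rewrite -[RHS]mass1; apply: eq_wsum => p _; rewrite subrK.
    by lra.
  rewrite /wsum big_seq psumr_eq0 => [/allP z|p ps]; last first.
    by have /andP[_ ?] := lam01 p.1; rewrite mulr_ge0 ?s0// subr_ge0.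
  apply: eq_big_seq => p ps; have := z p ps; rewrite ps mulf_eq0 subr_eq0.
  by move=> /orP[/eqP ->|/eqP <-]; rewrite ?mul0r// mul1r.
split.
  apply: integrable_step_function; first exact: measurable_itv.
  exact: lebesgue_bnd_lty.
apply: ge_ereal_sup => _ [J [Jok JI] <-].
have [d1 [d2 [l [r [lr JE]]]]] := bounded_nondegenerateP Jok.
have inJ t : l < t < r -> a <= t <= b.
  move=> ltr; have IJ : `]l, r[ `<=` [set` J].
    by rewrite JE; apply: subset_itv; rewrite bnd_simp; case: (d1); case: (d2).
  have Iab : [set` I] `<=` `[a, b].
    by apply: subset_itv; rewrite bnd_simp; case: (c1); case: (c2).
  by have := Iab t (JI t (IJ t _)); rewrite /= !in_itv/=; apply.
have al : a <= l.
  (* If [l < a], the point [(l + u) / 2] belongs to [J] and lies to the left of [a]. *)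
  rewrite leNgt; apply/negP => la; pose u := Num.min a r.
  have lu : l < u by rewrite lt_min la lr.
  have [ua ur] : u <= a /\ u <= r by rewrite !ge_min !lexx orbT.
  have /inJ/andP[] : l < (l + u) / 2 < r by apply/andP; split; lra.
  lra.
have rb : r <= b.
  rewrite leNgt; apply/negP => br; pose u := Num.max b l.
  have ur : u < r by rewrite gt_max br lr.
  have [bu lu] : b <= u /\ l <= u by rewrite !le_max !lexx orbT.
  have /inJ/andP[] : l < (u + r) / 2 < r by apply/andP; split; lra.
  lra.
have [lam [wlam W0 H]] := meanJ d1 d2 _ _ al lr rb.
set m := fine _.
have mE : m = wsum (fun x => lam x * x) s / wsum lam s.
  by rewrite /m JE -[phi]/(id \o phi) H.
have := H (fun x => `|x - m| ^+ 2); rewrite JE => ->.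
rewrite lee_fin ler_pdivrMr//.
have -> : wsum (fun x => lam x * `|x - m| ^+ 2) s =
    wsum (fun x => lam x * x ^+ 2) s - 2 * m * wsum (fun x => lam x * x) s +
    m ^+ 2 * wsum lam s.
  rewrite -mulNr -!wsumZ -!wsumD; apply: eq_wsum => p _.
  by rewrite real_normK ?num_real//; ring.
have [_ /(_ _ wlam)] := s_bmo; rewrite /disc_sum /disc.
move: mE W0; set p := wsum lam s; set q := wsum _ s; set rr := wsum _ s => mE W0 D.
rewrite -subr_ge0 mE.
have -> : e ^+ 2 * p - (rr - 2 * (q / p) * q + (q / p) ^+ 2 * p) =
  (e ^+ 2 * p ^+ 2 - p * rr + q ^+ 2) / p by field; rewrite gt_eqF.
by rewrite divr_ge0// ltW.
Qed.

End realization.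

(** * Mean estimates *)

Section mean_bounds.
Context {R : realType}.
Notation mu := (@lebesgue_measure R).
Implicit Types (f phi : R -> R) (G : R * R -> R) (a b d e lam t u : R) (x : R * R).

Lemma within_continuous_bounded d N G : {within Omega d, continuous G} ->
  exists M, forall x, Omega d x -> `|x.1| <= N -> `|G x| <= M.
Proof.
move=> cG.
pose K := Omega d `&` [set x | `|x.1| <= N].
have cK : compact K.
  apply: (@subclosed_compact _ _ (`[- N, N] `*` `[0, N ^+ 2 + d ^+ 2])).
  - have cv : continuous (fun x : R * R => x.2 - x.1 ^+ 2).
      by move=> x; apply: cvgB; [exact: cvg_snd|apply: cvgM; exact: cvg_fst].
    have cn : continuous (fun x : R * R => `|x.1|).
      by move=> x; apply: cvg_norm; exact: cvg_fst.
    have -> : K = ((fun x => x.2 - x.1 ^+ 2) @^-1` [set y | 0 <= y] `&`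
        (fun x => x.2 - x.1 ^+ 2) @^-1` [set y | y <= d ^+ 2]) `&`
        (fun x => `|x.1|) @^-1` [set y | y <= N].
      rewrite /K /Omega; apply/seteqP; split=> x /=; rewrite subr_ge0 lerBlDl.
        by move=> [/andP[]].
      by move=> [[-> ->] ->].
    apply: closedI; first apply: closedI.
    - by move/continuous_closedP : cv; apply; exact: closed_ge.
    - by move/continuous_closedP : cv; apply; exact: closed_le.
    - by move/continuous_closedP : cn; apply; exact: closed_le.
  - by apply: compact_setX; exact: segment_compact.
  - move=> x [/andP[x1 x2] xN] /=; rewrite !in_itv/= -ler_norml xN; split => //.
    rewrite (le_trans (sqr_ge0 _) x1)/= (le_trans x2)// lerD2r.
    rewrite -[leLHS]real_normK ?num_real// lerXn2r ?nnegrE//.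
    exact: le_trans xN.
have cGK : {within K, continuous G}.
  by apply: continuous_subspaceW cG => x [].
have [M [_ HM]] := compact_bounded (continuous_compact cGK cK).
exists (M + 1) => x xO xN; apply: (HM (M + 1)); first by rewrite ltrDl.
by exists x.
Qed.

(** The segment itself is a convex subset of the strip. [conv] puts its weight on the first point,
    hence the parameter [1 - t]. *)
Lemma locally_concave_segment d G : locally_concave (Omega d) G ->
  segment_concave d G.
Proof.
move=> lc x y xO yO seg t /andP[t0 t1].
pose C := [set z : R * R | exists2 s, 0 <= s <= 1 &
   z = ((1 - s) * x.1 + s * y.1, (1 - s) * x.2 + s * y.2)].
have CO : C `<=` Omega d by move=> _ [s s01 ->]; exact: seg.
have t01 : 0 <= 1 - t <= 1 by apply/andP; split; lra.
have xC : x \in C.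
  by rewrite inE; exists 0; rewrite ?lexx ?ler01// subr0 !mul1r !mul0r !addr0; case: (x).
have yC : y \in C.
  by rewrite inE; exists 1; rewrite ?lexx ?ler01// subrr !mul1r !mul0r !add0r; case: (y).
have cC : @convex_set R (R^o * R^o)%type C.
  move=> u v k; rewrite !inE => -[p /andP[p0 p1] ->] [q /andP[q0 q1] ->].
  have k0 : 0 <= k%:num by []. have k1 : k%:num <= 1 by [].
  exists (k%:num * p + (1 - k%:num) * q).
    apply/andP; split; first by rewrite addr_ge0 ?mulr_ge0 ?subr_ge0.
    have h1 := ler_wpM2l k0 p1.
    have : (1 - k%:num) * q <= (1 - k%:num) * 1 by rewrite ler_wpM2l ?subr_ge0.
    by lra.
  by congr (_, _); rewrite /= /GRing.scale/= /unstable.onem; ring.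
pose k : {i01 R} := Itv01 (proj1 (andP t01)) (proj2 (andP t01)).
have := lc C CO cC k x y xC yC.
have -> : @conv R (convex_lmodType (R^o * R^o)%type) k x y =
    ((1 - t) * x.1 + t * y.1, (1 - t) * x.2 + t * y.2).
  by congr (_, _); rewrite /= /GRing.scale/= /unstable.onem; ring.
have -> : @conv R R^o k (- G x) (- G y) = - ((1 - t) * G x + t * G y).
  by rewrite convRE /= /unstable.onem; ring.
by rewrite lerN2.
Qed.

Lemma segment_locally_concave d G : segment_concave d G ->
  locally_concave (Omega d) G.
Proof.
move=> sc C CO cC k x y xC yC.
have pt (j : {i01 R}) : @conv R (convex_lmodType (R^o * R^o)%type) j x y =
    ((1 - (1 - j%:num)) * x.1 + (1 - j%:num) * y.1,
     (1 - (1 - j%:num)) * x.2 + (1 - j%:num) * y.2).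
  by congr (_, _); rewrite /= /GRing.scale/= /unstable.onem; ring.
have seg : segment_in d x y.
  move=> t /andP[t0 t1]; have t01 : 0 <= 1 - t <= 1 by apply/andP; split; lra.
  pose j : {i01 R} := Itv01 (proj1 (andP t01)) (proj2 (andP t01)).
  have := cC x y j xC yC; rewrite inE pt => /CO; rewrite /= => h.
  by move: h; rewrite (_ : 1 - (1 - t) = t); last ring.
have xO : Omega d x by apply: CO; rewrite -inE.
have yO : Omega d y by apply: CO; rewrite -inE.
rewrite pt convRE -[k%:inum]/(k%:num) /unstable.onem.
have k01 : (0 : R) <= 1 - k%:num <= 1 by apply/andP; split; rewrite ?subr_ge0// gerBl.
have := sc x y xO yO seg _ k01; rewrite -lerN2 => h; apply: le_trans h _.
by rewrite le_eqVlt; apply/orP; left; apply/eqP; ring.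
Qed.

End mean_bounds.

Section mean_estimates.
Context {R : realType}.
Notation mu := (@lebesgue_measure R).
Implicit Types (f phi : R -> R) (G : R * R -> R) (a b d e lam t u : R) (x : R * R).

Definition mean_data a b e phi x := [/\ bmo_fun a b e phi,
  mu.-integrable `]a, b] (EFin \o phi),
  \int[mu]_(t in `]a, b]) phi t = x.1 * (b - a),
  (\int[mu]_(t in `]a, b]) (phi t ^+ 2)%:E = (x.2 * (b - a))%:E)%E & Omega e x].

Lemma mean_dataN a b e phi x : mean_data a b e phi x ->
  mean_data a b e (fun t => - phi t) (- x.1, x.2).
Proof.
move=> [[mphi bmo] i1 E1 E2 xO]; split.
- split=> [|l r al lr rb]; first exact: measurable_funN.
  have [m le] := bmo l r al lr rb; exists (- m); apply: le_trans le.
  rewrite le_eqVlt; apply/orP; left; apply/eqP; apply: eq_integral => t _.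
  by congr (_%:E); ring.
- suff : mu.-integrable `]a, b] (fun t => - (EFin \o phi) t)%E by exact: eq_integrable.
  exact: integrableN.
- under eq_Rintegral do rewrite -mulN1r.
  by rewrite RintegralZl// E1 /= !mulNr mul1r.
- by under eq_integral do rewrite sqrrN.
- by move: xO; rewrite /Omega/= sqrrN.
Qed.

Lemma BMO_mean_data (c1 c2 : bool) a b e phi x : a < b ->
  let I := Interval (BSide c1 a) (BSide c2 b) in
  BMO e I phi -> mean I phi = x.1%:E -> mean I (fun t => phi t ^+ 2) = x.2%:E ->
  Omega e x -> mean_data a b e (phi \_ `]a, b[) x.
Proof.
move=> ab I bmo m1 m2 xO; have [mphi bphi] := BMO_bmo_fun ab bmo.
have ba : 0 < b - a by rewrite subr_gt0.
have solve (y : R) (z : \bar R) : ((b - a)^-1%:E * z = y%:E)%E -> z = (y * (b - a))%:E.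
  move=> H; rewrite mulrC EFinM -H muleA -EFinM divff ?gt_eqF// mul1e//.
have := m1; rewrite -[phi in mean I phi]/(id \o phi) (mean_patch c1 c2 ab mphi)//.
move=> /solve E1.
have := m2; rewrite -[fun t => _]/((fun s => s ^+ 2) \o phi).
rewrite (mean_patch c1 c2 ab mphi); last exact: measurable_funX.
move=> /solve E2; split => //; last by rewrite /Rintegral E1.
have [iphi _] := bmo; have sub : `]a, b[ `<=` [set` I].
  by apply: subset_itv; rewrite bnd_simp; case: (c1); case: (c2).
have ioo : mu.-integrable `]a, b[ (EFin \o phi) by exact: integrableS iphi.
apply: (@integrableS _ _ _ mu setT) => //.
rewrite -restrict_EFin.
by apply/integrable_restrict => //; rewrite setTI.
Qed.

Section fixed_domain.
Variables (lam e d d' a b : R).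
Hypotheses (l0 : 0 < lam) (e0 : 0 < e) (ed : e < d) (dd' : d < d') (ld' : lam * d' < 1)
  (ab : a < b).

Let ba : 0 < b - a. Proof. by rewrite subr_gt0. Qed.

Lemma exp_mean phi x : mean_data a b e phi x ->
  (\int[mu]_(t in `]a, b]) (expR (lam * phi t))%:E <=
    ((b - a) * exp_super lam d' x)%:E)%E.
Proof.
move=> [bphi i1 E1 E2 xO]; have d0 : 0 < d by exact: lt_trans ed.
have d'0 : 0 < d' by exact: lt_trans dd'.
apply: (@supersolution_nonneg_bound _ phi (fun s => expR (lam * s))
  (exp_super lam d') a b d e x) => //.
- exact: ltW.
- by apply: Omega_le xO; rewrite !ltW.
- by apply: exp_super_concave; rewrite // (ltW d0).
- by apply: continuous_subspaceT; exact: exp_super_continuous.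
- by move=> u; rewrite exp_super_boundary// ltW.
- move=> s; apply: continuous_comp; last exact: continuous_expR.
  by apply: cvgM; [exact: cvg_cst|exact: cvg_id].
- move=> n; exists ((1 - lam * d')^-1 * expR (lam * n%:R)) => z /andP[z1 _] zn.
  have /andP[h1 h2] := exp_super_bounds l0 (ltW d'0) ld' z1.
  rewrite ger0_norm// (le_trans h2)// ler_pM2l ?invr_gt0 ?subr_gt0//.
  by rewrite ler_expR ler_pM2l// (le_trans (ler_norm _)).
Qed.

(** Bounds the mean of [cosh2 lam (phi - x.1)], by the exponential estimate for phi and for -phi. On
    the lower boundary it equals 2, the minimum of [cosh2]. *)
Definition cosh_mean x : R := 2 * exp_super lam d' (0, x.2 - x.1 ^+ 2).

Lemma exp_super_shift x :
  exp_super lam d' x = expR (lam * x.1) * exp_super lam d' (0, x.2 - x.1 ^+ 2).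
Proof.
rewrite /exp_super (_ : gap d' (0, _) = gap d' x); last first.
  by rewrite /gap /= expr0n subr0.
rewrite mulrCA -expRD /=; congr (_ * expR _); ring.
Qed.

Lemma integrable_exp phi x : mean_data a b e phi x ->
  mu.-integrable `]a, b] (EFin \o (fun t => expR (lam * phi t))).
Proof.
move=> md; have [[mphi _] _ _ _ _] := md; apply/integrableP; split.
  apply/measurable_EFinP; apply: measurable_funTS; apply: measurableT_comp => //.
  by apply: measurable_funM; [exact: measurable_cst|].
under eq_integral do rewrite /= ger0_norm ?expR_ge0//.
by apply: le_lt_trans (exp_mean md) _; rewrite ltry.
Qed.

Lemma integrable_cosh2 phi x u : mean_data a b e phi x ->
  mu.-integrable `]a, b] (EFin \o (fun t => cosh2 lam (phi t - u))) /\
  \int[mu]_(t in `]a, b]) cosh2 lam (phi t - u) <= (b - a) *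
   (expR (lam * (x.1 - u)) + expR (lam * (u - x.1))) *
   exp_super lam d' (0, x.2 - x.1 ^+ 2).
Proof.
move=> md; have mdN := mean_dataN md.
have i1 := integrable_exp md; have i2 := integrable_exp mdN.
have le1 : \int[mu]_(t in `]a, b]) expR (lam * phi t) <= (b - a) * exp_super lam d' x.
  by rewrite -lee_fin fineK ?exp_mean//; exact: integrable_fin_num i1.
have le2 : \int[mu]_(t in `]a, b]) expR (lam * - phi t) <=
    (b - a) * exp_super lam d' (- x.1, x.2).
  by rewrite -lee_fin fineK; [exact: (exp_mean mdN)|exact: integrable_fin_num i2].
have cE t : cosh2 lam (phi t - u) = expR (- (lam * u)) * expR (lam * phi t) +
    expR (lam * u) * expR (lam * - phi t).
  by rewrite /cosh2 -!expRD; congr (expR _ + expR _); ring.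
have j1 : mu.-integrable `]a, b]
    (EFin \o (fun t => expR (- (lam * u)) * expR (lam * phi t))).
  suff : mu.-integrable `]a, b] (fun t => (expR (- (lam * u)))%:E *
    (EFin \o (fun t => expR (lam * phi t))) t)%E by exact: eq_integrable.
  exact: integrableZl.
have j2 : mu.-integrable `]a, b]
    (EFin \o (fun t => expR (lam * u) * expR (lam * - phi t))).
  suff : mu.-integrable `]a, b] (fun t => (expR (lam * u))%:E *
    (EFin \o (fun t => expR (lam * - phi t))) t)%E by exact: eq_integrable.
  exact: integrableZl.
split.
  suff : mu.-integrable `]a, b] (fun t =>
      (EFin \o (fun t => expR (- (lam * u)) * expR (lam * phi t))%R) t +
      (EFin \o (fun t => expR (lam * u) * expR (lam * - phi t))%R) t)%E.
    by apply: eq_integrable => // t _; rewrite /= cE.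
  exact: integrableD.
under eq_Rintegral do rewrite cE.
rewrite RintegralD// !RintegralZl//.
apply: (@le_trans _ _ (expR (- (lam * u)) * ((b - a) * exp_super lam d' x) +
   expR (lam * u) * ((b - a) * exp_super lam d' (- x.1, x.2)))).
  by rewrite lerD// ler_pM2l ?expR_gt0.
rewrite (exp_super_shift (- x.1, x.2)) (exp_super_shift x) /= sqrrN.
rewrite mulrBr (mulrBr lam u) !expRD !mulrN; lra.
Qed.

Lemma growth_integrable f C phi x : 0 <= C -> continuous f ->
  (forall s, `|f s| <= C * cosh2 lam s) -> mean_data a b e phi x ->
  mu.-integrable `]a, b] (EFin \o (f \o phi)) /\
  mu.-integrable `]a, b] (EFin \o (fun t => C * cosh2 lam (phi t))).
Proof.
move=> C0 cf fC md; have [ic _] := integrable_cosh2 0 md.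
have [[mphi _] _ _ _ _] := md.
have iC : mu.-integrable `]a, b] (EFin \o (fun t => C * cosh2 lam (phi t))).
  suff : mu.-integrable `]a, b] (fun t => C%:E *
    (EFin \o (fun t => cosh2 lam (phi t - 0))) t)%E.
    by apply: eq_integrable => // t _; rewrite /= subr0.
  exact: integrableZl.
split => //; apply: le_integrable iC => //.
  apply/measurable_EFinP; apply: measurable_funTS; apply: measurableT_comp => //.
  exact: continuous_measurable_fun.
move=> t _ /=; rewrite lee_fin (le_trans (fC _))//; exact: ler_norm.
Qed.

(** Here [G] lives on the strip of phi itself; the truncation lemma is used with d = e. *)
Lemma mean_le_Lambda f C G phi x : 0 <= C -> continuous f ->
  (forall s, `|f s| <= C * cosh2 lam s) -> mean_data a b e phi x -> Lambda e f G ->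
  \int[mu]_(t in `]a, b]) f (phi t) <= (b - a) * G x.
Proof.
move=> C0 cf fC md [Gcont Gconc Gf]; have [bphi i1 E1 E2 xO] := md.
have [_ iC] := growth_integrable C0 cf fC md.
apply: (@supersolution_integrable_bound _ phi f G a b e e x e0 (lexx e) ab bphi i1
  E1 E2 xO (locally_concave_segment Gconc) Gcont Gf cf _ (fun s => C * cosh2 lam s)).
- by move=> n; exact: within_continuous_bounded.
- apply: measurable_funM; first exact: measurable_cst.
  have me k : measurable_fun setT (fun s : R => expR (k * s)).
    exact: measurableT_comp.
  have -> : cosh2 lam = (fun t => expR (lam * t) + expR (- lam * t)).
    by apply/funext => t; rewrite /cosh2 mulNr.
  by apply: measurable_funD; exact: me.
- exact: iC.
- by move=> s t st; rewrite (le_trans (fC _))// ler_wpM2l// cosh2_le// ltW.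
Qed.

(** The linear term integrates to 0 because [x.1] is the mean of phi. *)
Lemma mean_taylor f C K D phi x : 0 <= C -> continuous f ->
  (forall s, `|f s| <= C * cosh2 lam s) -> 0 <= K ->
  (forall s, f s <= f x.1 + D * (s - x.1) + K * (cosh2 lam (s - x.1) - 2)) ->
  mean_data a b e phi x ->
  \int[mu]_(t in `]a, b]) f (phi t) <= (b - a) * (f x.1 + K * (cosh_mean x - 2)).
Proof.
move=> C0 cf fC K0 fT md; have [bphi i1 E1 E2 xO] := md.
have [if_ _] := growth_integrable C0 cf fC md.
have [ic le] := integrable_cosh2 x.1 md.
pose p t := D * phi t; pose q t := K * cosh2 lam (phi t - x.1).
have ip : mu.-integrable `]a, b] (EFin \o p).
  suff : mu.-integrable `]a, b] (fun t => D%:E * (EFin \o phi) t)%E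
    by exact: eq_integrable.
  exact: integrableZl.
have iq : mu.-integrable `]a, b] (EFin \o q).
  suff : mu.-integrable `]a, b] (fun t => K%:E *
    (EFin \o (fun t => cosh2 lam (phi t - x.1))) t)%E by exact: eq_integrable.
  exact: integrableZl.
have ipq : mu.-integrable `]a, b] (EFin \o (fun t => p t + q t)).
  suff : mu.-integrable `]a, b] (fun t => (EFin \o p) t + (EFin \o q) t)%E
    by exact: eq_integrable.
  exact: integrableD.
pose c := f x.1 - D * x.1 - K * 2.
have ic' := @integrable_oc_cst R c a b.
apply: (@le_trans _ _ (\int[mu]_(t in `]a, b]) (p t + q t + c))).
  apply: le_Rintegral => //.
    suff : mu.-integrable `]a, b] (fun t => (EFin \o (fun t => (p t + q t)%R)) t +
      (EFin \o cst c) t)%E by exact: eq_integrable.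
    exact: integrableD.
  by move=> t _; rewrite (le_trans (fT _))// /p /q /c; lra.
rewrite RintegralD// RintegralD// Rintegral_oc_cst ?(ltW ab)//.
rewrite RintegralZl// RintegralZl// E1.
have {}le : K * \int[mu]_(t in `]a, b]) cosh2 lam (phi t - x.1) <=
    K * ((b - a) * cosh_mean x).
  rewrite ler_wpM2l// (le_trans le)// subrr mulr0 expR0 /cosh_mean; lra.
by rewrite /c; lra.
Qed.

End fixed_domain.

End mean_estimates.

(** * The discrete supremum *)

Section discrete_supremum.
Context {R : realType}.
Notation mu := (@lebesgue_measure R).
Implicit Types (f : R -> R) (M : R * R -> R) (s : seq (R * R)) (x y p : R * R).
Implicit Types (e d lam t u v : R).

Definition mass_data e x s := [/\ monotone_bmo e s, wsum (cst 1) s = 1,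
  wsum id s = x.1 & wsum (fun v => v ^+ 2) s = x.2].

Definition discrete_sup e f x : R := sup [set wsum f s | s in mass_data e x].

Lemma mass_data_exists e x : 0 < e -> Omega e x -> exists s, mass_data e x s.
Proof.
(* Two equal atoms at distance [h], the standard deviation, from the mean. *)
move=> e0 /andP[x1 x2]; pose h := Num.sqrt (x.2 - x.1 ^+ 2).
have h2 : h ^+ 2 = x.2 - x.1 ^+ 2 by rewrite sqr_sqrtr// subr_ge0.
exists [:: (x.1 - h, 2^-1); (x.1 + h, 2^-1)].
have W g : wsum g [:: (x.1 - h, 2^-1); (x.1 + h, 2^-1)] =
    (g (x.1 - h) + g (x.1 + h)) / 2.
  by rewrite /wsum !big_cons big_nil/=; field.
split.
- split=> [p|lam [lam01 _]]; first by rewrite !inE => /orP[|] /eqP -> /=.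
  rewrite /disc_sum !W; have := lam01 (x.1 - h); have := lam01 (x.1 + h).
  set l1 := lam _; set l2 := lam _ => /andP[l10 _] /andP[l20 _].
  have -> : disc e ((l2 + l1) / 2) ((l2 * (x.1 - h) + l1 * (x.1 + h)) / 2)
      ((l2 * (x.1 - h) ^+ 2 + l1 * (x.1 + h) ^+ 2) / 2) =
      (e ^+ 2 * (l1 - l2) ^+ 2 / 4) + (e ^+ 2 - h ^+ 2) * (l1 * l2).
    by rewrite /disc; field.
  have eh : 0 <= e ^+ 2 - h ^+ 2 by rewrite h2 subr_ge0 lerBlDl.
  have h1 := mulr_ge0 (sqr_ge0 e) (sqr_ge0 (l1 - l2)).
  by rewrite addr_ge0 ?(mulr_ge0 eh (mulr_ge0 l10 l20))// divr_ge0.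
- by rewrite W /=; field.
- by rewrite W /=; field.
- rewrite W /= (_ : _ / 2 = x.1 ^+ 2 + h ^+ 2); last by field.
  by rewrite h2 subrKC.
Qed.

Lemma disc_segment e x y A B : Omega e x -> Omega e y -> segment_in e x y ->
  0 <= A -> 0 <= B -> 0 <= disc e (A + B) (A * x.1 + B * y.1) (A * x.2 + B * y.2).
Proof.
move=> xO yO seg A0 B0; have [AB|AB] := eqVneq (A + B) 0.
  have [-> ->] : A = 0 /\ B = 0 by split; lra.
  by rewrite !mul0r !addr0 /disc expr0n /=; lra.
have AB0 : 0 < A + B by rewrite lt0r AB addr_ge0.
have t01 : 0 <= B / (A + B) <= 1.
  apply/andP; split; first by rewrite divr_ge0// ltW.
  by rewrite ler_pdivrMr// mul1r lerDr.
have /andP[_] := seg _ t01; set t := B / (A + B) => /=.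
have tA : (A + B) * (1 - t) = A by rewrite /t; field.
have tB : (A + B) * t = B by rewrite /t; field.
clearbody t => {t01}.
set Q := (1 - t) * x.1 + t * y.1; set r := (1 - t) * x.2 + t * y.2 => h.
have -> : A * x.1 + B * y.1 = (A + B) * Q by rewrite mulrDr !mulrA tA tB.
have -> : A * x.2 + B * y.2 = (A + B) * r by rewrite mulrDr !mulrA tA tB.
rewrite /disc (_ : _ + _ = (A + B) ^+ 2 * (Q ^+ 2 + e ^+ 2 - r)); last by ring.
by rewrite mulr_ge0 ?sqr_ge0// subr_ge0.
Qed.

Lemma mass_data_mix e x y t s1 s2 : 0 < e -> Omega e x -> Omega e y ->
  segment_in e x y -> 0 <= t <= 1 -> mass_data e x s1 -> mass_data e y s2 ->
  mass_data e ((1 - t) * x.1 + t * y.1, (1 - t) * x.2 + t * y.2)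
    (scale (cst (1 - t)) s1 ++ scale (cst t) s2).
Proof.
move=> e0 xO yO seg /andP[t0 t1] [m1 c1 f1 q1] [m2 c2 f2 q2].
have t1' : 0 <= 1 - t by rewrite subr_ge0.
have W g : wsum g (scale (cst (1 - t)) s1 ++ scale (cst t) s2) =
    (1 - t) * wsum g s1 + t * wsum g s2.
  by rewrite wsum_cat !wsum_scale /= !wsumZ.
split; rewrite ?W ?c1 ?c2 ?f1 ?f2 ?q1 ?q2 ?mulr1 ?subrK//.
apply: monotone_bmo_cat => //; do ?exact: monotone_bmo_scale_cst.
move=> A B A0 B0; rewrite !wsum_scale /= !wsumZ c1 c2 f1 f2 q1 q2 !mulr1 !mulrA.
by apply: disc_segment => //; rewrite mulr_ge0.
Qed.

(** Prolong [r, q] by [eta] to one side, still inside [-e, e]. Concavity on the longer interval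
    bounds the slope by the oscillation 2 N divided by [eta]; the two sides give the two signs. *)
Lemma concave_lipschitz (h : R -> R) (e eta N : R) : 0 < eta ->
  (forall r q t, - e <= r <= e -> - e <= q <= e -> 0 <= t <= 1 ->
    (1 - t) * h r + t * h q <= h ((1 - t) * r + t * q)) ->
  (forall r, - e <= r <= e -> `|h r| <= N) ->
  forall r q, `|r| <= e - eta -> `|q| <= e - eta ->
  `|h r - h q| <= 2 * N / eta * `|r - q|.
Proof.
move=> eta0 hc hN.
have N0 r : - e <= r <= e -> 0 <= N by move=> /hN; apply: le_trans.
suff H r q : r < q -> `|r| <= e - eta -> `|q| <= e - eta ->
    `|h r - h q| <= 2 * N / eta * `|r - q|.
  move=> r q re qe; have [rq|qr|->] := ltgtP r q; first exact: H.
    by rewrite distrC [`|r - q|]distrC; exact: H.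
  by rewrite !subrr normr0 mulr0.
move=> rq; rewrite !ler_norml => /andP[r1 r2] /andP[q1 q2].
have rqe : 0 < q - r + eta by lra.
have reI : - e <= r <= e by apply/andP; split; lra.
have qeI : - e <= q <= e by apply/andP; split; lra.
have bound (w z : R) : `|w| <= N -> `|z| <= N ->
   (q - r) / (q - r + eta) * (w - z) <= 2 * N / eta * (q - r).
  move=> wN zN; have wz : w - z <= 2 * N.
    by have := ler_normB w z; have := ler_norm (w - z); lra.
  have k0 : 0 <= (q - r) / (q - r + eta) by rewrite divr_ge0//; lra.
  rewrite (le_trans (ler_wpM2l k0 wz))//.
  have NN : 0 <= 2 * N by have := N0 _ reI; lra.
  rewrite (_ : 2 * N / eta * (q - r) = (q - r) / eta * (2 * N)); last by ring.
  rewrite ler_wpM2r// ler_pM2l ?subr_gt0// lef_pV2 ?posrE//; lra.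
have chord (w z : R) : - e <= w <= e -> - e <= z <= e -> 0 < z - w ->
    forall v, w <= v <= z ->
    (z - v) / (z - w) * h w + (v - w) / (z - w) * h z <= h v.
  move=> we ze zw v /andP[wv vz]; pose t := (v - w) / (z - w).
  have t01 : 0 <= t <= 1.
    rewrite /t divr_ge0 ?subr_ge0 ?(ltW zw)//=; last by rewrite -subr_ge0 ltW.
    by rewrite ler_pdivrMr// mul1r; lra.
  have := hc w z t we ze t01.
  rewrite (_ : (1 - t) * w + t * z = v); last by rewrite /t; field; rewrite gt_eqF.
  by rewrite (_ : 1 - t = (z - v) / (z - w))//; rewrite /t; field; rewrite gt_eqF.
rewrite [`|r - q|]ltr0_norm ?subr_lt0// opprB; apply/andP; split.
  have reI' : - e <= r - eta <= e by apply/andP; split; lra.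
  have zw : 0 < q - (r - eta) by lra.
  have := chord _ _ reI' qeI zw r; rewrite (_ : q - (r - eta) = q - r + eta); last ring.
  have -> : r - (r - eta) = eta by ring.
  move=> /(_ _)/wrap[]; first by apply/andP; split; lra.
  have := bound _ _ (hN _ reI') (hN _ qeI).
  have -> : eta / (q - r + eta) * h q = h q - (q - r) / (q - r + eta) * h q.
    by field; rewrite gt_eqF.
  rewrite mulrBr; have := bound _ _ (hN _ qeI) (hN _ reI'); rewrite mulrBr; lra.
have qeI' : - e <= q + eta <= e by apply/andP; split; lra.
have zw : 0 < q + eta - r by lra.
have := chord _ _ reI qeI' zw q; rewrite (_ : q + eta - r = q - r + eta); last ring.
have -> : q + eta - q = eta by ring.
move=> /(_ _)/wrap[]; first by apply/andP; split; lra.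
have -> : eta / (q - r + eta) * h r = h r - (q - r) / (q - r + eta) * h r.
  by field; rewrite gt_eqF.
have := bound _ _ (hN _ reI) (hN _ qeI'); rewrite mulrBr; lra.
Qed.

(** The intersection of the tangents to the upper parabola at abscissae [u] and [v]; varying one
    parameter moves the point along a tangent. *)
Definition tangent_point e u v : R * R := ((u + v) / 2, e ^+ 2 + u * v).

Lemma tangent_pointE e x : Omega e x ->
  x = tangent_point e (x.1 + gap e x) (x.1 - gap e x).
Proof.
move=> xO; have g2 := gap_sqr xO; rewrite [LHS]surjective_pairing /tangent_point.
congr (_, _); first by field.
by rewrite mulrC -subr_sqr g2; ring.
Qed.

(** At horizontal offset r from the tangency point the variance is e^2 - r^2, so the tangent is in
    the strip for |r| <= e and [concave_lipschitz] applies. *)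
Lemma tangent_lipschitz e M c (eta N : R) : 0 < eta -> segment_concave e M ->
  (forall x, Omega e x -> `|x.1 - c| <= e -> `|M x| <= N) ->
  forall r q, `|r| <= e - eta -> `|q| <= e - eta ->
  `|M (c + r, c ^+ 2 + e ^+ 2 + 2 * c * r) - M (c + q, c ^+ 2 + e ^+ 2 + 2 * c * q)|
    <= 2 * N / eta * `|r - q|.
Proof.
move=> eta0 Mc MN.
have TO r : - e <= r <= e -> Omega e (c + r, c ^+ 2 + e ^+ 2 + 2 * c * r).
  move=> /andP[r1 r2]; rewrite /Omega/=.
  have h : 0 <= (e - r) * (e + r) by rewrite mulr_ge0 ?subr_ge0// -lerBlDl sub0r.
  by have h' := sqr_ge0 r; apply/andP; split; lra.
apply: (@concave_lipschitz (fun r => M (c + r, c ^+ 2 + e ^+ 2 + 2 * c * r)) e) => //.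
- move=> r q t re qe t01.
  have := Mc _ _ (TO r re) (TO q qe) _ t t01 => /(_ _)/wrap[].
    move=> k /andP[k0 k1] /=.
    rewrite (_ : (1 - k) * (c + r) + k * (c + q) = c + ((1 - k) * r + k * q)); last ring.
    rewrite (_ : (1 - k) * (c ^+ 2 + e ^+ 2 + 2 * c * r) +
      k * (c ^+ 2 + e ^+ 2 + 2 * c * q) = c ^+ 2 + e ^+ 2 + 2 * c * ((1 - k) * r + k * q)); last ring.
    apply: TO; move: re qe => /andP[? ?] /andP[? ?]; apply/andP; split; nra.
  move=> /le_trans; apply; rewrite /= le_eqVlt; apply/orP; left; apply/eqP.
  by congr (M (_, _)); ring.
- move=> r re; apply: MN; first exact: TO.
  by rewrite /= addrAC subrr add0r ler_norml.
Qed.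

End discrete_supremum.

(** * The discrete supremum belongs to Lambda *)

Section discrete_sup_Lambda.
Context {R : realType}.
Notation mu := (@lebesgue_measure R).
Implicit Types (s : seq (R * R)) (x y p : R * R) (t u v r : R).
Variables (lam e d d' C K0 : R) (f df : R -> R).
Hypotheses (l0 : 0 < lam) (e0 : 0 < e) (ed : e < d) (dd' : d < d') (ld' : lam * d' < 1).
Hypotheses (C0 : 0 <= C) (cf : continuous f) (fC : forall t, `|f t| <= C * cosh2 lam t).
Hypotheses (K00 : 0 <= K0) (fT : forall u t, `|f t - (f u + df u * (t - u))| <=
  K0 * expR (lam * `|u|) * (cosh2 lam (t - u) - 2)).

Let K u := K0 * expR (lam * `|u|).
Let M := discrete_sup e f.
Let B x := K x.1 * (cosh_mean lam d' x - 2).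

Let K_ge0 u : 0 <= K u. Proof. by rewrite mulr_ge0 ?expR_ge0. Qed.

(** Realize the distribution as a function on [0, 1] and apply [mean_taylor] to [f] and to [- f].
    This estimate yields the finiteness of the supremum, its boundary values and its continuity at
    the lower boundary. *)
Let wsum_bound x s : Omega e x -> mass_data e x s -> `|wsum f s - f x.1| <= B x.
Proof.
move=> xO [sM s1 sx sxx].
have [phi [bmo mE]] := step_function_bmo sM s1 (@ltr01 R) true false.
have := mE id; rewrite sx => m1; have := mE (fun v => v ^+ 2); rewrite sxx => m2.
have md := BMO_mean_data ltr01 bmo m1 m2 xO.
have [mphi _] := BMO_bmo_fun ltr01 bmo.
have E : \int[mu]_(t in `]0, 1]) f ((phi \_ `]0, 1[) t) = wsum f s.
  have := mE f; rewrite (mean_patch _ _ ltr01 mphi (continuous_measurable_fun cf)).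
  by rewrite subr0 invr1 mul1e /Rintegral => ->.
have up := @mean_taylor R lam e d d' 0 1 l0 e0 ed dd' ld' ltr01 f C (K x.1) (df x.1)
  _ x C0 cf fC (K_ge0 _) _ md.
have lo := @mean_taylor R lam e d d' 0 1 l0 e0 ed dd' ld' ltr01 (fun t => - f t) C
  (K x.1) (- df x.1) _ x C0 _ _ (K_ge0 _) _ md.
have {}up : wsum f s <= f x.1 + B x.
  rewrite -E (le_trans (up _))// ?subr0 ?mul1r// => t.
  by have := fT x.1 t; rewrite ler_norml => /andP[_]; rewrite -/(K _); lra.
have {}lo : - wsum f s <= - f x.1 + B x.
  rewrite -E -mulN1r -RintegralZl//; last first.
    by have [] := @growth_integrable R lam e d d' 0 1 l0 e0 ed dd' ld' ltr01 f C _ x C0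
      cf fC md.
  under eq_Rintegral do rewrite mulN1r.
  rewrite (le_trans (lo _ _ _))// ?subr0 ?mul1r//.
  - by move=> t; apply: cvgN; exact: cf.
  - by move=> t; rewrite normrN.
  - move=> t; have := fT x.1 t; rewrite ler_norml => /andP[+ _]; rewrite -/(K _); lra.
by rewrite ler_norml; apply/andP; split; lra.
Qed.

Lemma discrete_sup_ub x s : Omega e x -> mass_data e x s -> wsum f s <= M x.
Proof.
move=> xO sx; apply: ub_le_sup; last by exists s.
exists (f x.1 + B x) => _ [s' s'x <-].
by have := wsum_bound xO s'x; rewrite ler_norml => /andP[_]; lra.
Qed.

Lemma discrete_sup_le x z : Omega e x ->
  (forall s, mass_data e x s -> wsum f s <= z) -> M x <= z.
Proof.
move=> xO H; apply: ge_sup; last by move=> _ [s sx <-]; exact: H.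
by have [s sx] := mass_data_exists e0 xO; exists (wsum f s), s.
Qed.

Let sup_bound x : Omega e x -> `|M x - f x.1| <= B x.
Proof.
move=> xO; have [s sx] := mass_data_exists e0 xO.
have := discrete_sup_ub xO sx; have := wsum_bound xO sx.
rewrite !ler_norml => /andP[h1 h2] h3; apply/andP; split; first lra.
rewrite lerBlDl; apply: discrete_sup_le => // s' s'x.
by have := wsum_bound xO s'x; rewrite ler_norml => /andP[_]; lra.
Qed.

(** Mix nearly optimal distributions for [x] and [y]. *)
Let sup_concave : segment_concave e M.
Proof.
move=> x y xO yO seg t t01; have /andP[t0 t1] := t01.
have zO := seg _ t01; apply/ler_addgt0Pr => eta eta0.
have hs z : Omega e z -> exists2 s, mass_data e z s & M z - eta < wsum f s.
  move=> zO'; have hz : has_sup [set wsum f s | s in mass_data e z].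
    split; first by have [s sz] := mass_data_exists e0 zO'; exists (wsum f s), s.
    by exists (M z) => _ [s sz <-]; exact: discrete_sup_ub.
  by have [_ [s sz <-] lt] := sup_adherent eta0 hz; exists s.
have [s1 s1x h1] := hs x xO; have [s2 s2y h2] := hs y yO.
have := discrete_sup_ub zO (mass_data_mix e0 xO yO seg t01 s1x s2y).
rewrite wsum_cat !wsum_scale /= !wsumZ.
have t1' : 0 <= 1 - t by rewrite subr_ge0.
have := ler_wpM2l t1' (ltW h1); have := ler_wpM2l t0 (ltW h2); lra.
Qed.

Let d'0 : 0 < d'. Proof. exact: lt_trans (lt_trans e0 ed) dd'. Qed.

Let cosh_mean_boundary u : cosh_mean lam d' (u, u ^+ 2) = 2.
Proof.
rewrite /cosh_mean /= subrr -[X in (_, X)](@expr0n R 2%N).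
by rewrite exp_super_boundary ?(ltW d'0)// mulr0 expR0 mulr1.
Qed.

Let sup_boundary u : M (u, u ^+ 2) = f u.
Proof.
have uO : Omega e (u, u ^+ 2) by rewrite /Omega/= lexx lerDl sqr_ge0.
have := sup_bound uO; rewrite /B cosh_mean_boundary subrr mulr0 normr_le0 subr_eq0.
by move=> /eqP.
Qed.

Let continuous_K : continuous K.
Proof.
move=> u; apply: cvgM; first exact: cvg_cst.
apply: (@continuous_comp _ _ _ (fun u => lam * `|u|) expR); last exact: continuous_expR.
by apply: cvgM; [exact: cvg_cst|apply: cvg_norm; exact: cvg_id].
Qed.

Let continuous_B : continuous B.
Proof.
move=> x; apply: cvgM.
  by apply: (@continuous_comp _ _ _ fst K); [exact: cvg_fst|exact: continuous_K].
apply: cvgB; last exact: cvg_cst.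
apply: cvgM; first exact: cvg_cst.
apply: (@continuous_comp _ _ _ (fun x : R * R => (0 : R, x.2 - x.1 ^+ 2))
  (exp_super lam d')); last exact: exp_super_continuous.
have h : (y.2 - y.1 ^+ 2) @[y --> x] --> x.2 - x.1 ^+ 2.
  by apply: cvgB; [exact: cvg_snd|apply: cvgM; exact: cvg_fst].
exact: (cvg_pair (cvg_cst (0 : R)) h).
Qed.

Let continuous_f1 : continuous (fun x : R * R => f x.1).
Proof. by move=> x; apply: (@continuous_comp _ _ _ fst f); [exact: cvg_fst|exact: cf]. Qed.

Let sup_local_bound (c r : R) :
  exists N, forall x, Omega e x -> `|x.1 - c| <= r -> `|M x| <= N.
Proof.
exists (C * cosh2 lam (`|c| + r) + K (`|c| + r) * (2 * (1 - lam * d')^-1)) => x xO xr.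
have r0 : 0 <= r by exact: le_trans xr.
have x1 : `|x.1| <= `|(`|c| + r)|.
  rewrite (ger0_norm (addr_ge0 _ r0))// addrC -lerBlDr.
  by rewrite (le_trans (lerB_dist _ _)).
have := sup_bound xO => h.
have := ler_normD (f x.1) (M x - f x.1); rewrite subrKC => /le_trans; apply.
apply: lerD; first by rewrite (le_trans (fC _))// ler_wpM2l// cosh2_le// ltW.
rewrite (le_trans h)// /B.
have /andP[x12 _] := xO.
have x0 : (0 : R, x.2 - x.1 ^+ 2).1 ^+ 2 <= (0 : R, x.2 - x.1 ^+ 2).2.
  by rewrite /= expr0n/= subr_ge0.
have /andP[_] := exp_super_bounds l0 (ltW d'0) ld' x0; rewrite /= mulr0 expR0 mulr1 => E.
apply: (@le_trans _ _ (K x.1 * (2 * (1 - lam * d')^-1))).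
  by rewrite ler_wpM2l// /cosh_mean; lra.
rewrite ler_wpM2r ?mulr_ge0 ?invr_ge0 ?subr_ge0 ?(ltW ld')//.
by rewrite ler_wpM2l// ler_expR ler_pM2l.
Qed.

(* Away from the lower boundary every point is joined to its neighbours by two
   steps along lines tangent to the upper boundary. *)
Let sup_continuous_inside p : Omega e p -> gap e p < e ->
  M x @[x --> within (Omega e) (nbhs p)] --> M p.
Proof.
(* Since [gap e p = e - 2 * eta], one [eta] can be spent on moving the point and the other is left
   for [tangent_lipschitz]. *)
move=> pO gp; pose eta := (e - gap e p) / 2.
have eta0 : 0 < eta by rewrite divr_gt0// subr_gt0.
have [N HN] := sup_local_bound p.1 (eta + eta + e + e).
have pN : `|p.1 - p.1| <= eta + eta + e + e.
  by rewrite subrr normr0 !addr_ge0// ltW.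
have N0 : 0 <= N := le_trans (normr_ge0 _) (HN p pO pN).
pose L := 2 * N / eta; have L0 : 0 <= L by rewrite /L divr_ge0 ?(ltW eta0)// mulr_ge0.
set u0 := p.1 + gap e p; set v0 := p.1 - gap e p.
have pE : p = tangent_point e u0 v0 by exact: tangent_pointE.
have g0 := gap_ge0 e p.
have step1 u u' v : v <= u -> v <= u' -> (u - v) / 2 <= e - eta ->
    (u' - v) / 2 <= e - eta -> `|v - v0| <= eta ->
    `|M (tangent_point e u v) - M (tangent_point e u' v)| <= L * `|u - u'|.
  move=> vu vu' us us' vv.
  have TE w : tangent_point e w v =
      (v + (w - v) / 2, v ^+ 2 + e ^+ 2 + 2 * v * ((w - v) / 2)).
    by rewrite /tangent_point; congr (_, _); field.
  rewrite !TE; apply: (le_trans (@tangent_lipschitz _ e M v eta N eta0 sup_concave _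
    ((u - v) / 2) ((u' - v) / 2) _ _)).
  - move=> x xO xv; apply: HN => //.
    rewrite (_ : x.1 - p.1 = (x.1 - v) + (v - v0) - gap e p); last by rewrite /v0; ring.
    by rewrite (le_trans (ler_normB _ _))// (ger0_norm g0) (le_trans (lerD (ler_normD _ _) (lexx _)))//; lra.
  - by rewrite ger0_norm// divr_ge0// subr_ge0.
  - by rewrite ger0_norm// divr_ge0// subr_ge0.
  rewrite (_ : (u - v) / 2 - (u' - v) / 2 = (u - u') / 2); last by field.
  by rewrite ler_wpM2l// normrM [X in _ * X]ger0_norm// ler_piMr//; lra.
have step2 u v v' : v <= u -> v' <= u -> (u - v) / 2 <= e - eta ->
    (u - v') / 2 <= e - eta -> `|u - u0| <= eta ->
    `|M (tangent_point e u v) - M (tangent_point e u v')| <= L * `|v - v'|.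
  move=> vu vu' us us' uu.
  have TE w : tangent_point e u w =
      (u + (w - u) / 2, u ^+ 2 + e ^+ 2 + 2 * u * ((w - u) / 2)).
    by rewrite /tangent_point; congr (_, _); field.
  rewrite !TE; apply: (le_trans (@tangent_lipschitz _ e M u eta N eta0 sup_concave _
    ((v - u) / 2) ((v' - u) / 2) _ _)).
  - move=> x xO xu; apply: HN => //.
    rewrite (_ : x.1 - p.1 = (x.1 - u) + (u - u0) + gap e p); last by rewrite /u0; ring.
    by rewrite (le_trans (ler_normD _ _))// (ger0_norm g0) (le_trans (lerD (ler_normD _ _) (lexx _)))//; lra.
  - by rewrite ler0_norm ?pmulr_lle0 ?invr_gt0 ?subr_le0//; lra.
  - by rewrite ler0_norm ?pmulr_lle0 ?invr_gt0 ?subr_le0//; lra.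
  rewrite (_ : (v - u) / 2 - (v' - u) / 2 = (v - v') / 2); last by field.
  by rewrite ler_wpM2l// normrM [X in _ * X]ger0_norm// ler_piMr//; lra.
apply/cvgrPdist_le => eps eps0.
have L1 : 0 < 2 * L + 1 by rewrite ltr_wpDl// mulr_ge0.
clearbody L; pose dlt := Num.min eta (eps / (2 * L + 1)).
have dlt0 : 0 < dlt by rewrite lt_min eta0 divr_gt0.
have cu : x.1 + gap e x @[x --> p] --> u0.
  by apply: cvgD; [exact: cvg_fst|exact: gap_continuous].
have cv : x.1 - gap e x @[x --> p] --> v0.
  by apply: cvgB; [exact: cvg_fst|exact: gap_continuous].
move/cvgrPdist_le : cu => /(_ _ dlt0) cu; move/cvgrPdist_le : cv => /(_ _ dlt0) cv.
rewrite near_withinE; near=> x => xO.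
have uu : `|u0 - (x.1 + gap e x)| <= dlt by near: x.
have vv : `|v0 - (x.1 - gap e x)| <= dlt by near: x.
set u := x.1 + gap e x in uu; set v := x.1 - gap e x in vv.
have xE : x = tangent_point e u v by exact: tangent_pointE.
have gx := gap_ge0 e x.
have de : dlt <= eta by rewrite ge_min lexx.
have d1 : (2 * L + 1) * dlt <= eps.
  by rewrite -ler_pdivlMl// mulrC ge_min lexx orbT.
have Ld : L * dlt + L * dlt <= eps by lra.
have uv : v <= u by rewrite /u /v; lra.
have uv0 : v0 <= u0 by rewrite /u0 /v0; lra.
have uv0s : (u0 - v0) / 2 = e - 2 * eta by rewrite /u0 /v0 /eta; field.
have uu' : `|u - u0| <= dlt by rewrite distrC.
have vv' : `|v - v0| <= dlt by rewrite distrC.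
have := uu'; rewrite ler_norml => /andP[a1 a2].
have := vv'; rewrite ler_norml => /andP[b1 b2].
have bnd (w w' z z' : R) : `|w| <= L * z -> `|w'| <= L * z' -> z <= dlt -> z' <= dlt ->
    `|w + w'| <= eps.
  move=> hw hw' zd zd'; rewrite (le_trans (ler_normD _ _))//.
  rewrite (le_trans (lerD hw hw'))// (le_trans _ Ld)//.
  by rewrite lerD// ler_wpM2l.
(* The intermediate point must keep its first parameter above the second; one of the two orders of
   changing the parameters achieves this. *)
rewrite xE pE distrC; have [v0u|uv0'] := leP v0 u.
  rewrite -(subrKA (M (tangent_point e u v0))).
  apply: (bnd _ _ `|v - v0| `|u - u0|) => //.
  - by apply: step2 => //; rewrite ?(le_trans uu')//; lra.
  - apply: step1 => //; [lra|lra|by rewrite subrr normr0 ltW].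
rewrite -(subrKA (M (tangent_point e u0 v))).
have vu0 : v <= u0 by lra.
apply: (bnd _ _ `|u - u0| `|v - v0|) => //.
- by apply: step1 => //; rewrite ?(le_trans vv')//; lra.
- apply: step2 => //; [lra|lra|by rewrite subrr normr0 ltW].
Unshelve. all: by end_near. Qed.

Let sup_continuous : {within Omega e, continuous M}.
Proof.
apply/subspace_continuousP => p pO; have /andP[p1 p2] := pO.
have [E|pn] := eqVneq p.2 (p.1 ^+ 2); last first.
  apply: sup_continuous_inside => //.
  rewrite /gap -[ltRHS]ger0_norm ?(ltW e0)// -sqrtr_sqr ltr_sqrt ?exprn_gt0//.
  by rewrite gtrBl subr_gt0 lt_neqAle eq_sym pn.
have pE : p = (p.1, p.1 ^+ 2) by rewrite -E -surjective_pairing.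
(* At the lower boundary continuity follows from [sup_bound], whose right-hand side tends to
   [B p]. *)
have B0 : B p = 0 by rewrite /B pE cosh_mean_boundary subrr mulr0.
have Mp : M p = f p.1 by rewrite pE sup_boundary.
apply/cvgrPdist_le => eps eps0.
have eps2 : 0 < eps / 2 by rewrite divr_gt0.
have := @continuous_B p; move/cvgrPdist_le => /(_ _ eps2) cB.
have := @continuous_f1 p; move/cvgrPdist_le => /(_ _ eps2) cf1.
rewrite near_withinE; near=> x => xO.
have h1 : `|B p - B x| <= eps / 2 by near: x.
have h2 : `|f p.1 - f x.1| <= eps / 2 by near: x.
suff: `|M p - M x| <= eps by [].
rewrite Mp -(subrKA (f x.1)) (le_trans (ler_normD _ _))//.
have h3 := sup_bound xO; rewrite distrC in h3.
have : B x <= eps / 2.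
  by move: h1; rewrite B0 sub0r normrN; exact: le_trans (ler_norm _).
lra.
Unshelve. all: by end_near. Qed.

Lemma discrete_sup_Lambda : Lambda e f (discrete_sup e f).
Proof.
split; [exact: sup_continuous|exact: segment_locally_concave|exact: sup_boundary].
Qed.

End discrete_sup_Lambda.

(** * The two inequalities for the Bellman function *)

Section bellman_bounds.
Context {R : realType}.
Notation mu := (@lebesgue_measure R).
Implicit Types (f : R -> R) (x : R * R) (e lam : R).

Lemma taylor_abs f (df ddf : R -> R) lam C : 0 < lam -> 0 <= C ->
  (forall t : R, is_derive t 1 f (df t)) -> (forall t : R, is_derive t 1 df (ddf t)) ->
  (forall t, `|ddf t| <= C * expR (lam * `|t|)) -> forall u t,
  `|f t - (f u + df u * (t - u))| <=
    C / lam ^+ 2 * expR (lam * `|u|) * (cosh2 lam (t - u) - 2).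
Proof.
move=> l0 C0 fd dfd ddfC u t.
have up := @taylor_upper R f df ddf lam C u l0 C0 fd dfd _ t.
have lo := @taylor_upper R (\- f) (\- df) (\- ddf) lam C u l0 C0 _ _ _ t.
have {}up := up (fun s => le_trans (ler_norm _) (ddfC s)).
rewrite ler_norml; apply/andP; split; last by lra.
suff : - f t <= - f u + - df u * (t - u) +
    C / lam ^+ 2 * expR (lam * `|u|) * (cosh2 lam (t - u) - 2) by lra.
apply: lo => s /=; try exact: is_deriveN.
by apply: le_trans (ddfC s); rewrite -normrN ler_norm.
Qed.

(** Expand at 0; the linear term is absorbed because |t| is at most [cosh2 lam t / lam]. *)
Lemma growth_of_taylor f (df : R -> R) lam K0 : 0 < lam -> 0 <= K0 ->
  (forall u t, `|f t - (f u + df u * (t - u))| <=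
     K0 * expR (lam * `|u|) * (cosh2 lam (t - u) - 2)) ->
  exists2 C, 0 <= C & forall t, `|f t| <= C * cosh2 lam t.
Proof.
move=> l0 K00 fT; exists (`|f 0| + `|df 0| / lam + K0).
  by rewrite !addr_ge0// divr_ge0// ltW.
move=> t; have c2 := cosh2_ge2 lam t.
have tc : `|t| <= cosh2 lam t / lam.
  rewrite ler_pdivlMr// mulrC (le_trans _ (exp_abs_le_cosh2 lam t))//.
  by have := expR_ge1Dx (lam * `|t|); lra.
have := fT 0 t; rewrite normr0 mulr0 expR0 mulr1 !subr0 => h.
have h1 : `|f 0 + df 0 * t| <= `|f 0| + `|df 0| * (cosh2 lam t / lam).
  by rewrite (le_trans (ler_normD _ _))// lerD2l normrM ler_wpM2l.
have h2 : `|f 0| <= `|f 0| * cosh2 lam t by rewrite ler_peMr//; lra.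
have := ler_normD (f t - (f 0 + df 0 * t)) (f 0 + df 0 * t); rewrite subrK => h3.
rewrite (le_trans h3)// (le_trans (lerD h h1))//.
rewrite (_ : (_ + _ + _) * _ = `|f 0| * cosh2 lam t + `|df 0| * (cosh2 lam t / lam) +
  K0 * cosh2 lam t); last by field; rewrite gt_eqF.
by lra.
Qed.

Lemma wsum_le_Bellman e f (I : interval R) x s : bounded_nondegenerate I ->
  mass_data e x s -> ((wsum f s)%:E <= Bellman e f I x)%E.
Proof.
move=> /bounded_nondegenerateP[c1 [c2 [a [b [ab ->]]]]] [sM s1 sx sxx].
have [phi [bmo mE]] := step_function_bmo sM s1 ab c1 c2.
apply: ereal_sup_ubound; exists phi; last exact: mE.
split => //; first by rewrite -sx -mE.
by rewrite -sxx -mE.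
Qed.

Lemma Bellman_le_Lambda e d d' lam C f (G : R * R -> R) (I : interval R) x :
  0 < lam -> 0 < e -> e < d -> d < d' -> lam * d' < 1 -> 0 <= C -> continuous f ->
  (forall t, `|f t| <= C * cosh2 lam t) -> bounded_nondegenerate I -> Omega e x ->
  Lambda e f G -> (Bellman e f I x <= (G x)%:E)%E.
Proof.
move=> l0 e0 ed dd' ld' C0 cf fC /bounded_nondegenerateP[c1 [c2 [a [b [ab ->]]]]].
move=> xO GL; apply: ge_ereal_sup => _ [phi [m1 m2 bmo] <-].
have md := BMO_mean_data ab bmo m1 m2 xO.
have [mphi _] := BMO_bmo_fun ab bmo.
have [if_ _] := growth_integrable l0 e0 ed dd' ld' ab C0 cf fC md.
have le := mean_le_Lambda l0 e0 ed dd' ld' ab C0 cf fC md GL.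
rewrite (mean_patch _ _ ab mphi (continuous_measurable_fun cf)).
rewrite -[X in (_ * X)%E]fineK; last exact: integrable_fin_num if_.
by rewrite -EFinM lee_fin ler_pdivrMl// subr_gt0.
Qed.

End bellman_bounds.

Theorem theorem2p2p11 (R : realType) (f : R -> R) (eps_inf eps : R)
    (eps_inf_gt0 : 0 < eps_inf)
    (fi : condition_i f) (fii : condition_ii eps_inf f)
    (eps_gt0 : 0 < eps) (eps_lt : eps < eps_inf)
    (I : interval R) (I_itv : bounded_nondegenerate I)
    (x : R * R) (xO : Omega eps x) :
  Bellman eps f I x = min_locally_concave eps f x.
Proof.
have [[fd dfd _] _] := fi.
pose lam := eps_inf^-1; have lam0 : 0 < lam by rewrite invr_gt0.
(* Both widths lie strictly between [eps] and [eps_inf], which gives [lam * d' < 1]. *)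
pose d' := (eps + eps_inf) / 2; pose d := (eps + d') / 2.
have ed : eps < d by rewrite /d /d'; lra.
have dd' : d < d' by rewrite /d /d'; lra.
have ld' : lam * d' < 1 by rewrite mulrC ltr_pdivrMr// mul1r /d'; lra.
have [|C1 C10 ddfC] := @stieltjes_abs_convergent_growth R lam (derive1n 2 f) (ltW lam0).
  rewrite (_ : (fun t => _) = fun t => expR (- (`|t| / eps_inf)))//.
  by apply/funext => t; rewrite mulrC.
have fd1 (t : R) : is_derive t 1 f (derive1 f t).
  by rewrite derive1E; exact/derivableP.
have fd2 (t : R) : is_derive t 1 (derive1 f) (derive1n 2 f t).
  by rewrite [derive1n 2 f t]derive1E; exact/derivableP.
have fT := taylor_abs lam0 C10 fd1 fd2 ddfC.
have K0 : 0 <= C1 / lam ^+ 2 by rewrite divr_ge0// sqr_ge0.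
have [C C0 fC] := growth_of_taylor lam0 K0 fT.
have cf : continuous f.
  by move=> t; apply/differentiable_continuous/derivable1_diffP.
apply/eqP; rewrite eq_le; apply/andP; split.
  apply: le_ereal_inf_tmp => _ [G GL <-].
  exact: (Bellman_le_Lambda lam0 eps_gt0 ed dd' ld' C0 cf fC).
have ML := discrete_sup_Lambda lam0 eps_gt0 ed dd' ld' C0 cf fC K0 fT.
apply: (@le_trans _ _ (discrete_sup eps f x)%:E).
  by apply: ereal_inf_lbound; exists (discrete_sup eps f).
have [s0 s0x] := mass_data_exists eps_gt0 xO.
have := wsum_le_Bellman f I_itv s0x.
(* One admissible distribution rules out the value -oo, and +oo is trivial. *)
case E : (Bellman eps f I x) => [r| |] // _; last by rewrite leey.
rewrite lee_fin; apply: (discrete_sup_le eps_gt0 xO) => s sx.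
by have := wsum_le_Bellman f I_itv sx; rewrite E lee_fin.
Qed.
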